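(* Let $C\subset\mathbb{R}^{n+1}$ ($n\ge 1$) be a cylindrically bounded convex body with asymptotic cylinder $C_\infty=K\times\mathbb{R}$. Then $$\lim_{v\to\infty}I_C(v)=H^n(K).$$
   Context: A closed unbounded convex set $C\subset\mathbb{R}^{n+1}$ with non-empty interior is a cylindrically bounded convex body if its orthogonal projection onto some hyperplane is bounded and $C$ is not itself a cylinder (i.e. it contains no complete line). Coordinates in $\mathbb{R}^{n+1}=\mathbb{R}^n\times\mathbb{R}$ are chosen so that this hyperplane is $\mathbb{R}^n\times\{0\}$. Let $K\subset\mathbb{R}^n$ be the closure of the orthogonal projection of $C$ to $\mathbb{R}^n\times\{0\}\equiv\mathbb{R}^n$; the asymptotic cylinder of $C$ is $C_\infty=K\times\mathbb{R}$. $H^n$ is $n$-dimensional Hausdorff measure. For measurable $E\subset C$, $|E|$ denotes the $(n+1)$-dimensional Hausdorff (Lebesgue) measure. The relative perimeter of $E$ in the interior of $C$ is $P_C(E)=\sup\{\int_E \operatorname{div}\xi\, dH^{n+1} : \xi \text{ smooth vector field with compact support in } \operatorname{int}(C),\ |\xi|\le 1\}$. The isoperimetric profile is $I_C(v)=\inf\{P_C(E): E\subset C,\ |E|=v\}$. *)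

(* Defs.v *)
From HB Require Import structures.
From mathcomp Require Import all_boot all_order all_algebra.
From mathcomp Require Import all_classical all_reals all_analysis.

Set Implicit Arguments.
Unset Strict Implicit.
Unset Printing Implicit Defensive.
Import Order.TTheory GRing.Theory Num.Theory.
Import numFieldNormedType.Exports.
Local Open Scope classical_set_scope.
Local Open Scope ring_scope.

(* The norm [`|x|] of the library on row vectors is the sup norm. It defines
   the right topology and the right bounded sets, but lengths and diameters
   below need the Euclidean norm. *)
Definition enorm {R : realType} {m : nat} (x : 'rV[R]_m) : R :=
  Num.sqrt (\sum_i x 0 i ^+ 2).

Section Hausdorff.
Context {R : realType} {m : nat}.
Implicit Types (A U : set 'rV[R]_m) (F : (set 'rV[R]_m)^nat) (d : nat).
Local Open Scope ereal_scope.

(* -oo when U is empty *)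
Definition diam U : \bar R :=
  ereal_sup [set (enorm (x - y))%:E | x in U & y in U].

(* The empty set is singled out so that it weighs 0 also when d = 0. *)
Definition diam_pow d U : \bar R := if U == set0 then 0 else diam U ^+ d.

Definition delta_cover (delta : R) A F :=
  A `<=` \bigcup_k F k /\ forall k, diam (F k) <= delta%:E.

Definition hausdorff_delta d (delta : R) A : \bar R :=
  ereal_inf [set \sum_(k <oo) diam_pow d (F k) | F in delta_cover delta A].

Definition hausdorff_unnormalized d A : \bar R :=
  ereal_sup [set hausdorff_delta d delta A | delta in [set e : R | (0 < e)%R]].

End Hausdorff.

Definition unit_cube {R : realType} {d : nat} : set 'rV[R]_d :=
  [set x | forall i, 0 <= x 0 i <= 1].

(* d-dimensional Hausdorff measure on R^m, with the constant factor fixed by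
   requiring that the unit cube of R^d has measure 1, so that it is Lebesgue
   measure when m = d. *)
Definition hausdorff {R : realType} {m : nat} (d : nat) (A : set 'rV[R]_m) :
    \bar R :=
  ((fine (hausdorff_unnormalized d (unit_cube : set 'rV[R]_d)))^-1%:E
    * hausdorff_unnormalized d A)%E.

Section HausdorffUnnormalizedTheory.
Context {R : realType} {m : nat} (d : nat).
Implicit Types (A U : set 'rV[R]_m).
Local Open Scope ereal_scope.

Lemma diam_pow_ge0 U : 0 <= diam_pow d U.
Proof.
rewrite /diam_pow; case: ifPn => // /set0P[x Ux]; apply: expe_ge0.
apply: (@le_trans _ _ (enorm (x - x))%:E).
  by rewrite lee_fin; exact: sqrtr_ge0.
by apply: ereal_sup_ubound; exists x => //; exists x.
Qed.

Lemma diam_pow0 : diam_pow d (set0 : set 'rV[R]_m) = 0.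
Proof. by rewrite /diam_pow eqxx. Qed.

Lemma hausdorff_delta_ge0 (delta : R) A : 0 <= hausdorff_delta d delta A.
Proof.
apply: le_ereal_inf_tmp => _ [F _ <-]; apply: nneseries_ge0 => k _ _.
exact: diam_pow_ge0.
Qed.

Lemma hausdorff_delta0 (delta : R) :
  hausdorff_delta d delta (set0 : set 'rV[R]_m) = 0.
Proof.
apply/eqP; rewrite eq_le hausdorff_delta_ge0 andbT.
apply: ereal_inf_lbound; exists (fun=> set0).
  split=> // k; apply: ge_ereal_sup => _ [x []].
by apply: eseries0 => k _ _; exact: diam_pow0.
Qed.

Lemma hausdorff_delta_sigma_subadditive (delta : R) :
  sigma_subadditive (hausdorff_delta d delta : set 'rV[R]_m -> \bar R).
Proof.
set h := hausdorff_delta d delta.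
have h0 (A : set 'rV[R]_m) : 0 <= h A by exact: hausdorff_delta_ge0.
move=> A; have [[i ioo]|] := pselect (exists i, h (A i) = +oo).
  rewrite (eseries_pinfty _ _ ioo) ?leey// => n _.
  by rewrite -ltNye (lt_le_trans _ (h0 _)).
rewrite -forallNE => Aoo.
suff add2e (e : {posnum R}) :
    h (\bigcup_n A n) <= \sum_(i <oo) h (A i) + e%:num%:E.
  by apply/lee_addgt0Pr => _/posnumP[].
rewrite (le_trans _ (epsilon_trick _ _ _))//.
pose P n (B : (set 'rV[R]_m)^nat) := delta_cover delta (A n) B /\
  \sum_(k <oo) diam_pow d (B k) <= h (A n) + (e%:num / (2 ^ n.+1)%:R)%:E.
have [G PG] : {G : ((set 'rV[R]_m)^nat)^nat & forall n, P n (G n)}.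
  apply: (@choice _ _ P) => n; rewrite /P /h /hausdorff_delta.
  set S := (X in ereal_inf X); move infS : (ereal_inf S) => iS.
  case: iS infS => [r Sr|Soo|Soo].
  - have en1 : (0 < e%:num / (2 ^ n.+1)%:R)%R by [].
    have /(lb_ereal_inf_adherent en1) : ereal_inf S \is a fin_num by rewrite Sr.
    move=> [x [B AnB muBx] xS].
    by exists B; split => //; rewrite muBx -Sr; exact/ltW.
  - by have := Aoo n; rewrite /h /hausdorff_delta -/S Soo.
  - by have := h0 (A n); rewrite /h /hausdorff_delta -/S Soo.
have dG_ge0 x : 0 <= (diam_pow d \o uncurry G) x by exact: diam_pow_ge0.
apply: (@le_trans _ _ (\esum_(i in setT) (diam_pow d \o uncurry G) i)).
  apply: ereal_inf_lbound => /=.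
  have /card_esym/ppcard_eqP[f] := card_nat2.
  exists (uncurry G \o f).
    split => [|k]; last first.
      by rewrite /=; case: (f k) => a b; exact: (PG a).1.2.
    apply: (@subset_trans _  (\bigcup_n \bigcup_k G n k)) => [t [i _]|].
      by move=> /(PG i).1.1 -[j _ ?]; exists i => //; exists j.
    move=> t [i _ [j _ Bijt]]; exists (f^-1%FUN (i, j)) => //=.
    by rewrite invK ?inE.
  rewrite -(esum_pred_image (diam_pow d \o uncurry G) _ xpredT) ?[fun=> _]set_true//.
  by rewrite image_eq.
rewrite (_ : esum _ _ = \sum_(i <oo) \sum_(j <oo) diam_pow d (G i j)); last first.
  pose J : nat -> set (nat * nat) := fun i => [set (i, j) | j in setT].
  rewrite (_ : setT = \bigcup_k J k); last first.
    by rewrite predeqE => -[a b]; split => // _; exists a => //; exists b.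
  rewrite esum_bigcupT /=; last 2 first.
    - apply/trivIsetP => i j _ _ ij.
      rewrite predeqE => -[n k] /=; split => //= -[] [_] _ [<-{n} _].
      by move=> [m' _] [] /esym/eqP; rewrite (negbTE ij).
    - by move=> /= [n k]; exact: diam_pow_ge0.
  rewrite -(image_id [set: nat]) -fun_true esum_pred_image//; last first.
    by move=> n _; apply: esum_ge0 => x _; exact: dG_ge0.
  apply: eq_eseriesr => /= j _.
  rewrite -(esum_pred_image (diam_pow d \o uncurry G) (pair j) predT)//=;
    last by move=> ? ? _ _; exact: (@can_inj _ _ _ snd).
    by congr esum; rewrite predeqE => -[a b]; split; move=> [i _ <-]; exists i.
  by move=> n _; exact: diam_pow_ge0.
apply: lee_nneseries => [n _ _|n _]; last exact: (PG n).2.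
by apply: nneseries_ge0 => k _ _; exact: diam_pow_ge0.
Qed.

Lemma hausdorff_delta_le_unnormalized (delta : R) A : (0 < delta)%R ->
  hausdorff_delta d delta A <= hausdorff_unnormalized d A.
Proof. by move=> delta0; apply: ereal_sup_ubound; exists delta. Qed.

Lemma hausdorff_unnormalized_ge0 A : 0 <= hausdorff_unnormalized d A.
Proof.
apply: (le_trans (hausdorff_delta_ge0 1 A)).
exact: hausdorff_delta_le_unnormalized.
Qed.

End HausdorffUnnormalizedTheory.

Section HausdorffOuterMeasure.
Context {R : realType} {m : nat} (d : nat).
Implicit Types A : set 'rV[R]_m.
Local Open Scope ereal_scope.

Lemma hausdorff_outer_measure0 : hausdorff d (set0 : set 'rV[R]_m) = 0.
Proof.
rewrite /hausdorff (_ : hausdorff_unnormalized d set0 = 0) ?mule0//.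
apply/eqP; rewrite eq_le hausdorff_unnormalized_ge0 andbT.
by apply: ge_ereal_sup => _ [delta _ <-]; rewrite hausdorff_delta0.
Qed.

Lemma hausdorff_constant_ge0 :
  0 <= (fine (hausdorff_unnormalized d (unit_cube : set 'rV[R]_d)))^-1%:E.
Proof.
rewrite lee_fin invr_ge0 fine_ge0//. exact: hausdorff_unnormalized_ge0.
Qed.

Lemma hausdorff_outer_measure_ge0 A : 0 <= hausdorff d A.
Proof.
by apply: mule_ge0; [exact: hausdorff_constant_ge0|exact: hausdorff_unnormalized_ge0].
Qed.

Lemma le_hausdorff :
  {homo (hausdorff d : set 'rV[R]_m -> \bar R) : A B / A `<=` B >-> A <= B}.
Proof.
move=> A B AB; apply: lee_wpmul2l; first exact: hausdorff_constant_ge0.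
apply: ge_ereal_sup => _ [delta delta0 <-].
apply: le_trans (hausdorff_delta_le_unnormalized d B delta0).
apply: ereal_inf_le_tmp => _ [F [BF Fd] <-]; exists F => //.
by split => //; exact: subset_trans BF.
Qed.

Lemma hausdorff_sigma_subadditive :
  sigma_subadditive (hausdorff d : set 'rV[R]_m -> \bar R).
Proof.
move=> F; rewrite /hausdorff nneseriesZl; last first.
  by move=> k _; exact: hausdorff_unnormalized_ge0.
apply: lee_wpmul2l; first exact: hausdorff_constant_ge0.
apply: ge_ereal_sup => _ [delta delta0 <-].
apply: (le_trans (hausdorff_delta_sigma_subadditive d delta F)).
apply: lee_nneseries => [k _ _|k _]; first exact: hausdorff_delta_ge0.
exact: hausdorff_delta_le_unnormalized.
Qed.

HB.instance Definition _ := isOuterMeasure.Build R 'rV[R]_m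
  (hausdorff d : set 'rV[R]_m -> \bar R)
  hausdorff_outer_measure0 hausdorff_outer_measure_ge0 le_hausdorff
  hausdorff_sigma_subadditive.

End HausdorffOuterMeasure.

(* |E|, as an outer measure defined on all subsets of R^m *)
Definition volume (R : realType) (m : nat) :
    {outer_measure set 'rV[R]_m -> \bar R} :=
  hausdorff m.

(* The measure it induces on the sigma-algebra of its Caratheodory measurable
   sets, i.e. of the Lebesgue measurable subsets of R^m, used for integration. *)
Definition volume_measure (R : realType) (m : nat) :
    {measure set (caratheodory_type (volume R m)) -> \bar R} :=
  volume R m.

Arguments volume : clear implicits.
Arguments volume_measure : clear implicits.

Section RelativePerimeter.
Context {R : realType} {m : nat}.
Implicit Types (f : 'rV[R]_m -> R) (xi : 'rV[R]_m -> 'rV[R]_m).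
Implicit Types (C E : set 'rV[R]_m).

Definition partial f (i : 'I_m) : 'rV[R]_m -> R := 'D_(delta_mx 0 i) f.

Definition iter_partial f (s : seq 'I_m) : 'rV[R]_m -> R := foldl partial f s.

Definition smooth_fun f := forall s : seq 'I_m,
  continuous (iter_partial f s) /\
  forall i x, derivable (iter_partial f s) x (delta_mx 0 i).

Definition smooth_field xi := forall i, smooth_fun (fun x => xi x 0 i).

Definition divergence xi (x : 'rV[R]_m) : R :=
  \sum_i partial (fun y => xi y 0 i) i x.

Definition support_of xi : set 'rV[R]_m := closure [set x | xi x != 0].

Definition test_field C xi :=
  [/\ smooth_field xi, compact (support_of xi), support_of xi `<=` interior C
    & forall x, enorm (xi x) <= 1].

Definition relative_perimeter C E : \bar R :=
  ereal_sup [set (\int[volume_measure R m]_(x in E) (divergence xi x)%:E)%E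
            | xi in test_field C].

Definition isoperimetric_profile C (v : R) : \bar R :=
  ereal_inf [set relative_perimeter C E
            | E in [set E | [/\ (volume R m).-caratheodory E, E `<=` C
                              & volume R m E = v%:E]]].

End RelativePerimeter.

Section CylindricallyBounded.
Context {R : realType} {n : nat}.
Implicit Types C : set 'rV[R]_n.+1.

(* Orthogonal projection of R^n x R onto R^n, R being the last coordinate. *)
Definition horizontal_projection (x : 'rV[R]_n.+1) : 'rV[R]_n := col' ord_max x.

Definition contains_line C :=
  exists x v : 'rV[R]_n.+1, v != 0 /\ forall t : R, C (x + t *: v).

Definition cylindrically_bounded_convex_body C :=
  [/\ closed C,
      ~ bounded_set C,
      convex_set (C : set (convex_lmodType 'rV[R]_n.+1)) &
      interior C !=set0] /\
  (bounded_set (horizontal_projection @` C) /\ ~ contains_line C).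

Definition cylinder (K : set 'rV[R]_n) : set 'rV[R]_n.+1 :=
  horizontal_projection @^-1` K.

Definition asymptotic_cylinder C : set 'rV[R]_n.+1 :=
  cylinder (closure (horizontal_projection @` C)).

End CylindricallyBounded.

(* Main.v *)
(* Upper bound. Let E be the part of C below height t. The divergence of a test
   field xi is a limit of difference quotients of its coordinates. By translation
   invariance the horizontal quotients integrate to 0 over E and the vertical one
   with step w is at most |S| / w, where S is a slab of height w over K, so that
   |S| <= w |K|. Hence P_C(E) <= |K|, and |E| takes every positive value.

   Lower bound. Suppose P_C(E) <= P with P = |K| - eps. Testing against fields made
   of bump functions shows that translating a family of disjoint cubes inside C
   by w changes the volume of E in them by at most |w|_1 P in total. On a grid of
   mesh eta, the columns over an inner part of K lie in C from a fixed height on.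
   Comparing a level with the levels above, which carry little of the finite
   volume |E|, we see that these columns contain at most eta P of E on each level,
   so that a fixed proportion of each level misses E. If a_c and b_c are the
   volumes of E and of its complement in the cell c, and q = a_c + b_c, then
   a_c b_j / q <= |a_c - a_j| + min(a_c, b_c). Summed over the cells c well inside C
   and the cells j of the inner columns on the level of c, the first term is
   controlled by the translation estimate and the second one tends to 0 with the
   mesh. This bounds |E| above the fixed height independently of E, so large
   volumes force P_C(E) > |K| - eps. *)

Require Import Defs.
From mathcomp Require Import all_boot all_order all_algebra.
From mathcomp Require Import all_classical all_reals all_analysis.
From mathcomp Require Import measurable_realfun.
From mathcomp Require Import ring lra zify.

Set Implicit Arguments.
Unset Strict Implicit.
Unset Printing Implicit Defensive.
Import Order.TTheory GRing.Theory Num.Theory.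
Import numFieldNormedType.Exports.
Local Open Scope classical_set_scope.
Local Open Scope ring_scope.

(** * Hausdorff measure *)

(** From below, perimeter is used only through the translation estimate: no Gauss-Green formula, no
    slicing, no Fubini. Whatever concerns products is done by counting grid cubes. As volume is a
    Hausdorff measure, its basic properties are first derived from covers. Two points shape the
    lower bound. The vertical estimate has to be sharp: [P] is compared with the exact value of |K|,
    so a vertical shift by [eta] may cost [eta * P] and no more; this works because a vertical
    vector has the same Euclidean and l1 norm. Horizontal shifts may lose any fixed factor. Moreover
    the threshold on the volume must not depend on [E], whereas the mesh at which most cells are
    almost full or almost empty does. The grid therefore has [N] cells in each horizontal direction
    with [eta * N = W] fixed, and [eta] and [N] enter the final bound only through [W]. The sign [s]
    is 1 or -1 according to whether [C] opens upwards or downwards. *)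

Section EuclideanNorm.
Context {R : realType} {m : nat}.
Implicit Types x y : 'rV[R]_m.

Lemma enorm_ge0 x : 0 <= enorm x.
Proof. exact: sqrtr_ge0. Qed.

Lemma sum_sqr_ge0 x : 0 <= \sum_i x 0 i ^+ 2.
Proof. by apply: sumr_ge0 => i _; exact: sqr_ge0. Qed.

Lemma sqr_enorm x : enorm x ^+ 2 = \sum_i x 0 i ^+ 2.
Proof. by rewrite sqr_sqrtr // sum_sqr_ge0. Qed.

Lemma enorm_coord x i : `|x 0 i| <= enorm x.
Proof.
rewrite -sqrtr_sqr ler_wsqrtr // (bigD1 i) //= lerDl.
by apply: sumr_ge0 => j _; exact: sqr_ge0.
Qed.

Lemma enorm_le x (r : R) : 0 <= r -> (forall i, `|x 0 i| <= r) ->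
  enorm x <= m%:R * r.
Proof.
move=> r0 xr; rewrite -[leRHS](@ger0_norm _ (m%:R * r)) ?mulr_ge0//.
rewrite -sqrtr_sqr ler_wsqrtr //.
apply: (@le_trans _ _ (\sum_(i < m) r ^+ 2)).
  by apply: ler_sum => i _; rewrite -real_normK ?num_real// lerXn2r// nnegrE.
rewrite sumr_const card_ord exprMn -[leLHS]mulr_natl ler_wpM2r ?sqr_ge0//.
by rewrite -natrX ler_nat; case: m => // k; rewrite expnS expn1 leq_pmulr.
Qed.

Lemma enormZ (a : R) x : enorm (a *: x) = `|a| * enorm x.
Proof.
rewrite /enorm -sqrtr_sqr -sqrtrM ?sqr_ge0// mulr_sumr.
by congr Num.sqrt; apply: eq_bigr => i _; rewrite mxE exprMn.
Qed.

Lemma enormN x : enorm (- x) = enorm x.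
Proof. by rewrite -scaleN1r enormZ normrN1 mul1r. Qed.

Lemma enorm_distC x y : enorm (x - y) = enorm (y - x).
Proof. by rewrite -opprB enormN. Qed.

Lemma dot_le_enorm x y : \sum_i x 0 i * y 0 i <= enorm x * enorm y.
Proof.
have H : (\sum_i x 0 i * y 0 i) ^+ 2 <= (enorm x * enorm y) ^+ 2.
  rewrite exprMn !sqr_enorm -subr_ge0.
  (* Lagrange's identity: the defect in the Cauchy-Schwarz inequality is half a sum of squares. *)
  have -> : (\sum_i x 0 i ^+ 2) * (\sum_i y 0 i ^+ 2) - (\sum_i x 0 i * y 0 i) ^+ 2
      = 2^-1 * \sum_i \sum_j (x 0 i * y 0 j - x 0 j * y 0 i) ^+ 2.
    have -> : \sum_i \sum_j (x 0 i * y 0 j - x 0 j * y 0 i) ^+ 2 =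
        \sum_i \sum_j (x 0 i ^+ 2 * y 0 j ^+ 2)
        + \sum_i \sum_j (x 0 j ^+ 2 * y 0 i ^+ 2)
        - 2 * \sum_i \sum_j ((x 0 i * y 0 i) * (x 0 j * y 0 j)).
      rewrite mulr_sumr -sumrN -!big_split /=; apply: eq_bigr => i _.
      rewrite mulr_sumr -sumrN -!big_split /=; apply: eq_bigr => j _.
      by ring.
    rewrite [X in _ + X - _]exchange_big /=.
    have E (u v : 'I_m -> R) :
        \sum_i \sum_j (u i * v j) = (\sum_i u i) * (\sum_j v j).
      by rewrite mulr_suml; apply: eq_bigr => i _; rewrite mulr_sumr.
    by rewrite !E; field.
  rewrite mulr_ge0 ?invr_ge0// sumr_ge0// => i _; rewrite sumr_ge0// => j _.
  exact: sqr_ge0.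
rewrite (le_trans (ler_norm _))// -(ger0_norm (mulr_ge0 (enorm_ge0 x) (enorm_ge0 y))).
by rewrite -!sqrtr_sqr ler_wsqrtr.
Qed.

Lemma enormD x y : enorm (x + y) <= enorm x + enorm y.
Proof.
rewrite -(ger0_norm (enorm_ge0 (x + y))).
rewrite -[leRHS](ger0_norm (addr_ge0 (enorm_ge0 x) (enorm_ge0 y))).
rewrite -!sqrtr_sqr ler_wsqrtr// sqrrD !sqr_enorm.
have -> : \sum_i (x + y) 0 i ^+ 2 =
    \sum_i x 0 i ^+ 2 + 2 * (\sum_i x 0 i * y 0 i) + \sum_i y 0 i ^+ 2.
  by rewrite mulr_sumr -!big_split/=; apply: eq_bigr => i _; rewrite mxE; ring.
by rewrite lerD2r lerD2l -[leRHS]mulr_natl ler_pM2l// dot_le_enorm.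
Qed.

End EuclideanNorm.

Section Diameter.
Context {R : realType}.
Local Open Scope ereal_scope.

Lemma diam_ge m (U : set 'rV[R]_m) x y : U x -> U y ->
  (enorm (x - y))%:E <= diam U.
Proof. by move=> Ux Uy; apply: ereal_sup_ubound; exists x => //; exists y. Qed.

Lemma diam_le m (U : set 'rV[R]_m) (r : \bar R) :
  (forall x y, U x -> U y -> (enorm (x - y))%:E <= r) -> diam U <= r.
Proof. by move=> H; apply: ge_ereal_sup => _ [x Ux [y Uy <-]]; exact: H. Qed.

Lemma diam_ge0 m (U : set 'rV[R]_m) : U !=set0 -> 0 <= diam U.
Proof.
by move=> [x Ux]; rewrite (le_trans _ (diam_ge Ux Ux))// lee_fin enorm_ge0.
Qed.

Lemma lee_expe (x y : \bar R) k : 0 <= x -> x <= y -> x ^+ k <= y ^+ k.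
Proof.
move=> x0 xy; elim: k => [|k IH]; first by rewrite !expe0.
by rewrite !expeS lee_pmul// expe_ge0.
Qed.

Lemma diam_pow_le m d (U : set 'rV[R]_m) (r : R) : (0 <= r)%R ->
  diam U <= r%:E -> diam_pow d U <= (r ^+ d)%:E.
Proof.
move=> r0 Ur; rewrite /diam_pow; case: ifPn => [_|/set0P U0].
  by rewrite lee_fin exprn_ge0.
by rewrite EFin_expe lee_expe// diam_ge0.
Qed.

End Diameter.

Section Lipschitz.
Context {R : realType} {m m' : nat} (d : nat).
Implicit Types (f : 'rV[R]_m -> 'rV[R]_m').
Local Open Scope ereal_scope.

(** The first bound controls the mesh of an image cover, the second its weight. *)
Lemma diam_pow_lipschitz f (r : R) (U : set 'rV[R]_m) : (0 < r)%R ->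
  (forall x y, enorm (f x - f y) <= r * enorm (x - y))%R ->
  diam (f @` U) <= r%:E * diam U /\
  diam_pow d (f @` U) <= (r ^+ d)%:E * diam_pow d U.
Proof.
move=> r0 fr.
have dU : diam (f @` U) <= r%:E * diam U.
  apply: diam_le => _ _ [x Ux <-] [y Uy <-].
  apply: (@le_trans _ _ (r * enorm (x - y))%:E); first by rewrite lee_fin.
  by rewrite EFinM lee_pmul2l// diam_ge.
split => //.
have [->|/set0P U0] := eqVneq U set0.
  by rewrite image_set0 !diam_pow0 mule0.
rewrite /diam_pow; case: ifPn => [/eqP H|_].
  case: U0 => x Ux; have : (f @` U) (f x) by exists x.
  by rewrite H.
case: ifPn => [/eqP H|_]; first by rewrite H in U0; case: U0.
apply: (@le_trans _ _ ((r%:E * diam U) ^+ d)).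
  by apply: lee_expe => //; apply: diam_ge0; case: U0 => x Ux; exists (f x); exists x.
elim: d => [|k IH]; first by rewrite !expe0 expr0 mule1.
have dU0 := diam_ge0 U0.
rewrite !expeS exprS EFinM muleACA lee_pmul// ?mule_ge0 ?lee_fin ?(ltW r0)//.
by rewrite expe_ge0// mule_ge0// lee_fin ltW.
Qed.

(** A cover of mesh [e / r] is mapped to a cover of mesh [e]; the change of scale disappears in the
    supremum over all meshes. *)
Lemma hausdorff_unnormalized_lipschitz f (r : R) (A : set 'rV[R]_m) : (0 < r)%R ->
  (forall x y, enorm (f x - f y) <= r * enorm (x - y))%R ->
  hausdorff_unnormalized d (f @` A) <=
  (r ^+ d)%:E * hausdorff_unnormalized d A.
Proof.
move=> r0 fr; have rd0 : (0 < r ^+ d)%R by rewrite exprn_gt0.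
apply: ge_ereal_sup => _ [e /= e0 <-].
have er0 : (0 < e / r)%R by rewrite divr_gt0.
apply: (@le_trans _ _ ((r ^+ d)%:E * hausdorff_delta d (e / r)%R A)); last first.
  by rewrite lee_pmul2l// hausdorff_delta_le_unnormalized.
rewrite -lee_pdivrMl//; apply: le_ereal_inf_tmp => _ [F [AF Fe] <-].
rewrite lee_pdivrMl// -nneseriesZl; last by move=> *; exact: diam_pow_ge0.
apply: (@le_trans _ _ (\sum_(k <oo) diam_pow d (f @` F k))); last first.
  apply: lee_nneseries => [k _ _|k _]; first exact: diam_pow_ge0.
  by case: (diam_pow_lipschitz (F k) r0 fr).
apply: ereal_inf_lbound; exists (fun k => f @` F k) => //; split.
  by move=> _ [x Ax <-]; have [k _ Fx] := AF x Ax; exists k => //; exists x.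
move=> k; apply: (le_trans (diam_pow_lipschitz (F k) r0 fr).1).
apply: (@le_trans _ _ (r%:E * (e / r)%:E)); first by rewrite lee_pmul2l//.
by rewrite -EFinM mulrC divfK// gt_eqF.
Qed.

End Lipschitz.

Section AffineImage.
Context {R : realType} {m : nat} (d : nat).
Local Open Scope ereal_scope.

(** The homothety and its inverse are Lipschitz with constants [r] and [r^-1], so the two one-sided
    bounds meet. The case [r = 1] is translation invariance; [r < 1] serves for the contractions of
    convex sets. *)
Lemma hausdorff_unnormalized_affine (a : 'rV[R]_m) (r : R) (A : set 'rV[R]_m) : (0 < r)%R ->
  hausdorff_unnormalized d [set (a + r *: x)%R | x in A] =
  (r ^+ d)%:E * hausdorff_unnormalized d A.
Proof.
move=> r0; have rd0 : (0 < r ^+ d)%R by rewrite exprn_gt0.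
apply/eqP; rewrite eq_le; apply/andP; split.
  apply: hausdorff_unnormalized_lipschitz => // x y.
  by rewrite opprD addrACA subrr add0r -scalerBr enormZ gtr0_norm.
rewrite -lee_pdivlMl// -exprVn.
have E : A = [set (r^-1 *: (x - a))%R | x in [set (a + r *: x)%R | x in A]].
  rewrite predeqE => x; split => [Ax|[_ [y Ay <-] <-]].
    exists (a + r *: x)%R; first by exists x.
    by rewrite addrAC subrr add0r scalerA mulVf ?scale1r// gt_eqF.
  by rewrite addrAC subrr add0r scalerA mulVf ?scale1r// gt_eqF.
rewrite {1}E; have ri0 : (0 < r^-1)%R by rewrite invr_gt0.
pose f (x : 'rV[R]_m) : 'rV[R]_m := (r^-1 *: (x - a))%R.
have := @hausdorff_unnormalized_lipschitz R m m d f r^-1 [set (a + r *: x)%R | x in A] ri0.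
apply.
move=> x y; by rewrite -scalerBr opprB addrA subrK enormZ gtr0_norm.
Qed.

End AffineImage.

(** * Caratheodory's criterion: closed sets are measurable *)

Section MetricOuterMeasure.
Context {R : realType} {m : nat} (d : nat).
Implicit Types A B : set 'rV[R]_m.
Local Open Scope ereal_scope.

Lemma hausdorff_delta_mono (e1 e2 : R) A : (e1 <= e2)%R ->
  hausdorff_delta d e2 A <= hausdorff_delta d e1 A.
Proof.
move=> e12; apply: ereal_inf_le_tmp => _ [F [AF Fe] <-]; exists F => //.
by split => // k; rewrite (le_trans (Fe k))// lee_fin.
Qed.

(** A set of diameter at most [e] cannot meet both [A] and [B], so a cover of the union splits into
    the members that meet [A] and those that meet [B]. *)
Lemma hausdorff_delta_separated (e : R) A B : (0 < e)%R ->
  (forall x y, A x -> B y -> e < enorm (x - y))%R ->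
  hausdorff_delta d e A + hausdorff_delta d e B <= hausdorff_delta d e (A `|` B).
Proof.
move=> e0 AB; apply: le_ereal_inf_tmp => _ [F [ABF Fe] <-].
pose G X k := if `[< F k `&` X !=set0 >] then F k else set0.
have sG X : X `<=` \bigcup_k F k -> X `<=` \bigcup_k G X k.
  move=> XF x Xx; have [k _ Fx] := XF x Xx; exists k => //; rewrite /G.
  by case: asboolP => // -[]; exists x.
have dG X k : diam (G X k) <= e%:E.
  rewrite /G; case: asboolP => // _.
  by apply: diam_le.
apply: (@le_trans _ _ (\sum_(k <oo) diam_pow d (G A k) + \sum_(k <oo) diam_pow d (G B k))).
  apply: leeD; apply: ereal_inf_lbound; eexists; try reflexivity; split => //;
  apply: sG => x Xx; apply: ABF; [left|right]; exact: Xx.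
rewrite -nneseriesD; do ?by move=> *; exact: diam_pow_ge0.
apply: lee_nneseries => [k _ _|k _]; first by rewrite adde_ge0// diam_pow_ge0.
rewrite /G; case: asboolP => [[x [Fx Ax]]|_]; last first.
  by rewrite diam_pow0 add0e; case: asboolP => // _; rewrite diam_pow0 diam_pow_ge0.
case: asboolP => [[y [Fy By]]|_]; last by rewrite diam_pow0 adde0.
have := diam_ge Fx Fy; move=> /le_trans/(_ (Fe k)); rewrite lee_fin leNgt.
by rewrite AB.
Qed.

(** By monotonicity in the mesh, one scale below [e] serves [A] and [B] at once; then the two
    suprema are taken one after the other. Terms are moved across by subtraction, hence the
    finiteness claims. *)
Lemma hausdorff_unnormalized_separated (e : R) A B : (0 < e)%R ->
  (forall x y, A x -> B y -> e < enorm (x - y))%R ->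
  hausdorff_unnormalized d A + hausdorff_unnormalized d B <=
  hausdorff_unnormalized d (A `|` B).
Proof.
move=> e0 AB.
have H e1 e2 : (0 < e1)%R -> (0 < e2)%R ->
    hausdorff_delta d e1 A + hausdorff_delta d e2 B <= hausdorff_unnormalized d (A `|` B).
  move=> e10 e20; pose e' := Num.min e (Num.min e1 e2).
  have e'0 : (0 < e')%R by rewrite !lt_min e0 e10.
  apply: le_trans (hausdorff_delta_le_unnormalized d (A `|` B) e'0).
  apply: le_trans (hausdorff_delta_separated e'0 _); last first.
    by move=> x y Ax By; rewrite (le_lt_trans _ (AB _ _ Ax By))// ge_min lexx.
  apply: leeD; apply: hausdorff_delta_mono; rewrite !ge_min lexx ?orbT//.
have [->|ABoo] := eqVneq (hausdorff_unnormalized d (A `|` B)) +oo.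
  by rewrite leey.
have fAB : hausdorff_unnormalized d (A `|` B) \is a fin_num.
  by rewrite ge0_fin_numE ?hausdorff_unnormalized_ge0// ltey.
have fin e2 : (0 < e2)%R -> hausdorff_delta d e2 B \is a fin_num.
  move=> e20; rewrite ge0_fin_numE ?hausdorff_delta_ge0//.
  apply: le_lt_trans (_ : hausdorff_unnormalized d (A `|` B) < +oo); last by rewrite ltey.
  by apply: le_trans (H _ _ e0 e20); rewrite leeDr// hausdorff_delta_ge0.
have finA : hausdorff_unnormalized d A \is a fin_num.
  rewrite ge0_fin_numE ?hausdorff_unnormalized_ge0//.
  apply: le_lt_trans (_ : hausdorff_unnormalized d (A `|` B) < +oo); last by rewrite ltey.
  apply: ge_ereal_sup => _ [e1 /= e10 <-].
  by apply: le_trans (H _ _ e10 e0); rewrite leeDl// hausdorff_delta_ge0.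
rewrite -leeBrDl//; apply: ge_ereal_sup => _ [e2 /= e20 <-].
rewrite leeBrDl// -leeBrDr ?fin//; apply: ge_ereal_sup => _ [e1 /= e10 <-].
by rewrite leeBrDr ?fin// H.
Qed.

Lemma hausdorff_separated (e : R) A B : (0 < e)%R ->
  (forall x y, A x -> B y -> e < enorm (x - y))%R ->
  hausdorff d A + hausdorff d B <= hausdorff d (A `|` B).
Proof.
move=> e0 AB; rewrite /hausdorff -ge0_muleDr ?hausdorff_unnormalized_ge0//.
apply: lee_wpmul2l; first exact: hausdorff_constant_ge0.
exact: hausdorff_unnormalized_separated AB.
Qed.

End MetricOuterMeasure.

Lemma sume_double (R : realType) (a : nat -> \bar R) n :
  (\sum_(j < n.*2) a j = \sum_(j < n) a (j.*2 + 0)%N + \sum_(j < n) a (j.*2 + 1)%N)%E.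
Proof.
elim: n => [|k IH]; first by rewrite !big_ord0 adde0.
rewrite doubleS big_ord_recr big_ord_recr /= IH big_ord_recr /= [in RHS]big_ord_recr /=.
by rewrite addn0 addn1 addeACA addeA.
Qed.

Section Caratheodory.
Context {R : realType} {m : nat} (d : nat).
Local Notation mu := (hausdorff d : set 'rV[R]_m -> \bar R).
Local Open Scope ereal_scope.

Section Layers.
Variables (g : 'rV[R]_m -> R) (X : set 'rV[R]_m).
Hypothesis g_lip : forall x y, (g x - g y <= enorm (x - y))%R.

(** [g] stands for the distance to a closed set. Consecutive layers touch, but layers whose indices
    differ by at least two are a positive distance apart; hence [layers] collects the indices of one
    parity [b]. *)
Let layer (k : nat) := X `&` [set x | (k.+2%:R^-1 < g x <= k.+1%:R^-1)%R].

Let layers (b : nat) (n : nat) := \bigcup_(j in [set j | (j < n)%N]) layer (j.*2 + b).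

Let sum_layers b n : \sum_(j < n) mu (layer (j.*2 + b)) <= mu (layers b n).
Proof.
elim: n => [|n IH]; first by rewrite big_ord0 outer_measure_ge0.
rewrite big_ord_recr /=.
apply: (@le_trans _ _ (mu (layers b n) + mu (layer (n.*2 + b)))); first exact: leeD2r.
have -> : layers b n.+1 = layers b n `|` layer (n.*2 + b).
  rewrite /layers predeqE => x; split.
    move=> [j /=]; rewrite ltnS leq_eqVlt => /orP[/eqP ->|jn]; first by right.
    by left; exists j.
  by move=> [[j /= jn]|]; [exists j => //=; exact: ltnW|exists n => /=].
pose k := (n.*2 + b)%N.
(* With [n = 0] there is no earlier layer, and [k] may be 0, where [k%:R^-1] has the default value
   0. *)
case: n @k {IH} => [|n] k.
  rewrite (_ : layers b 0 = set0) ?outer_measure0 ?set0U ?add0e//.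
  by rewrite -subset0 => x [j].
(* On the earlier layers [g] exceeds [k%:R^-1], on the new one it is at most [k.+1%:R^-1], so their
   distance exceeds half of this gap. *)
apply: (@hausdorff_separated _ _ _ ((k%:R^-1 - k.+1%:R^-1) / 2)).
  rewrite divr_gt0// subr_gt0 ltf_pV2 ?posrE ?ltr0n ?ltr_nat// /k doubleS addSn//.
move=> x y [j /= jn [_ /= /andP[gx _]]] [_ /= /andP[_ gy]].
apply: lt_le_trans (g_lip x y).
have k0 : (0 < k%:R :> R)%R by rewrite ltr0n /k doubleS.
have kj : (k%:R^-1 <= (j.*2 + b).+2%:R^-1 :> R)%R.
  by rewrite lef_pV2 ?posrE ?ltr0n// ler_nat /k; lia.
have kk : (k.+1%:R^-1 < k%:R^-1 :> R)%R.
  by rewrite ltf_pV2 ?posrE ?ltr0n// ltr_nat.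
move: gx gy kj kk; rewrite -/k.
move: (k%:R^-1)%R (k.+1%:R^-1)%R ((j.*2 + b).+2%:R^-1)%R (g x) (g y) => p q r u v.
lra.
Qed.

(** Each parity contributes at most [mu X]. For finite [mu X] the series of the layers thus
    converges and its tails tend to 0. *)
Let sum_layer n : \sum_(j < n) mu (layer j) <= mu X + mu X.
Proof.
have H b k : \sum_(j < k) mu (layer (j.*2 + b)) <= mu X.
  apply: (le_trans (sum_layers b k)); apply: le_outer_measure.
  by move=> x [j _ []].
apply: (@le_trans _ _ (\sum_(j < n.*2) mu (layer j))).
  rewrite -addnn big_split_ord /= leeDl// sume_ge0// => i _.
  exact: outer_measure_ge0.
by rewrite (sume_double (fun j => mu (layer j))) leeD.
Qed.

Let positive_part : X `&` [set x | 0 < g x]%R `<=`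
  \bigcap_k ((X `&` [set x | (k.+1%:R^-1 < g x)%R]) `|` \bigcup_(j >= k) layer j).
Proof.
move=> x [Xx /= gx] k _.
have [kg|gk] := ltP (k.+1%:R^-1)%R (g x); [by left|right].
have [j] : exists j, (j.+2%:R^-1 < g x)%R.
  have [j] := ltr_add_invr gx; rewrite add0r => jg; exists j.
  by rewrite (le_lt_trans _ jg)// lef_pV2 ?posrE ?ltr0n// ler_nat.
elim: j => [|j IH] jg.
  have [k0|k0] := leqP k 0; first by exists 0%N => //; split => //=;
    rewrite jg (le_trans gk)// lef_pV2 ?posrE ?ltr0n// ler_nat.
  exfalso; have := lt_le_trans jg gk; rewrite ltf_pV2 ?posrE ?ltr0n// ltr_nat.
  lia.
have [jg'|jg'] := ltP (j.+2%:R^-1)%R (g x); first exact: IH.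
exists j.+1; last by split => //=; rewrite jg.
have := lt_le_trans jg gk; rewrite ltf_pV2 ?posrE ?ltr0n// ltr_nat /=.
lia.
Qed.

(** The part of [X] where [g] exceeds 1/(k+1) is separated from the part where [g <= 0], so measures
    add. The rest of the positive part lies in the layers from [k] on, whose total measure tends to
    0. *)
Lemma hausdorff_positive_part :
  mu (X `&` [set x | (g x <= 0)%R]) + mu (X `&` [set x | 0 < g x]%R) <= mu X.
Proof.
have [->|Xoo] := eqVneq (mu X) +oo; first by rewrite leey.
have fX : mu X \is a fin_num by rewrite ge0_fin_numE ?outer_measure_ge0// ltey.
have sum_fin : \sum_(j <oo) mu (layer j) < +oo.
  apply: (@le_lt_trans _ _ (mu X + mu X)); last by rewrite lte_add_pinfty// ltey.
  apply: lime_le; first by apply: is_cvg_nneseries => *; exact: outer_measure_ge0.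
  by near=> n; rewrite big_mkord; exact: sum_layer.
have tail : (fun k => \sum_(k <= j <oo) mu (layer j)) @ \oo --> 0.
  by apply: nneseries_tail_cvg => // *; exact: outer_measure_ge0.
have H k : mu (X `&` [set x | (g x <= 0)%R]) + mu (X `&` [set x | 0 < g x]%R) <=
    mu X + \sum_(k <= j <oo) mu (layer j).
  apply: (@le_trans _ _ (mu (X `&` [set x | (g x <= 0)%R]) +
      (mu (X `&` [set x | (k.+1%:R^-1 < g x)%R]) + \sum_(k <= j <oo) mu (layer j)))).
    apply: leeD2l.
    apply: (@le_trans _ _ (mu ((X `&` [set x | (k.+1%:R^-1 < g x)%R]) `|` \bigcup_(j >= k) layer
      j))).
      by apply: le_outer_measure => x /positive_part /(_ k I).
    apply: (le_trans (outer_measureU2 _ _ _)); apply: leeD2l.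
    pose L j := if (k <= j)%N then layer j else set0.
    rewrite (_ : \bigcup_(j >= k) layer j = \bigcup_j L j); last first.
      rewrite predeqE => x; split => [[j /= kj Lx]|[j _]].
        by exists j => //; rewrite /L kj.
      by rewrite /L; case: ifPn => // kj Lx; exists j.
    apply: (le_trans (outer_measure_sigma_subadditive _ _)).
    rewrite [leRHS]ereal_series [leRHS]eseries_mkcond; apply: lee_nneseries => [j _ _|j _].
      exact: outer_measure_ge0.
    by rewrite /L; case: ifPn => //; rewrite outer_measure0.
  rewrite addeA; apply: leeD2r.
  apply: (@le_trans _ _ (mu ((X `&` [set x | (g x <= 0)%R]) `|`
      (X `&` [set x | (k.+1%:R^-1 < g x)%R])))); last by apply: le_outer_measure => x [] [].
  apply: (@hausdorff_separated _ _ _ (k.+2%:R^-1)).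
  - by rewrite invr_gt0 ltr0n.
  - move=> x y [_ /= gx] [_ /= gy]; rewrite enorm_distC.
    apply: lt_le_trans (g_lip y x).
    have : (k.+2%:R^-1 < k.+1%:R^-1 :> R)%R by rewrite ltf_pV2 ?posrE ?ltr0n// ltr_nat.
    move: gx gy; move: (k.+1%:R^-1)%R (k.+2%:R^-1)%R (g x) (g y) => p q u v; lra.
have C : (fun k => mu X + \sum_(k <= j <oo) mu (layer j)) @ \oo --> mu X + 0.
  apply: cvgeD => //; [exact: fin_num_adde_defr|exact: cvg_cst].
rewrite -[leRHS]adde0; rewrite -(cvg_lim _ C)//; apply: lime_ge; first by apply/cvg_ex;
  exists (mu X + 0).
by near=> k; exact: H.
Unshelve. all: by end_near. Qed.

End Layers.

(** [g] is the Euclidean distance to [F]; closedness identifies [F] with the set where [g <= 0]. *)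
Lemma closed_caratheodory (F : set 'rV[R]_m) :
  closed F -> (hausdorff d : {outer_measure set 'rV[R]_m -> \bar R}).-caratheodory F.
Proof.
move=> cF; have [->|/set0P F0] := eqVneq F set0.
  exact: caratheodory_measurable_set0.
pose g (x : 'rV[R]_m) : R := inf [set enorm (x - y)%R | y in F].
have hi x : has_inf [set enorm (x - y)%R | y in F].
  split; first by case: F0 => y Fy; exists (enorm (x - y)); exists y.
  by exists 0%R => _ [y _ <-]; exact: enorm_ge0.
have g0 x : (0 <= g x)%R.
  by apply: lb_le_inf; [exact: (hi x).1|move=> _ [y _ <-]; exact: enorm_ge0].
have glip x y : (g x - g y <= enorm (x - y))%R.
  rewrite lerBlDl -lerBlDr; apply: lb_le_inf; first exact: (hi y).1.
  move=> _ [z Fz <-]; rewrite lerBlDr.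
  apply: (@le_trans _ _ (enorm (x - z))).
    by apply: ge_inf; [exact: (hi x).2|exists z].
  have -> : (x - z = (x - y) + (y - z))%R by rewrite addrA subrK.
    by rewrite addrC enormD.
have gF x : F x -> g x = 0%R.
  move=> Fx; apply/eqP; rewrite eq_le g0 andbT; apply: ge_inf; first exact: (hi x).2.
  by exists x => //; rewrite subrr -(scale0r 0) enormZ normr0 mul0r.
have FE : F = [set x | (g x <= 0)%R].
  rewrite predeqE => x; split => [Fx|/= gx]; first by rewrite /= gF.
  apply: cF => B /nbhs_ballP[e /= e0 eB].
  have [_ [y Fy <-] xy] := inf_adherent e0 (hi x).
  exists y; split => //; apply: eB; split => // i j; rewrite (ord1 i) /ball /=.
  have := enorm_coord (x - y) j; rewrite !mxE => /le_lt_trans; apply.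
  by rewrite (lt_le_trans xy)// -/(g x); move: gx; lra.
have FC : ~` F = [set x | (0 < g x)%R].
  rewrite FE predeqE => x; split => /=; first by move/negP; rewrite -ltNge.
  by move=> gx; apply/negP; rewrite -ltNge.
apply: le_caratheodory_measurable => X; rewrite FC {1}FE.
exact: hausdorff_positive_part.
Qed.

End Caratheodory.

(** * Cubes and volume *)

Section Cubes.
Context {R : realType} {m : nat}.
Implicit Types (x y a : 'rV[R]_m) (r : R).

(** [r] is the half-side. For positive [r] these are the balls of the sup norm, so neighbourhoods
    can be read off them. *)
Definition cube x r : set 'rV[R]_m := [set y | forall i, `|y 0 i - x 0 i| < r].
Definition ccube x r : set 'rV[R]_m := [set y | forall i, `|y 0 i - x 0 i| <= r].

Lemma nbhs_cube x r : 0 < r -> nbhs x (cube x r).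
Proof.
move=> r0; apply/nbhs_ballP; exists r => //= y [_ xy] i.
by have := xy 0 i; rewrite /ball /= distrC.
Qed.

Lemma nbhs_cubeP x (A : set 'rV[R]_m) :
  nbhs x A <-> exists2 r, 0 < r & cube x r `<=` A.
Proof.
split => [/nbhs_ballP[r /= r0 rA]|[r r0 rA]]; last first.
  by apply: filterS rA _; exact: nbhs_cube.
exists r => // y xy; apply: rA; split => // i j.
by rewrite (ord1 i) /ball /= distrC; exact: xy.
Qed.

Lemma open_cubeP (A : set 'rV[R]_m) :
  open A <-> forall x, A x -> exists2 r, 0 < r & cube x r `<=` A.
Proof.
rewrite openE; split => H x Ax; first by apply/nbhs_cubeP; exact: H.
by rewrite /interior; apply/nbhs_cubeP; exact: H.
Qed.

Lemma open_cube x r : open (cube x r).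
Proof.
apply/open_cubeP => y xy.
(* For [r <= 0] the cube is empty, except when [m = 0]: then the condition is void and the cube is
   the whole one-point space. *)
have [r0|r0] := ltP 0 r; last first.
  have [E|m0] := posnP m; last first.
    by have := le_lt_trans (normr_ge0 _) (xy (Ordinal m0)); rewrite ltNge r0.
  exists 1 => // z _ i; exfalso.
  by have := ltn_ord i; rewrite [X in (_ < X)%N]E ltn0.
pose d := r - \big[Num.max/0]_i `|y 0 i - x 0 i|.
exists d; first by rewrite subr_gt0; apply/bigmax_ltP; split.
move=> z yz i; have := yz i; rewrite /d.
have : `|y 0 i - x 0 i| <= \big[Num.max/0]_i `|y 0 i - x 0 i|.
  exact: le_bigmax.
have := ler_distD (y 0 i) (z 0 i) (x 0 i); lra.
Qed.

Lemma closed_ccube x r : closed (ccube x r).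
Proof.
move=> y cy i; apply/ler_addgt0Pr => e e0.
have [z [xz yz]] := cy _ (nbhs_cube y e0).
have := xz i; have := yz i.
have := ler_distD (z 0 i) (y 0 i) (x 0 i); rewrite (distrC (y 0 i) (z 0 i)); lra.
Qed.

Lemma cube_subset x r : cube x r `<=` ccube x r.
Proof. by move=> y xy i; apply/ltW. Qed.

Lemma ccube_cube x r r' : r < r' -> ccube x r `<=` cube x r'.
Proof. by move=> rr y xy i; apply: le_lt_trans rr. Qed.

Lemma ccubeS x r r' : r <= r' -> ccube x r `<=` ccube x r'.
Proof. by move=> rr y xy i; apply: le_trans rr. Qed.

Lemma bounded_ccubeP (A : set 'rV[R]_m) :
  bounded_set A <-> exists2 r, 0 < r & A `<=` ccube 0 r.
Proof.
split => [[M [_ MA]]|[r r0 rA]].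
  exists (`|M| + 1); first by rewrite ltr_wpDl.
  move=> x /(MA (`|M| + 1)) H i; rewrite mxE subr0.
  have /H : M < `|M| + 1 by rewrite (le_lt_trans (ler_norm _))// ltrDl.
  apply: le_trans; rewrite -[leRHS]/(mx_norm x) mx_normrE.
  exact: (le_bigmax _ (fun ij : 'I_1 * 'I_m => `|x ij.1 ij.2|) (0, i)).
exists r; split => [|M rM x /rA xr]; first exact: num_real.
apply: le_trans (ltW rM).
rewrite -[leLHS]/(mx_norm x) mx_normrE; apply/bigmax_leP; split; first exact: ltW.
by move=> [i j] _ /=; rewrite (ord1 i); have := xr j; rewrite mxE subr0.
Qed.

Lemma compact_ccubeP (A : set 'rV[R]_m) r : closed A -> A `<=` ccube 0 r -> compact A.
Proof.
move=> cA Ar; apply: bounded_closed_compact => //; apply/bounded_ccubeP.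
by exists (Num.max 1 r); [rewrite lt_max ltr01|apply: (subset_trans Ar); apply: ccubeS;
  rewrite le_max lexx orbT].
Qed.

Lemma affine_ccube x r a s : 0 < s ->
  [set a + s *: y | y in ccube x r] = ccube (a + s *: x) (s * r).
Proof.
move=> s0; rewrite predeqE => z; split => [[y xy <-] i|H].
  rewrite !mxE opprD addrACA subrr add0r -mulrBr normrM gtr0_norm//.
  by rewrite ler_pM2l.
exists (s^-1 *: (z - a)); last first.
  by rewrite scalerA mulfV ?gt_eqF// scale1r addrCA subrr addr0.
move=> i; have := H i; rewrite !mxE => H1.
rewrite -(ler_pM2l s0) -[X in X * `|_|](gtr0_norm s0) -normrM mulrBr.
by rewrite mulrA mulfV ?gt_eqF// mul1r -addrA -opprD.
Qed.

Lemma unit_cubeE : unit_cube = ccube (const_mx 2^-1) 2^-1.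
Proof.
rewrite predeqE => x; split => H i; have := H i; rewrite mxE ler_norml; lra.
Qed.

Lemma diam_ccube x r : 0 <= r -> (diam (ccube x r) <= (m%:R * (2 * r))%:E)%E.
Proof.
move=> r0; apply: diam_le => y z xy xz; rewrite lee_fin.
apply: enorm_le => [|i]; first by rewrite mulr_ge0.
rewrite !mxE; have := ler_distD (x 0 i) (y 0 i) (z 0 i).
have := xy i; have := xz i; rewrite (distrC (x 0 i)); lra.
Qed.

End Cubes.

(** * Counting grid points, and the measure of the unit cube *)

Section Grid.
Context {R : realType}.

Lemma count_open_interval (N : nat) (u v : R) : u <= v ->
  \sum_(a < N) ((u < a%:R < v)%R)%:R <= v - u + 1.
Proof.
move=> uv; pose S n := \sum_(a < n) ((u < a%:R < v)%R%:R : R).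
(* The invariant of the induction: [a] is the last integer counted so far, which bounds the count by
   [a - u + 1]. *)
suff [S0|[a [_ av au]]] : S N = 0 \/
    exists a : R, [/\ a <= N%:R - 1, a < v & S N <= a - u + 1].
- by rewrite [leLHS]S0; move: uv; lra.
- by apply: (le_trans au); move: av; lra.
have SS n : S n.+1 = S n + (u < n%:R < v)%R%:R by rewrite /S big_ord_recr.
elim: N => [|n IH]; first by left; rewrite /S big_ord0.
rewrite SS -natr1 addrK; move: (S n) IH => Sn IH.
case: (boolP (u < n%:R < v)) => [/andP[un nv]|_]; rewrite /= ?addr0; last first.
  case: IH => [->|[a [an av aS]]]; [by left|right; exists a; split => //].
  by move: an; lra.
right; exists n%:R; rewrite nv lexx; split => //.
case: IH => [->|[a [an av aS]]]; first by rewrite /= add0r; lra.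
by move: aS an => /=; lra.
Qed.

(** The indicator of a cube is a product over the coordinates, so the count factors into
    one-dimensional counts. Counting grid points replaces volume while the measure of the unit cube
    is not yet known. *)
Lemma grid_count (m N : nat) (y : 'rV[R]_m) (r : R) : (0 < N)%N -> 0 <= r ->
  \sum_(c : {ffun 'I_m -> 'I_N}) (`[< cube y r (\row_l ((c l)%:R / N%:R)) >])%:R
  <= (2 * N%:R * r + 1) ^+ m.
Proof.
move=> N0 r0; have N0' : 0 < N%:R :> R by rewrite ltr0n.
pose b l (a : 'I_N) : R := (N%:R * (y 0 l - r) < a%:R < N%:R * (y 0 l + r))%R%:R.
have bE (c : {ffun 'I_m -> 'I_N}) : (`[< cube y r (\row_l ((c l)%:R / N%:R)) >])%:R = \prod_l b l
  (c l) :> R.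
  have E l : (`|(c l)%:R / N%:R - y 0 l| < r) =
      (N%:R * (y 0 l - r) < (c l)%:R < N%:R * (y 0 l + r)).
    rewrite ltr_norml ltrBDr ltrBlDr.
    by rewrite ltr_pdivlMr// ltr_pdivrMr//; congr (_ && _); congr (_ < _); ring.
  case: asboolP => [H|H].
    by rewrite big1// => l _; rewrite /b -E; have := H l; rewrite mxE => ->.
  suff [l Hl] : exists l, ~~ (`|(c l)%:R / N%:R - y 0 l| < r).
    by rewrite (bigD1 l)//= /b -E (negbTE Hl) mul0r.
  apply/existsP; rewrite -negb_forall; apply/negP => /forallP H'.
  by apply: H => l; rewrite mxE; exact: H'.
under eq_bigr do rewrite bE.
rewrite -(bigA_distr_bigA b).
have -> : (2 * N%:R * r + 1) ^+ m = \prod_(l < m) (2 * N%:R * r + 1).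
  by rewrite prodr_const card_ord.
apply: ler_prod => l _; rewrite sumr_ge0//=.
  rewrite (le_trans (count_open_interval _ _))//.
    by rewrite ler_pM2l//; lra.
  by rewrite [leLHS](_ : _ = 2 * N%:R * r + 1)//; ring.
Qed.


Lemma grid_interval (N : nat) (t : R) : (0 < N)%N -> 0 <= t <= N%:R ->
  exists a : 'I_N, a%:R <= t <= a%:R + 1.
Proof.
elim: N => // -[|N] IH _ /andP[t0 tN]; first by exists ord0 => /=; rewrite t0 add0r.
have [tN'|tN'] := leP t N.+1%:R; last first.
  by exists ord_max => /=; rewrite (ltW tN')/= natr1.
have [|a Ha] := IH isT; first by rewrite t0.
by exists (widen_ord (leqnSn _) a).
Qed.

(** The grid has corner [o] and mesh [e]. Its closed cells of half-side [e / 2] cover, its open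
    cells are disjoint; [volume_ccube_le_cube] later disposes of the faces. *)
Definition grid_center m N (o : 'rV[R]_m) (e : R) (c : {ffun 'I_m -> 'I_N}) : 'rV[R]_m :=
  \row_l (o 0 l + e * ((c l)%:R + 2^-1)).

Lemma grid_cover m N (o x : 'rV[R]_m) (e : R) : 0 < e -> (0 < N)%N ->
  (forall l, o 0 l <= x 0 l <= o 0 l + e * N%:R) ->
  exists c : {ffun 'I_m -> 'I_N}, ccube (grid_center o e c) (e / 2) x.
Proof.
move=> e0 N0 H.
have /choice[f Hf] (l : 'I_m) : exists a : 'I_N,
    a%:R <= (x 0 l - o 0 l) / e <= a%:R + 1.
  apply: grid_interval => //; have /andP[H1 H2] := H l.
  by rewrite divr_ge0 ?(ltW e0)/= ?ler_pdivrMr// ?subr_ge0// lerBlDl mulrC.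
exists [ffun l => f l] => l; rewrite mxE ffunE ler_norml.
have /andP[] := Hf l; rewrite ler_pdivlMr// ler_pdivrMr//; lra.
Qed.

Lemma grid_disjoint m N (o : 'rV[R]_m) (e : R) (c c' : {ffun 'I_m -> 'I_N}) x : 0 < e ->
  cube (grid_center o e c) (e / 2) x -> cube (grid_center o e c') (e / 2) x -> c = c'.
Proof.
move=> e0 H H'; apply/ffunP => l; apply/val_inj => /=.
have := H l; have := H' l; rewrite !mxE !ltr_norml => /andP[h1 h2] /andP[h3 h4].
have [h5 h6] : (c l)%:R < (c' l)%:R + 1 :> R /\ (c' l)%:R < (c l)%:R + 1 :> R.
  by split; rewrite -(ltr_pM2l e0); lra.
by apply/eqP; move: h5 h6; rewrite !natr1 !ltr_nat !ltnS eqn_leq => -> ->.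
Qed.

End Grid.

(** Bernoulli's inequality in place of a limit [t --> 1]. Every argument that contracts a set by a
    factor below 1 is concluded by this lemma. *)
Lemma ler_of_scaling {R : realType} (d : nat) (a b : R) : 0 <= a ->
  (forall t, 0 < t -> t < 1 -> t ^+ d * a <= b) -> a <= b.
Proof.
move=> a0 H; apply/ler_addgt0Pr => e e0.
have bern (t : R) : 0 <= t -> t <= 1 -> 1 - d%:R * t <= (1 - t) ^+ d.
  move=> t0 t1; elim: d {H} => [|k IH]; first by rewrite expr0 mul0r subr0.
  rewrite exprS -natr1; apply: (@le_trans _ _ ((1 - t) * (1 - k%:R * t))).
    have : 0 <= k%:R * (t * t) by rewrite mulr_ge0// mulr_ge0.
    lra.
  by rewrite ler_wpM2l// subr_ge0.
(* Small enough for the Bernoulli loss [d%:R * t * a] to be at most [e]; the added ones keep the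
   denominator positive. *)
pose t := Num.min 2^-1 (e / ((d%:R + 1) * (a + 1))).
have da0 : 0 < (d%:R + 1) * (a + 1) by rewrite mulr_gt0// ltr_wpDl.
have t0 : 0 < t by rewrite lt_min invr_gt0 ltr0n/= divr_gt0.
have t1 : t <= 2^-1 by rewrite ge_min lexx.
have te : t * ((d%:R + 1) * (a + 1)) <= e.
  by rewrite -ler_pdivlMr// ge_min lexx orbT.
have := H (1 - t).
have := bern t (ltW t0) ltac:(move: t1; lra) => B.
have : (1 - d%:R * t) * a <= (1 - t) ^+ d * a by rewrite ler_wpM2r.
have t2 : 0 < 1 - t by move: t1; lra.
have t3 : 1 - t < 1 by move: t0; lra.
move=> h1 /(_ t2 t3) h2.
have h3 : d%:R * t * a <= t * ((d%:R + 1) * (a + 1)).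
  rewrite -mulrA mulrCA ler_pM2l// ler_pM//; [by rewrite lerDl|by rewrite lerDl].
move: h1 h2 h3 te; rewrite mulrBl mul1r; lra.
Qed.

Section UnitCube.
Context {R : realType}.
Local Open Scope ereal_scope.

Lemma nneseries_finite (a : nat -> \bar R) n : (forall k, 0 <= a k) ->
  (forall k, (n <= k)%N -> a k = 0) -> \sum_(k <oo) a k = \sum_(k < n) a k.
Proof.
move=> a0 an; rewrite (nneseries_split 0 n)// add0n eseries0 ?adde0 ?big_mkord//.
by move=> k nk _; exact: an.
Qed.

Lemma finite_cover_hausdorff_delta m d (I : finType) (F : I -> set 'rV[R]_m) (e : R) A :
  (A `<=` \bigcup_i F i) -> (forall i, diam (F i) <= e%:E) ->
  hausdorff_delta d e A <= \sum_i diam_pow d (F i).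
Proof.
move=> AF Fe.
pose G k := oapp (fun i : 'I_#|I| => F (enum_val i)) set0 (insub k).
have G0 k : (#|I| <= k)%N -> G k = set0.
  by move=> Ik; rewrite /G insubF// ltnNge Ik.
have GE (i : 'I_#|I|) : G i = F (enum_val i) by rewrite /G valK.
rewrite (reindex (@enum_val I I))/=; last by apply: onW_bij; exact: enum_val_bij.
apply: (@le_trans _ _ (\sum_(k <oo) diam_pow d (G k))); last first.
  rewrite (@nneseries_finite _ #|I|).
  - by apply: lee_sum => i _; rewrite GE.
  - by move=> k; exact: diam_pow_ge0.
  - by move=> k Ik; rewrite G0// diam_pow0.
apply: ereal_inf_lbound; exists G => //; split.
  move=> x /AF[i _ Fx]; exists (enum_rank i) => //.
  by rewrite GE enum_rankK.
move=> k; have [kI|Ik] := ltnP k #|I|.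
  by rewrite -[k]/(nat_of_ord (Ordinal kI)) GE.
by rewrite G0//; apply: diam_le.
Qed.

(** The [N ^ m] cells of side [1 / N] have diameter at most [m / N], so their weights add up to at
    most [m ^ m] at every scale. *)
Lemma hausdorff_unnormalized_unit_cube_lty m : (0 < m)%N ->
  hausdorff_unnormalized m (unit_cube : set 'rV[R]_m) < +oo.
Proof.
move=> m0; have m0' : (0 < m%:R :> R)%R by rewrite ltr0n.
apply: (@le_lt_trans _ _ (m%:R ^+ m)%:E); last exact: ltry.
apply: ge_ereal_sup => _ [e /= e0 <-].
pose N := (Num.bound (m%:R / e)).+1.
have N0 : (0 < N%:R :> R)%R by rewrite ltr0n.
have Ne : (m%:R / N%:R <= e)%R.
  rewrite ler_pdivrMr// mulrC -ler_pdivrMr// (le_trans (ltW (archi_boundP _)))//.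
    by rewrite divr_ge0// ltW.
  by rewrite ler_nat leqnSn.
pose F (c : {ffun 'I_m -> 'I_N}) : set 'rV[R]_m :=
  ccube (grid_center 0 N%:R^-1 c) (N%:R^-1 / 2).
have dF c : diam (F c) <= (m%:R / N%:R)%:E.
  apply: (le_trans (diam_ccube _ _)); first by rewrite divr_ge0// invr_ge0 ltW.
  by rewrite lee_fin [X in (_ * X)%R](_ : _ = N%:R^-1)%R// mulrC divfK.
apply: (@le_trans _ _ (\sum_c diam_pow m (F c))).
  apply: finite_cover_hausdorff_delta => [x Hx|c]; last first.
    by apply: le_trans (dF c) _; rewrite lee_fin.
  have [|//||c Hc] := @grid_cover R m N 0 x N%:R^-1; last by exists c.
    by rewrite invr_gt0.
  by move=> l; rewrite mxE add0r mulVf ?gt_eqF//; exact: Hx.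
apply: (@le_trans _ _ (\sum_(c : {ffun 'I_m -> 'I_N}) ((m%:R / N%:R) ^+ m)%:E)).
  by apply: lee_sum => c _; apply: diam_pow_le => //; rewrite divr_ge0// ltW.
rewrite sumEFin lee_fin sumr_const card_ffun !card_ord -[leLHS]mulr_natr.
by rewrite expr_div_n natrX divfK// expf_neq0 ?gt_eqF.
Qed.

(** Finitely many cubes of half-side [r_k] enclosing members of a cover contain all [N ^ m] grid
    points, and each contains at most [(3 N r_k) ^ m] of them. Hence 3^m times the sum of the
    [r_k ^ m] is at least 1. The passage from [r_k] to the diameters costs another 2^m, which gives
    6^m. *)
Lemma hausdorff_unnormalized_unit_cube_gt0 m : (0 < m)%N ->
  0 < hausdorff_unnormalized m (unit_cube : set 'rV[R]_m).
Proof.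
move=> m0; apply: (@lt_le_trans _ _ ((6 ^+ m)^-1%:E)).
  by rewrite lte_fin invr_gt0 exprn_gt0.
apply: le_trans (hausdorff_delta_le_unnormalized m _ (ltr01)).
apply: le_ereal_inf_tmp => _ [F [AF Fe] <-].
have Fd k : diam (F k) < +oo by rewrite (le_lt_trans (Fe k))// ltry.
apply/lee_addgt0Pr => e e0.
have e2 k : (0 < e / (2 ^ k.+1)%:R)%R by rewrite divr_gt0// ltr0n expn_gt0.
(* The half-side is the diameter plus a small [r], so that the open cube is not degenerate when the
   diameter is 0. The factor 2^m comes from bounding a sum by twice the maximum. *)
have /choice[yr Hyr] (k : nat) : exists yr : 'rV[R]_m * R, [/\ (0 < yr.2)%R,
    F k `<=` cube yr.1 yr.2 &
    (yr.2 ^+ m)%:E <= (2 ^+ m)%:E * (diam_pow m (F k) + (e / (2 ^ k.+1)%:R)%:E)].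
  pose r := Num.min 1%R (e / (2 ^ k.+1)%:R)%R.
  have r0 : (0 < r)%R by rewrite lt_min ltr01 e2.
  have r1 : (r <= 1)%R by rewrite ge_min lexx.
  have rm : (r ^+ m <= e / (2 ^ k.+1)%:R)%R.
    apply: (@le_trans _ _ r); last by rewrite ge_min lexx orbT.
    by case: (m) m0 => // m' _; rewrite exprS ler_piMr ?(ltW r0)// exprn_ile1// ltW.
  have [Fk|/set0P F0] := eqVneq (F k) set0.
    exists (0%R, r); split => //=; first by rewrite Fk.
    rewrite Fk diam_pow0 add0e -EFinM lee_fin.
    by rewrite (le_trans rm)// ler_peMl ?(ltW (e2 k))// exprn_ege1// ler1n.
  have [y Fy] := F0.
  have fd : diam (F k) \is a fin_num by rewrite ge0_fin_numE// diam_ge0.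
  have d0 : (0 <= fine (diam (F k)))%R by rewrite fine_ge0// diam_ge0.
  exists (y, fine (diam (F k)) + r)%R; split => /=; first by rewrite ltr_wpDl.
    move=> z Fz i; have := enorm_coord (z - y)%R i; rewrite !mxE => /le_lt_trans; apply.
    have := diam_ge Fz Fy; rewrite -(fineK fd) lee_fin => /le_lt_trans; apply.
    by rewrite ltrDl.
  rewrite /diam_pow ifF; last by apply/negbTE/set0P.
  rewrite -(fineK fd) -EFin_expe -EFinD -EFinM lee_fin.
  apply: (@le_trans _ _ ((2 * Num.max (fine (diam (F k))) r) ^+ m)%R).
    apply: lerXn2r; rewrite ?nnegrE ?addr_ge0 ?mulr_ge0 ?le_max ?d0 ?(ltW r0)//.
    rewrite [leRHS]mulr_natl mulr2n lerD// le_max lexx ?orbT//.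
  rewrite exprMn ler_pM2l ?exprn_gt0//.
  rewrite /Num.max; case: ifP => _.
    by rewrite (le_trans rm)// lerDr exprn_ge0.
  by rewrite lerDl (ltW (e2 k)).
have : cover_compact (unit_cube : set 'rV[R]_m).
  rewrite -compact_cover unit_cubeE; apply: (@compact_ccubeP _ _ _ 1%R).
    exact: closed_ccube.
  move=> x H i; have := H i; rewrite !mxE subr0 !ler_norml; lra.
move=> /(_ nat setT (fun k => cube (yr k).1 (yr k).2)) [].
- by move=> k _; exact: open_cube.
- by move=> x /AF[k _ Fx]; exists k => //; case: (Hyr k) => _ H _; exact: H.
move=> D _ DF.
pose M := (\max_(k <- finmap.enum_fset D) k).+1.
have cM x : unit_cube x -> exists k : 'I_M, cube (yr k).1 (yr k).2 x.
  move=> /DF[k /= kD H].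
  have kM : (k < M)%N by rewrite /M ltnS; exact: (@leq_bigmax_seq _ (finmap.enum_fset D) xpredT id).
  by exists (Ordinal kM).
(* Fine enough that [N * r >= 1] for the finitely many cubes kept, whence
   [2 * N * r + 1 <= 3 * N * r]. *)
pose N := (\max_(k < M) Num.bound ((yr k).2)^-1).+1.
have N0 : (0 < N%:R :> R)%R by rewrite ltr0n.
have Nr (k : 'I_M) : (1 <= N%:R * (yr k).2)%R.
  case: (Hyr k) => r0 _ _; rewrite -ler_pdivrMr// div1r.
  rewrite (le_trans (ltW (archi_boundP _)))// ?invr_ge0 ?(ltW r0)// ler_nat.
  by rewrite /N ltnW// ltnS; exact: (@leq_bigmax _ (fun k : 'I_M => Num.bound ((yr k).2)^-1) k).
have count : (1 <= \sum_(k < M) 3 ^+ m * (yr k).2 ^+ m)%R.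
  rewrite -(ler_pM2l (exprn_gt0 m N0)) mulr1 mulr_sumr.
  apply: (@le_trans _ _ (\sum_(k < M) (2 * N%:R * (yr k).2 + 1) ^+ m)%R); last first.
    apply: ler_sum => k _; rewrite -!exprMn; case: (Hyr k) => r0 _ _.
    apply: lerXn2r; rewrite ?nnegrE ?addr_ge0 ?mulr_ge0 ?(ltW r0)//.
    by have := Nr k; lra.
  apply: (@le_trans _ _ (\sum_(k < M) \sum_(c : {ffun 'I_m -> 'I_N})
     (`[< cube (yr k).1 (yr k).2 (\row_l ((c l)%:R / N%:R)) >])%:R)%R); last first.
    by apply: ler_sum => k _; apply: grid_count => //; case: (Hyr k) => /ltW.
  rewrite exchange_big /=.
  apply: (@le_trans _ _ (\sum_(c : {ffun 'I_m -> 'I_N}) 1)%R).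
    by rewrite sumr_const card_ffun !card_ord natrX.
  apply: ler_sum => c _.
  have [|k Hk] := cM (\row_l ((c l)%:R / N%:R))%R.
    move=> l; rewrite mxE divr_ge0 ?ler0n//= ler_pdivrMr// mul1r ler_nat.
    by apply: ltnW.
  by rewrite (bigD1 k)//= (asboolT Hk) lerDl sumr_ge0.
have s0 k : 0 <= diam_pow m (F k) + (e / (2 ^ k.+1)%:R)%:E.
  by rewrite adde_ge0 ?diam_pow_ge0// lee_fin ltW.
apply: (@le_trans _ _ (\sum_(k <oo) (diam_pow m (F k) + (e / (2 ^ k.+1)%:R)%:E))); last first.
  by apply: epsilon_trick; [move=> k; exact: diam_pow_ge0|exact: ltW].
have -> : 6 ^- m = ((6 ^+ m)^-1 * 1)%R :> R by rewrite mulr1.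
rewrite EFinM lee_pdivrMl; last by rewrite exprn_gt0.
apply: (@le_trans _ _ (\sum_(k < M) 3 ^+ m * (yr k).2 ^+ m)%R%:E).
  by rewrite lee_fin.
rewrite -nneseriesZl//.
apply: (@le_trans _ _ (\sum_(0 <= k < M) (6 ^+ m)%:E * (diam_pow m (F k) + (e / (2 ^
  k.+1)%:R)%:E))); last first.
  apply: nneseries_lim_ge => k _ _; rewrite mule_ge0// lee_fin exprn_ge0//.
rewrite big_mkord -sumEFin; apply: lee_sum => k _; case: (Hyr k) => _ _ H.
have -> : (6 = 3 * 2 :> R)%R by rewrite -natrM.
by rewrite exprMn 2!EFinM -muleA lee_pmul2l// lte_fin exprn_gt0.
Qed.

End UnitCube.

(** * Volume of cubes and regularity of volume *)

Section Volume.
Context {R : realType} {m : nat}.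
Hypothesis m_gt0 : (0 < m)%N.
Local Notation mu := (volume R m).
Local Open Scope ereal_scope.

Lemma hausdorff_affine d (a : 'rV[R]_m) (r : R) (A : set 'rV[R]_m) : (0 < r)%R ->
  hausdorff d [set (a + r *: x)%R | x in A] = (r ^+ d)%:E * hausdorff d A.
Proof. by move=> r0; rewrite /hausdorff hausdorff_unnormalized_affine// muleCA. Qed.

Lemma volume_affine (a : 'rV[R]_m) (r : R) (A : set 'rV[R]_m) : (0 < r)%R ->
  mu [set (a + r *: x)%R | x in A] = (r ^+ m)%:E * mu A.
Proof. exact: hausdorff_affine. Qed.

Lemma volume_unit_cube : mu unit_cube = 1.
Proof.
rewrite /volume /= /hausdorff.
have h0 := @hausdorff_unnormalized_unit_cube_gt0 R m m_gt0.
have hoo := @hausdorff_unnormalized_unit_cube_lty R m m_gt0.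
have fh : hausdorff_unnormalized m (unit_cube : set 'rV[R]_m) \is a fin_num.
  by rewrite ge0_fin_numE// ltW.
rewrite -{2}(fineK fh) -EFinM mulVf// gt_eqF// fine_gt0//.
by rewrite h0.
Qed.

Lemma volume_ccube (x : 'rV[R]_m) (r : R) : (0 < r)%R -> mu (ccube x r) = ((2 * r) ^+ m)%:E.
Proof.
move=> r0; rewrite -[RHS]mule1 -volume_unit_cube unit_cubeE.
have r20 : (0 < 2 * r)%R by rewrite mulr_gt0.
rewrite -(volume_affine (x - (2 * r) *: const_mx 2^-1)%R)//.
by rewrite affine_ccube// subrK mulrAC mulfV ?mul1r.
Qed.

(** The open cube contains the closed cubes of half-side [t * r] for all [t < 1]. *)
Lemma volume_cube (x : 'rV[R]_m) (r : R) : (0 < r)%R -> mu (cube x r) = ((2 * r) ^+ m)%:E.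
Proof.
move=> r0; apply/eqP; rewrite eq_le; apply/andP; split.
  by rewrite -(volume_ccube x r0); apply: le_outer_measure; exact: cube_subset.
have fin : mu (cube x r) \is a fin_num.
  rewrite ge0_fin_numE ?outer_measure_ge0//.
  rewrite (@le_lt_trans _ _ (mu (ccube x r)))//; last by rewrite volume_ccube// ltry.
  by apply: le_outer_measure; exact: cube_subset.
rewrite -(fineK fin) lee_fin; apply: (@ler_of_scaling _ m).
  by rewrite exprn_ge0// mulr_ge0// ltW.
move=> t t0 t1; rewrite -exprMn mulrCA -lee_fin (fineK fin).
have tr0 : (0 < t * r)%R by rewrite mulr_gt0.
rewrite -(volume_ccube x tr0); apply: le_outer_measure; apply: ccube_cube.
by rewrite gtr_pMl.
Qed.

Lemma volume_bounded_lty (A : set 'rV[R]_m) (x : 'rV[R]_m) (r : R) :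
  A `<=` ccube x r -> mu A < +oo.
Proof.
move=> Ar; pose r' := Num.max 1%R r.
have r'0 : (0 < r')%R by rewrite lt_max ltr01.
apply: (@le_lt_trans _ _ (mu (ccube x r'))); last by rewrite volume_ccube// ltry.
apply: le_outer_measure; apply: (subset_trans Ar); apply: ccubeS.
by rewrite le_max lexx orbT.
Qed.

Lemma closed_measurable_volume (F : set 'rV[R]_m) : closed F ->
  measurable (F : set (caratheodory_type mu)).
Proof. exact: closed_caratheodory. Qed.

Lemma open_measurable_volume (F : set 'rV[R]_m) : open F ->
  measurable (F : set (caratheodory_type mu)).
Proof.
move=> oF; rewrite -[F]setCK; apply: measurableC; apply: closed_measurable_volume.
exact: open_closedC.
Qed.

Lemma cube_measurable x r : measurable (cube x r : set (caratheodory_type mu)).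
Proof. by apply: open_measurable_volume; exact: open_cube. Qed.

Lemma ccube_measurable x r : measurable (ccube x r : set (caratheodory_type mu)).
Proof. by apply: closed_measurable_volume; exact: closed_ccube. Qed.

Let thicken (A : set 'rV[R]_m) (r : R) := \bigcup_(x in A) cube x r.

Let thicken_sub A r : (0 < r)%R -> A `<=` thicken A r.
Proof. by move=> r0 x Ax; exists x => // i; rewrite subrr normr0. Qed.

Let thicken_open A r : open (thicken A r).
Proof. by apply: bigcup_open => x _; exact: open_cube. Qed.

Let diam_thicken A r : (0 <= r)%R -> A !=set0 ->
  diam (thicken A r) <= diam A + (m%:R * (2 * r))%:E.
Proof.
move=> r0 A0; apply: diam_le => x y [x' Ax' xx'] [y' Ay' yy'].
apply: (@le_trans _ _ (enorm (x' - y') + enorm ((x - y) - (x' - y')))%:E).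
  by rewrite lee_fin; apply: le_trans (enormD _ _); rewrite [X in (_ <= enorm X)%R]addrC subrK.
rewrite EFinD leeD// ?diam_ge// lee_fin; apply: enorm_le; first by rewrite mulr_ge0.
move=> i; rewrite !mxE; have := xx' i; have := yy' i.
rewrite !ltr_norml ler_norml => /andP[h1 h2] /andP[h3 h4].
by apply/andP; split; move: h1 h2 h3 h4; lra.
Qed.

(** By continuity of the power function at the diameter, a set can be made open at an arbitrarily
    small cost in mesh and in weight. *)
Let thicken_small (A : set 'rV[R]_m) (e : R) : (0 < e)%R -> diam A < +oo ->
  exists2 r, (0 < r)%R & diam (thicken A r) <= diam A + e%:E /\
     diam_pow m (thicken A r) <= diam_pow m A + e%:E.
Proof.
move=> e0 Aoo; have [->|/set0P A0] := eqVneq A set0.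
  exists 1%R => //; rewrite /thicken bigcup_set0 diam_pow0 add0e lee_fin (ltW e0).
  by split => //; apply: diam_le => x y [].
have fA : diam A \is a fin_num by rewrite ge0_fin_numE// diam_ge0.
pose a := fine (diam A); have a0 : (0 <= a)%R by rewrite fine_ge0// diam_ge0.
have [d d0 dP] : exists2 d : R, (0 < d)%R & ((a + d) ^+ m <= a ^+ m + e)%R.
  have C : continuous (fun x : R => x ^+ m)%R by move=> x; exact: exprn_continuous.
  have /cvgrPdist_le /(_ e e0) := C a.
  move=> /nbhs_ballP[d /= d0 H]; exists (d / 2)%R; first by rewrite divr_gt0.
  have /H : ball a d (a + d / 2)%R.
    rewrite /ball /= opprD addrA subrr sub0r normrN gtr0_norm ?divr_gt0//.
    by rewrite ltr_pdivrMr// ltr_pMr// ltr1n.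
  by rewrite ler_norml /= => /andP[+ _]; lra.
pose d' := Num.min d e; have d'0 : (0 < d')%R by rewrite lt_min d0.
exists (d' / (m%:R * 2))%R; first by rewrite divr_gt0// mulr_gt0// ltr0n.
have r0 : (0 <= d' / (m%:R * 2))%R by rewrite divr_ge0 ?(ltW d'0)// mulr_ge0.
have E : (m%:R * (2 * (d' / (m%:R * 2))) = d')%R.
  by rewrite mulrA mulrC divfK// gt_eqF// mulr_gt0// ltr0n.
have := diam_thicken r0 A0; rewrite E => dT; split.
  by rewrite (le_trans dT)// leeD2l// lee_fin ge_min lexx orbT.
rewrite {2}/diam_pow ifF; last by apply/negbTE/set0P.
rewrite -(fineK fA) -/a -EFin_expe -EFinD.
have ad : (0 <= a + d')%R by rewrite addr_ge0// ltW.
apply: le_trans (_ : ((a + d') ^+ m)%:E <= _); last first.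
  rewrite lee_fin; apply: le_trans dP; apply: lerXn2r; rewrite ?nnegrE// ?addr_ge0// ?(ltW d0)//.
  by rewrite lerD2l ge_min lexx.
apply: diam_pow_le => //; rewrite (le_trans dT)// -(fineK fA) -EFinD//.
Qed.


(** Only the content of [U] at scale [e + e] is controlled, not its Hausdorff measure, which is a
    supremum over finer scales. *)
Let hausdorff_open_cover (A : set 'rV[R]_m) (e : R) : (0 < e)%R ->
  hausdorff_unnormalized m A < +oo ->
  exists U, [/\ open U, A `<=` U &
    hausdorff_delta m (e + e) U <= hausdorff_unnormalized m A + (e + e)%:E].
Proof.
move=> e0 Aoo; have [F [AF Fe]] : exists2 F, delta_cover e A F &
    \sum_(k <oo) diam_pow m (F k) <= hausdorff_unnormalized m A + e%:E.
  have fA : hausdorff_delta m e A \is a fin_num.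
    rewrite ge0_fin_numE ?hausdorff_delta_ge0//.
    exact: le_lt_trans (hausdorff_delta_le_unnormalized m A e0) Aoo.
  have [_ [F AF <-] Fe] := lb_ereal_inf_adherent e0 fA; exists F => //.
  rewrite (le_trans (ltW Fe))// leeD2r//.
  exact: hausdorff_delta_le_unnormalized.
move=> FS; have e2 k : (0 < e / (2 ^ k.+1)%:R)%R by rewrite divr_gt0// ltr0n expn_gt0.
have /choice[r Hr] (k : nat) : exists r, (0 < r)%R /\
    (diam (thicken (F k) r) <= diam (F k) + (e / (2 ^ k.+1)%:R)%:E /\
     diam_pow m (thicken (F k) r) <= diam_pow m (F k) + (e / (2 ^ k.+1)%:R)%:E).
  have [|r r0 H] := @thicken_small (F k) _ (e2 k).
    by rewrite (le_lt_trans (Fe k))// ltry.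
  by exists r.
exists (\bigcup_k thicken (F k) (r k)); split.
- by apply: bigcup_open => k _; exact: thicken_open.
- move=> x /AF[k _ Fx]; exists k => //; apply: thicken_sub => //.
  by case: (Hr k).
- apply: (@le_trans _ _ (\sum_(k <oo) diam_pow m (thicken (F k) (r k)))).
    apply: ereal_inf_lbound; exists (fun k => thicken (F k) (r k)) => //; split => //.
    move=> k; case: (Hr k) => _ [H _]; rewrite (le_trans H)//.
    rewrite EFinD leeD// lee_fin ler_pdivrMr ?ltr0n ?expn_gt0//.
    by rewrite ler_peMr ?(ltW e0)// ler1n expn_gt0.
  apply: (@le_trans _ _ (\sum_(k <oo) (diam_pow m (F k) + (e / (2 ^ k.+1)%:R)%:E))).
    apply: lee_nneseries => [k _ _|k _]; first exact: diam_pow_ge0.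
    by case: (Hr k) => _ [].
  apply: (le_trans (epsilon_trick _ _ _)); [by move=> k; exact: diam_pow_ge0|exact: ltW|].
  by rewrite EFinD addeA leeD2r.
Qed.

Let hausdorff_constant_gt0 :
  (0 < (fine (hausdorff_unnormalized m (unit_cube : set 'rV[R]_m)))^-1)%R.
Proof.
rewrite invr_gt0 fine_gt0// hausdorff_unnormalized_unit_cube_gt0//.
exact: hausdorff_unnormalized_unit_cube_lty.
Qed.

(** In the intersection of the open sets for [e = 1 / (j + 1)] every scale is controlled, so its
    volume is at most that of [A]. Continuity from above, valid in a bounded cube, leads back to a
    finite intersection, which is open. *)
Lemma volume_outer_regular (A : set 'rV[R]_m) (r e : R) : (0 < e)%R -> A `<=` cube 0 r ->
  exists U, [/\ open U, A `<=` U, U `<=` cube 0 r & mu U <= mu A + e%:E].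
Proof.
move=> e0 Ar.
have muA : mu A < +oo by apply: volume_bounded_lty (subset_trans Ar (@cube_subset _ _ _ _)).
have HA : hausdorff_unnormalized m A < +oo.
  rewrite ltNge leye_eq; apply/negP => /eqP E; move: muA.
  by rewrite /volume /= /hausdorff E mulry gtr0_sg ?mul1e.
have /choice[U HU] (j : nat) := @hausdorff_open_cover A j.+1%:R^-1 ltac:(by rewrite invr_gt0
  ltr0n) HA.
pose V (J : nat) : set 'rV[R]_m := [set x | forall j, (j <= J)%N -> U j x].
have oV J : open (V J).
  elim: J => [|J IH].
    rewrite (_ : V 0%N = U 0%N); first by case: (HU 0%N).
    by rewrite predeqE => x; split => [H|Ux [|j]//]; exact: H.
  rewrite (_ : V J.+1 = V J `&` U J.+1); first by apply: openI => //; case: (HU J.+1).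
  rewrite predeqE => x; split => [H|[H1 H2] j].
    by split => [j jJ|]; apply: H => //; exact: leqW.
  by rewrite leq_eqVlt => /orP[/eqP ->//|]; exact: H1.
pose G J : set (caratheodory_type mu) := cube 0 r `&` V J.
have oG J : open (G J : set 'rV[R]_m) by apply: openI => //; exact: open_cube.
have mG J : measurable (G J) by apply: open_measurable_volume; exact: oG.
have AG J : A `<=` G J.
  by move=> x Ax; split; [exact: Ar|move=> j _; case: (HU j) => _ H _; exact: H].
have Goo X : X `<=` G 0%N -> mu X < +oo.
  move=> XG; apply: (@volume_bounded_lty _ 0 r).
  by apply: (subset_trans XG) => x [/(@cube_subset _ _ _ _) H _].
have muG : mu (\bigcap_J G J) <= mu A.
  apply: lee_wpmul2l; first by rewrite lee_fin ltW.
  apply: ge_ereal_sup => _ [d /= d0 <-]; apply/lee_addgt0Pr => t t0.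
  pose s := Num.min d t; have s0 : (0 < s)%R by rewrite lt_min d0.
  have [j js] : exists j, (j.+1%:R^-1 + j.+1%:R^-1 <= s)%R.
    have s20 : (0 < s / 2)%R by rewrite divr_gt0.
    have [j] := ltr_add_invr s20; rewrite add0r => jg; exists j.
    by rewrite [leRHS]splitr lerD// ltW.
  have [_ _ HUj] := HU j.
  apply: (@le_trans _ _ (hausdorff_delta m (j.+1%:R^-1 + j.+1%:R^-1)%R (U j))).
    apply: (@le_trans _ _ (hausdorff_delta m d (U j))).
      apply: ereal_inf_le_tmp => _ [F [BF Fd] <-]; exists F => //; split => //.
      by apply: subset_trans BF => x /(_ j I) [_ /(_ j (leqnn j))].
    apply: hausdorff_delta_mono; rewrite (le_trans js)// ge_min lexx//.
  rewrite (le_trans HUj)// leeD2l// lee_fin (le_trans js)// ge_min lexx orbT//.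
have C : (mu \o G) J @[J --> \oo] --> mu (\bigcap_J G J).
  apply: (@nonincreasing_cvg_mu _ _ _ (volume_measure R m)) => //.
  - exact: Goo.
  - exact: bigcap_measurable.
  - move=> i j ij; apply/subsetPset => x [xr Hx]; split => // k ki.
    by apply: Hx; rewrite (leq_trans ki).
have [J GJ] : exists J, mu (G J) <= mu A + e%:E.
  apply: contrapT => /forallNP H.
  have : mu A + e%:E <= mu (\bigcap_J G J).
    rewrite -(cvg_lim _ C)//; apply: lime_ge; first by apply/cvg_ex; eexists; exact: C.
    by near=> J => /=; have /negP := H J; rewrite -ltNge => /ltW.
  move=> /le_trans/(_ muG); rewrite leNgt lteDl ?lte_fin ?e0//.
  by rewrite ge0_fin_numE ?outer_measure_ge0.
exists (G J); split; [exact: oG|exact: AG|by move=> x []|exact: GJ].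
Unshelve. all: by end_near. Qed.

(** A Lebesgue number: [d] is the least half radius in a finite subcover, so a cube of half-side [d]
    about a point of a half cube stays in the full one. *)
Lemma compact_cube_nbhs (K U : set 'rV[R]_m) : compact K -> open U -> K `<=` U ->
  exists2 d, (0 < d)%R & forall x, K x -> cube x d `<=` U.
Proof.
move=> cK oU KU.
have /choice[r Hr] (x : 'rV[R]_m) : exists r, (0 < r)%R /\ (K x -> cube x (r + r)%R `<=` U).
  have [Kx|nKx] := pselect (K x); last by exists 1%R.
  have [r r0 rU] := (open_cubeP U).1 oU x (KU x Kx).
  by exists (r / 2)%R; rewrite divr_gt0// -splitr.
have : cover_compact K by rewrite -compact_cover.
move=> /(_ _ K (fun x => cube x (r x))) [].
- by move=> x _; exact: open_cube.
- by move=> x Kx; exists x => // i; rewrite subrr normr0; case: (Hr x).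
move=> D DK KD.
have [d d0 dD] : exists2 d, (0 < d)%R & forall y, y \in finmap.enum_fset D -> (d <= r y)%R.
  elim: (finmap.enum_fset D) => [|y s [d d0 IH]]; first by exists 1%R.
  exists (Num.min d (r y)); first by rewrite lt_min d0; case: (Hr y).
  by move=> z; rewrite inE ge_min => /orP[/eqP ->|/IH ->//]; rewrite lexx orbT.
exists d => // x /KD[y /= yD xy] z xz.
have Ky : K y by have := DK y yD; rewrite inE.
case: (Hr y) => _ /(_ Ky); apply => i.
have := ler_distD (x 0%R i) (z 0%R i) (y 0%R i).
by have := xy i; have := xz i; have := dD y yD; lra.
Qed.

Lemma sum_disjoint_volume (I : finType) (Q : I -> set 'rV[R]_m) (X : set 'rV[R]_m) :
  (forall i, measurable (Q i : set (caratheodory_type mu))) ->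
  (forall i j x, Q i x -> Q j x -> i = j) ->
  measurable (X : set (caratheodory_type mu)) ->
  \sum_i mu (X `&` Q i) = mu (X `&` \bigcup_i Q i).
Proof.
move=> mQ tQ mX.
have := @measure_fin_bigcup _ _ (caratheodory_type mu) (volume_measure R m) I setT
  (fun i => X `&` Q i).
have -> : [set: I] = [set` index_enum I].
  by rewrite predeqE => i; split => // _; exact: mem_index_enum.
rewrite -(@fsbig_seq _ _ _ _ (index_enum I))//; last exact: index_enum_uniq.
rewrite setI_bigcupr (_ : [set` index_enum I] = setT); last first.
  by rewrite predeqE => i; split => // _; exact: mem_index_enum.
move=> -> //.
- exact: finite_finset.
- by apply/trivIsetP => i j _ _ ij; rewrite -subset0 => x [[_ Qi] [_ Qj]]; move: ij;
  rewrite (tQ i j x)// eqxx.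
- by move=> i _; apply: measurableI.
Qed.


(** [K] is the complement, within the cube, of an open set of nearly the same volume as the cube
    minus [E]. *)
Lemma volume_inner_regular (E : set 'rV[R]_m) (r e : R) : (0 < e)%R -> E `<=` ccube 0 r ->
  measurable (E : set (caratheodory_type mu)) ->
  exists K, [/\ closed K, K `<=` E & mu (E `\` K) <= e%:E].
Proof.
move=> e0 Er mE; pose A := ccube 0 r `\` E.
have mA : measurable (A : set (caratheodory_type mu)).
  by apply: measurableD => //; exact: ccube_measurable.
have Ar : A `<=` cube 0 (r + 1).
  by move=> x [xr _]; apply: ccube_cube xr; rewrite ltrDl.
have [U [oU AU _ muU]] := volume_outer_regular e0 Ar.
have mU : measurable (U : set (caratheodory_type mu)) by exact: open_measurable_volume.
exists (ccube 0 r `\` U); split.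
- rewrite setDE; apply: closedI; first exact: closed_ccube.
  exact: open_closedC.
- by move=> x [xr nUx]; apply: contrapT => nEx; apply: nUx; apply: AU.
have muA : mu A \is a fin_num.
  rewrite ge0_fin_numE ?outer_measure_ge0// (@volume_bounded_lty _ 0 r)//.
  by move=> x [].
apply: (@le_trans _ _ (mu (U `\` A))).
  apply: le_outer_measure => x [Ex H].
  have Ux : U x by apply: contrapT => nUx; apply: H; split => //; exact: Er.
  by split => // -[].
have : mu U = mu A + mu (U `\` A).
  have := measureU (volume_measure R m) mA (measurableD mU mA).
  by rewrite setDE setICA setICr setI0 -setDE setDUK// => /(_ erefl).
by move=> E1; move: muU; rewrite E1 leeD2lE.
Qed.

(** Takes the place of the Lebesgue density theorem. [E] and its complement in the cube are filled
    up to [e / 2] by disjoint compact sets [K1] and [K2]. A small cube meets at most one of them, so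
    the smaller of its two volumes is at most its volume outside [K1] and [K2]. Summed over disjoint
    cubes this is at most [e], however many there are. *)
Lemma oscillation_small (E : set 'rV[R]_m) (r e : R) : (0 < e)%R -> (0 < r)%R ->
  measurable (E : set (caratheodory_type mu)) ->
  exists2 d, (0 < d)%R & forall (I : finType) (x : I -> 'rV[R]_m) (s : R), (s <= d)%R ->
    (forall i, cube (x i) s `<=` ccube 0 r) ->
    (forall i j y, cube (x i) s y -> cube (x j) s y -> i = j) ->
    \sum_i mine (mu (cube (x i) s `&` E)) (mu (cube (x i) s `\` E)) <= e%:E.
Proof.
move=> e0 r0 mE; have e20 : (0 < e / 2)%R by rewrite divr_gt0.
have mB := ccube_measurable 0 r.
have [K1 [cK1 K1E muK1]] := @volume_inner_regular (ccube 0 r `&` E) r _ e20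
  (@subIsetl _ _ _) (measurableI _ _ mB mE).
have [K2 [cK2 K2E muK2]] := @volume_inner_regular (ccube 0 r `\` E) r _ e20
  (@subDsetl _ _ _) (measurableD mB mE).
have [d d0 Hd] : exists2 d, (0 < d)%R & forall x, K1 x -> cube x d `<=` ~` K2.
  apply: compact_cube_nbhs.
  - by apply: (@compact_ccubeP _ _ _ r) => // x /K1E[].
  - exact: closed_openC.
  - by move=> x /K1E[_ Ex] /K2E[].
exists (d / 2)%R; first by rewrite divr_gt0.
move=> I x s sd xr tx; pose K := K1 `|` K2.
have mK1 := closed_measurable_volume cK1; have mK2 := closed_measurable_volume cK2.
have mK : measurable (K : set (caratheodory_type mu)) by apply: measurableU.
apply: (@le_trans _ _ (\sum_i mu ((ccube 0 r `\` K) `&` cube (x i) s))).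
  apply: lee_sum => i _; rewrite ge_min.
  have [[y [K1y xy]]|H] := pselect (exists y, K1 y /\ cube (x i) s y).
    apply/orP; right; apply: le_outer_measure => z [xz nEz].
    split => //; split; first exact: xr.
    case=> [/K1E[]//|K2z]; apply: (Hd y K1y z) => // l.
    have := ler_distD (x i 0%R l) (z 0%R l) (y 0%R l).
    by have := xy l; have := xz l; rewrite (distrC (x i 0%R l)); move: sd; lra.
  apply/orP; left; apply: le_outer_measure => z [xz Ez].
  split => //; split; first exact: xr.
  by case=> [K1z|/K2E[]//]; apply: H; exists z.
rewrite sum_disjoint_volume//; last 2 first.
- by move=> i; exact: cube_measurable.
- by apply: measurableD.
apply: (@le_trans _ _ (mu (((ccube 0 r `&` E) `\` K1) `|` ((ccube 0 r `\` E) `\` K2)))).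
  apply: le_outer_measure => z [[zr nK] _].
  have [Ez|nEz] := pselect (E z).
    by left; split; [split|move=> K1z; apply: nK; left].
  by right; split; [split|move=> K2z; apply: nK; right].
apply: (le_trans (outer_measureU2 _ _ _)).
by rewrite [e]splitr EFinD leeD.
Qed.

End Volume.

Lemma is_derive_cvg (R : realType) (V : normedModType R) (f : V -> R) (a v : V) (l : R) :
  h^-1 *: (f (h *: v + a) - f a) @[h --> (0 : R)^'] --> l -> is_derive a v f l.
Proof.
move=> H; have C : cvg (h^-1 *: (f (h *: v + a) - f a) @[h --> (0 : R)^']) by apply/cvg_ex;
  exists l.
by apply: DeriveDef => //; rewrite /derive; apply: cvg_lim H.
Qed.

Lemma is_derive_cvgP (R : realType) (V : normedModType R) (f : V -> R) (a v : V) (l : R) :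
  is_derive a v f l -> h^-1 *: (f (h *: v + a) - f a) @[h --> (0 : R)^'] --> l.
Proof. by case=> C <-; exact: C. Qed.

Lemma is_derive_continuous (R : realType) (f df : R -> R) :
  (forall x : R, is_derive x 1 f (df x)) -> continuous f.
Proof.
move=> H x; apply: differentiable_continuous; apply/derivable1_diffP.
by case: (H x).
Qed.

(** * Smooth bump functions *)

Section FlatFunctions.
Context {R : realType}.
Implicit Types p : {poly R}.

(** The classical exp(-1/t), with a polynomial in 1/t as factor so that the family is closed under
    differentiation. *)
Definition flat p (t : R) : R := if 0 < t then p.[t^-1] * expR (- t^-1) else 0.

Lemma poly_expRN_bounded p n : exists2 C, 0 <= C &
  forall x, 0 <= x -> `|p.[x]| * x ^+ n * expR (- x) <= C.
Proof.
elim/poly_ind: p n => [|p c IH] n.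
  by exists 0 => // x _; rewrite horner0 normr0 !mul0r.
have [C C0 HC] := IH n.+1.
exists (C + `|c| * n`!%:R) => [|x x0]; first by rewrite addr_ge0// mulr_ge0.
rewrite hornerMXaddC; apply: (@le_trans _ _ ((`|p.[x] * x| + `|c|) * x ^+ n * expR (- x))).
  by rewrite ler_wpM2r ?expR_ge0// ler_wpM2r ?exprn_ge0// ler_normD.
rewrite !mulrDl lerD//.
  by rewrite normrM (ger0_norm x0) -(mulrA `|_|) -exprS; exact: HC.
rewrite -mulrA ler_wpM2l// expRN ler_pdivrMr ?expR_gt0//.
case: n {IH HC} => [|n].
  by rewrite expr0 mul1r (le_trans _ (expR_ge1Dx _))// lerDl.
rewrite mulrC -ler_pdivrMr ?ltr0n ?fact_gt0//.
by apply: le_trans (expR_ge1Dxn n x0); rewrite lerDr.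
Qed.

(** The quadratic order makes the difference quotient at 0 tend to 0. *)
Lemma flat_quadratic p : exists2 C, 0 <= C & forall t, `|flat p t| <= C * t ^+ 2.
Proof.
have [C C0 HC] := poly_expRN_bounded p 2; exists C => // t.
rewrite /flat; case: ifPn => [t0|_]; last by rewrite normr0 mulr_ge0 ?sqr_ge0.
have t20 : 0 < t ^+ 2 by rewrite exprn_gt0.
rewrite normrM (ger0_norm (expR_ge0 _)) -ler_pdivrMr//.
have ti : 0 <= t^-1 by rewrite invr_ge0 ltW.
by apply: le_trans (HC _ ti); rewrite exprVn mulrAC.
Qed.

Lemma flat_derive p (t : R) : is_derive t 1 (flat p) (flat ('X^2 * (p - p^`())) t).
Proof.
have [t0|t0|->] := ltgtP t 0.
- have -> : flat ('X^2 * (p - p^`())) t = 0 by rewrite /flat ltNge ltW.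
  apply: (@near_eq_is_derive _ _ _ (cst 0)).
  near=> s; rewrite /flat ifF//; apply/negbTE; rewrite -leNgt ltW//.
  by near: s; exact: lt_nbhsl.
- pose g (s : R) : R := p.[s^-1] * expR (- s^-1).
  apply: (@near_eq_is_derive _ _ _ g).
    near=> s; rewrite /flat ifT//.
    by near: s; exact: lt_nbhsr.
  have D1 : is_derive t 1 (fun s : R => s^-1) (- t ^- 2).
    have := @is_deriveV R id t 1 1; rewrite /= [_ *: _]mulr1; apply.
    by rewrite gt_eqF.
  have D2 : is_derive t 1 (fun s : R => - s^-1) (t ^- 2).
    by rewrite -[X in is_derive _ _ _ X]opprK; exact: is_deriveN.
  have D3 := is_derive1_comp (is_derive_poly p t^-1) D1.
  have D4 := @is_derive1_comp _ expR (fun s => - s^-1) t _ _ (is_derive_expR (- t^-1)) D2.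
  refine (is_derive_eq (is_deriveM D3 D4) _).
  rewrite /flat t0 !hornerE /= /GRing.scale /=; field.
  by rewrite gt_eqF.
- have -> : flat ('X^2 * (p - p^`())) 0 = 0 by rewrite /flat ltxx.
  have [C C0 HC] := flat_quadratic p.
  apply: is_derive_cvg; apply/cvgrPdist_le => e e0.
  near=> h; rewrite addr0 [flat p 0]/flat ltxx subr0 sub0r normrN.
  have h0 : h != 0 by near: h; exact: nbhs_dnbhs_neq.
  rewrite [X in flat p X](_ : _ = h); last by rewrite /= [LHS]mulr1.
  rewrite normrM normfV ler_pdivrMl ?normr_gt0//.
  apply: (le_trans (HC h)); rewrite -(real_normK (num_real h)) expr2 mulrCA.
  rewrite ler_wpM2l//; apply: (@le_trans _ _ ((C + 1) * `|h|)).
    by rewrite ler_wpM2r// lerDl.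
  rewrite -ler_pdivlMl ?ltr_wpDl// mulrC.
  near: h; apply: nbhs_dnbhs; apply/nbhs_ballP.
  exists (e / (C + 1)); first by rewrite /= divr_gt0// ltr_wpDl.
  by move=> h; rewrite /ball /= sub0r normrN => /ltW.
Unshelve. all: by end_near. Qed.

End FlatFunctions.

Section Smooth1.
Context {R : realType}.

(* Closure under primitives is what makes the fields below explicit: no
   differentiation under the integral sign is needed. *)
Inductive smooth1 : (R -> R) -> Prop :=
| smooth1_flat (p : {poly R}) (a s : R) : smooth1 (fun t => flat p (a + s * t))
| smooth1_cst (c : R) : smooth1 (fun=> c)
| smooth1_add f g : smooth1 f -> smooth1 g -> smooth1 (fun t => f t + g t)
| smooth1_mul f g : smooth1 f -> smooth1 g -> smooth1 (fun t => f t * g t)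
| smooth1_prim f F : smooth1 f -> (forall t : R, is_derive t 1 F (f t)) -> smooth1 F.

Lemma smooth1_derive f : smooth1 f ->
  exists2 df, smooth1 df & forall t : R, is_derive t 1 f (df t).
Proof.
elim=> {f} [p a s|c|f g _ [df sdf Df] _ [dg sdg Dg]|f g sf [df sdf Df] sg [dg sdg Dg]|f F sf _ DF].
- exists (fun t => s * flat ('X^2 * (p - p^`())) (a + s * t)).
    by apply: smooth1_mul; [exact: smooth1_cst|exact: smooth1_flat].
  move=> t; rewrite mulrC.
  apply: (@is_derive1_comp _ (flat p) (fun t => a + s * t) t _ _ (flat_derive p (a + s * t))).
  have := is_deriveD (is_derive_cst a t 1) (is_deriveZ s (is_derive_id t (1 : R))).
  by rewrite add0r [_ *: _]mulr1.
- exists (fun=> 0); first exact: smooth1_cst.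
  by move=> t; exact: is_derive_cst.
- exists (fun t => df t + dg t); first exact: smooth1_add.
  by move=> t; exact: is_deriveD.
- exists (fun t => f t * dg t + g t * df t).
    by apply: smooth1_add; apply: smooth1_mul.
  by move=> t; exact: is_deriveM.
- by exists f.
Qed.

Lemma smooth1_continuous f : smooth1 f -> continuous f.
Proof. by case/smooth1_derive => df _ H; apply: is_derive_continuous H. Qed.

Lemma smooth1_exp f n : smooth1 f -> smooth1 (fun t => f t ^+ n).
Proof.
move=> sf; elim: n => [|n IH].
  by rewrite (_ : (fun _ => _) = fun=> 1); [exact: smooth1_cst|apply/funext => t; rewrite expr0].
rewrite (_ : (fun _ => _) = fun t => f t * f t ^+ n).
  exact: smooth1_mul.
by apply/funext => t; rewrite exprS.
Qed.

(** Since [f] vanishes up to [a], the integral can start at [a - 1]: each [t >= a] is then interior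
    to an interval of integration, and to the left of [a] the integral is 0. *)
Lemma exists_primitive (f : R -> R) (a : R) : continuous f ->
  (forall t, t <= a -> f t = 0) ->
  exists F : R -> R, forall t : R, is_derive t 1 F (f t).
Proof.
move=> cf fa; pose b := a - 1.
pose F (x : R) : R := \int[lebesgue_measure]_(t in `[b, x]) f t.
exists F => t; have [ta|ta] := ltP t a.
  rewrite fa ?(ltW ta)//; apply: (@near_eq_is_derive _ _ _ (cst 0)).
  near=> s; rewrite /F /Rintegral integral0_eq// => x /=.
  rewrite in_itv /= => /andP[_ xs]; rewrite fa// (le_trans xs)// ltW//.
  by near: s; exact: lt_nbhsl.
have bt : b < t by rewrite /b ltrBlDr ltr_pwDr.
have [||D1 D2] := @continuous_FTC1_closed R f b t (t + 1) _ _ bt (cf t).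
- by rewrite ltrDl.
- apply: continuous_compact_integrable; first exact: segment_compact.
  by apply: continuous_subspaceT => x; exact: cf.
by apply: DeriveDef; [exact: D1|rewrite -derive1E; exact: D2].
Unshelve. all: by end_near. Qed.

End Smooth1.

Section Bump1.
Context {R : realType}.
Implicit Types (N : nat) (r t : R).

(** With [w] the product of the two flat functions, [w] is 0 outside the open interval of
    half-length [r] and in ]0, 1] inside. So [1 - (1 - w) ^ N] tends to the indicator of this
    interval, and it vanishes outside for every [N]: disjoint cubes have bumps that are never
    nonzero together. *)
Definition bump1 N r t : R := 1 - (1 - flat 1 (r + t) * flat 1 (r - t)) ^+ N.

Lemma flat1_itv t : 0 <= flat 1 t <= 1.
Proof.
rewrite /flat; case: ifPn => [t0|_]; last by rewrite lexx ler01.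
by rewrite hornerC mul1r expR_ge0 -expR0 ler_expR oppr_le0 invr_ge0 ltW.
Qed.

Lemma flat1_gt0 t : 0 < t -> 0 < flat 1 t.
Proof. by move=> t0; rewrite /flat t0 hornerC mul1r expR_gt0. Qed.

Lemma bump_smooth N r : smooth1 (bump1 N r).
Proof.
rewrite (_ : bump1 N r = fun t => 1 + (-1) * (1 + (-1) * (flat 1 (r + 1 * t) * flat 1 (r + (-1) *
  t))) ^+ N).
  apply: smooth1_add; first exact: smooth1_cst.
  apply: smooth1_mul; first exact: smooth1_cst.
  apply: smooth1_exp; apply: smooth1_add; first exact: smooth1_cst.
  apply: smooth1_mul; first exact: smooth1_cst.
  by apply: smooth1_mul; exact: smooth1_flat.
by apply/funext => t; rewrite /bump1 !mulN1r mul1r.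
Qed.

Let w_itv r t : 0 <= flat 1 (r + t) * flat 1 (r - t) <= 1.
Proof.
have /andP[a0 a1] := flat1_itv (r + t); have /andP[b0 b1] := flat1_itv (r - t).
by rewrite mulr_ge0// mulr_ile1.
Qed.

Lemma bump_itv N r t : 0 <= bump1 N r t <= 1.
Proof.
have /andP[w0 w1] := w_itv r t.
have h0 : 0 <= 1 - flat 1 (r + t) * flat 1 (r - t) :> R by rewrite subr_ge0.
have h1 : 1 - flat 1 (r + t) * flat 1 (r - t) <= 1 :> R by rewrite gerBl.
by rewrite /bump1 subr_ge0 exprn_ile1//= gerBl exprn_ge0.
Qed.

Lemma bump_eq0 N r t : r <= `|t| -> bump1 N r t = 0.
Proof.
move=> rt; suff E : flat 1 (r + t) * flat 1 (r - t) = 0 :> R.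
  by rewrite /bump1 E subr0 expr1n subrr.
move: rt; rewrite ler_normr => /orP[rt|rt]; rewrite /flat.
  by rewrite [in X in _ * X]ltNge subr_le0 rt /= mulr0.
by rewrite [in X in X * _]ltNge (_ : r + t <= 0) ?mul0r// -lerBrDr sub0r.
Qed.

Lemma bump_cvg r t : `|t| < r -> bump1 N r t @[N --> \oo] --> (1 : R).
Proof.
rewrite ltr_norml => /andP[t1 t2].
have w0 : 0 < flat 1 (r + t) * flat 1 (r - t) :> R.
  by rewrite mulr_gt0// flat1_gt0; lra.
rewrite -[X in _ --> X]subr0; apply: cvgB; first exact: cvg_cst.
apply: cvg_expr; have /andP[_ w1] := w_itv r t.
by rewrite ger0_norm ?subr_ge0// gtrBl.
Qed.

End Bump1.

Section SmoothM.
Context {R : realType} {m : nat}.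
Implicit Types (F : 'rV[R]_m -> R) (y : 'rV[R]_m) (i : 'I_m).

(** Polynomial expressions in one-variable functions of single coordinates suffice for all test
    fields below. The class is stable under partial derivatives, so smoothness to all orders is an
    induction on the list of directions. *)
Inductive smoothm : ('rV[R]_m -> R) -> Prop :=
| smoothm_coord i a f : smooth1 f -> smoothm (fun y => f (y 0 i - a))
| smoothm_cst c : smoothm (fun=> c)
| smoothm_add F G : smoothm F -> smoothm G -> smoothm (fun y => F y + G y)
| smoothm_mul F G : smoothm F -> smoothm G -> smoothm (fun y => F y * G y).

Lemma line_coord i l (h : R) y :
  (h *: (delta_mx 0 i : 'rV[R]_m) + y) 0 l = h * (l == i)%:R + y 0 l.
Proof. by rewrite !mxE eqxx. Qed.

Lemma smoothm_partial F i : smoothm F ->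
  exists2 dF, smoothm dF & forall y, is_derive y (delta_mx 0 i) F (dF y).
Proof.
elim=> {F} [l a f sf|c|F G _ [dF sF DF] _ [dG sG DG]|F G sF [dF sdF DF] sG [dG sdG DG]].
- have [df sdf Df] := smooth1_derive sf.
  exists (fun y => (l == i)%:R * df (y 0 l - a)).
    by apply: smoothm_mul; [exact: smoothm_cst|exact: smoothm_coord].
  move=> y; apply: is_derive_cvg.
  have [li|li] := eqVneq l i; last first.
    rewrite mul0r; apply: cvg_near_cst; near=> h.
    by rewrite line_coord (negbTE li) mulr0 add0r subrr scaler0.
  rewrite mul1r; have := is_derive_cvgP (Df (y 0 l - a)).
  apply: cvg_trans; apply: near_eq_cvg; near=> h.
  by rewrite line_coord li eqxx mulr1 addrA [h *: 1]mulr1.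
- exists (fun=> 0); first exact: smoothm_cst.
  by move=> y; exact: is_derive_cst.
- exists (fun y => dF y + dG y); first exact: smoothm_add.
  by move=> y; exact: is_deriveD.
- exists (fun y => F y * dG y + G y * dF y).
    by apply: smoothm_add; apply: smoothm_mul.
  by move=> y; exact: is_deriveM.
Unshelve. all: by end_near. Qed.

Lemma smoothm_continuous F : smoothm F -> continuous F.
Proof.
elim=> {F} [l a f sf|c|F G _ cF _ cG|F G _ cF _ cG] y.
- apply: (@continuous_comp _ _ _ (fun y : 'rV[R]_m => y 0 l - a) f); last exact: smooth1_continuous.
  have := @cvgB _ _ _ _ _ (fun y : 'rV[R]_m => y 0 l) (fun=> a) _ _
    (@coord_continuous R 1 m 0 l y) (cvg_cst a).
  exact.
- exact: (@cst_continuous _ _ c y).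
- exact: (cvgD (cF y) (cG y)).
- exact: (cvgM (cF y) (cG y)).
Qed.

Lemma smoothm_smooth_fun F : smoothm F -> smooth_fun F.
Proof.
move=> sF s; have sI : smoothm (iter_partial F s).
  elim: s F sF => [//|i s IH] F sF /=; apply: IH.
  have [dF sdF DF] := smoothm_partial i sF.
  by rewrite (_ : partial F i = dF)//; apply/funext => y; case: (DF y).
split; first exact: smoothm_continuous.
by move=> i x; have [dF _ DF] := smoothm_partial i sI; case: (DF x).
Qed.

Lemma smoothm_sum (I : Type) (s : seq I) (P : pred I) (F : I -> 'rV[R]_m -> R) :
  (forall c, smoothm (F c)) -> smoothm (fun y => \sum_(c <- s | P c) F c y).
Proof.
move=> sF; elim: s => [|c s IH].
  by rewrite (_ : (fun _ => _) = fun=> 0); [exact: smoothm_cst|apply/funext => y; rewrite big_nil].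
rewrite (_ : (fun _ => _) = fun y => (if P c then F c y else 0) + \sum_(c <- s | P c) F c y).
  by apply: smoothm_add => //; case: (P c) => //; exact: smoothm_cst.
by apply/funext => y; rewrite big_cons; case: ifP => //; rewrite add0r.
Qed.

Lemma smoothm_prod (I : Type) (s : seq I) (P : pred I) (F : I -> 'rV[R]_m -> R) :
  (forall c, smoothm (F c)) -> smoothm (fun y => \prod_(c <- s | P c) F c y).
Proof.
move=> sF; elim: s => [|c s IH].
  by rewrite (_ : (fun _ => _) = fun=> 1); [exact: smoothm_cst|apply/funext => y; rewrite big_nil].
rewrite (_ : (fun _ => _) = fun y => (if P c then F c y else 1) * \prod_(c <- s | P c) F c y).
  by apply: smoothm_mul => //; case: (P c) => //; exact: smoothm_cst.
by apply/funext => y; rewrite big_cons; case: ifP => //; rewrite mul1r.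
Qed.

End SmoothM.

Lemma is_derive_bigsum (R : realType) (I : finType) (f df : I -> R -> R) (t : R) :
  (forall c, is_derive t 1 (f c) (df c t)) ->
  is_derive t 1 (fun s => \sum_c f c s) (\sum_c df c t).
Proof.
move=> H; elim: (index_enum I) => [|c s IH].
  rewrite big_nil (_ : (fun _ => _) = cst 0); first exact: is_derive_cst.
  by apply/funext => u; rewrite big_nil.
rewrite big_cons (_ : (fun _ => _) = f c + (fun u => \sum_(j <- s) f j u)).
  exact: is_deriveD.
by apply/funext => u; rewrite big_cons.
Qed.

(** * Integrals of bump functions over a measurable set *)

Section ContinuousMeasurable.
Context {R : realType} {m : nat}.
Local Notation mu := (volume R m).

Lemma continuous_measurable_volume (F : 'rV[R]_m -> R) D : continuous F ->
  measurable_fun D (F : caratheodory_type mu -> R).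
Proof.
move=> cF; apply: measurable_funTS.
apply: (measurability _ (RGenOInfty.measurableE R)) => //.
move=> _ [_ [x ->] <-]; rewrite setTI; apply: open_measurable_volume.
by apply: open_comp => [y _|]; [exact: cF|exact: interval_open].
Qed.

Lemma indic_integrable (E A : set 'rV[R]_m) (M : R) :
  measurable (E : set (caratheodory_type mu)) ->
  measurable (A : set (caratheodory_type mu)) -> (mu A < +oo)%E ->
  (volume_measure R m).-integrable E (EFin \o (fun y => M * \1_A y)).
Proof.
move=> mE mA Aoo; rewrite (_ : EFin \o _ = fun y => M%:E * (\1_A y)%:E)%E//.
apply: integrableZl => //; apply/integrableP; split.
  by apply/measurable_EFinP.
rewrite (eq_integral (fun y : caratheodory_type mu => (\1_A (y : 'rV[R]_m))%:E)); last first.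
  by move=> y _; rewrite gee0_abs// lee_fin.
rewrite integral_indic//; apply: le_lt_trans Aoo.
by apply: le_outer_measure => y [].
Qed.

Lemma bounded_support_integrable (F : 'rV[R]_m -> R) (E A : set 'rV[R]_m) (M : R) :
  continuous F -> measurable (E : set (caratheodory_type mu)) ->
  measurable (A : set (caratheodory_type mu)) -> (mu A < +oo)%E ->
  (forall y, `|F y| <= M * \1_A y) ->
  (volume_measure R m).-integrable E (EFin \o F).
Proof.
move=> cF mE mA Aoo FM.
apply: (@le_integrable _ _ _ _ _ mE _ (EFin \o (fun y => M * \1_A y))).
- by apply/measurable_EFinP; exact: continuous_measurable_volume.
- by move=> y _ /=; rewrite lee_fin (le_trans (FM y))// ler_norm.
- exact: indic_integrable.
Qed.

End ContinuousMeasurable.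

Section Boxes.
Context {R : realType} {m : nat}.

Definition cbox (lo hi : 'I_m -> R) : set 'rV[R]_m :=
  [set y | forall l, lo l <= y 0 l <= hi l].

Lemma closed_cbox lo hi : closed (cbox lo hi).
Proof.
move=> y cy l; apply/andP; split; apply/ler_addgt0Pr => e e0;
  have [z [zb yz]] := cy _ (nbhs_cube y e0); have /andP[h1 h2] := zb l;
  have := yz l; rewrite ltr_norml => /andP[]; lra.
Qed.

Lemma compact_cbox lo hi : compact (cbox lo hi).
Proof.
pose M := \sum_l (`|lo l| + `|hi l|).
apply: (@compact_ccubeP _ _ _ M); first exact: closed_cbox.
move=> y yb l; rewrite mxE subr0; have /andP[h1 h2] := yb l.
have : `|lo l| + `|hi l| <= M.
  by rewrite /M (bigD1 l)//= lerDl sumr_ge0// => k _; rewrite addr_ge0.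
apply: le_trans; rewrite ler_norml.
have := ler_norm (hi l); have := ler_norm (- lo l); rewrite normrN.
have := normr_ge0 (lo l); have := normr_ge0 (hi l); lra.
Qed.

End Boxes.

Section CubeBump.
Context {R : realType} {m : nat}.
Local Notation mu := (volume R m).
Implicit Types (a y : 'rV[R]_m) (r : R).

Definition cube_bump N r a y : R := \prod_l bump1 N r (y 0 l - a 0 l).

Lemma cube_bump_smooth N r a : smoothm (cube_bump N r a).
Proof.
by apply: smoothm_prod => l; apply: smoothm_coord; exact: bump_smooth.
Qed.

Lemma cube_bump_itv N r a y : 0 <= cube_bump N r a y <= 1.
Proof.
apply/andP; split; first by apply: prodr_ge0 => l _; case/andP: (bump_itv N r (y 0 l - a 0 l)).
rewrite [leRHS](_ : 1 = \prod_(l < m) (1 : R)); last by rewrite big1.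
by apply: ler_prod => l _; exact: bump_itv.
Qed.

Lemma cube_bump_eq0 N r a y : ~ cube a r y -> cube_bump N r a y = 0.
Proof.
move=> H; have [l Hl] : exists l, r <= `|y 0 l - a 0 l|.
  apply: contrapT => /forallNP H'; apply: H => l.
  by rewrite ltNge; apply/negP; exact: H'.
by rewrite /cube_bump (bigD1 l)//= bump_eq0// mul0r.
Qed.

Lemma cube_bump_le_indic N r a y : `|cube_bump N r a y| <= 1 * \1_(cube a r) y.
Proof.
have /andP[h0 h1] := cube_bump_itv N r a y; rewrite mul1r indicE ger0_norm//.
have [|H] := boolP (y \in cube a r); first by [].
by rewrite cube_bump_eq0// => H'; move: H; rewrite mem_set.
Qed.

Lemma cube_bump_cvg r a y :
  cube_bump N r a y @[N --> \oo] --> (\1_(cube a r) y : R).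
Proof.
rewrite indicE; have [/set_mem H|H] := boolP (y \in cube a r); last first.
  apply: cvg_near_cst; near=> N; apply: cube_bump_eq0 => H'.
  by move: H; rewrite mem_set.
rewrite /cube_bump /=; elim: (index_enum _) => [|l s IH].
  by apply: cvg_near_cst; near=> N; rewrite big_nil.
under eq_fun do rewrite big_cons.
rewrite (_ : 1%:R = 1 * 1 :> R); last by rewrite mulr1.
by apply: cvgM => //; apply: bump_cvg; exact: H.
Unshelve. all: by end_near. Qed.

Section Integral.
Hypothesis m_gt0 : (0 < m)%N.
Variable E : set 'rV[R]_m.
Hypothesis mE : measurable (E : set (caratheodory_type mu)).

Lemma cube_bump_integrable N r a : (volume_measure R m).-integrable E (EFin \o cube_bump N r a).
Proof.
apply: (@bounded_support_integrable _ _ _ _ (cube a r) 1) => //.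
- exact: smoothm_continuous (cube_bump_smooth _ _ _).
- exact: cube_measurable.
- exact: (volume_bounded_lty m_gt0 (@cube_subset _ _ a r)).
- exact: cube_bump_le_indic.
Qed.

(** Dominated convergence, the indicator of the open cube being both the limit and the bound. *)
Lemma cube_bump_integral_cvg r a :
  \int[volume_measure R m]_(y in E) cube_bump N r a y @[N --> \oo] -->
  fine (mu (E `&` cube a r)).
Proof.
have mQ : measurable (cube a r : set (caratheodory_type mu)) by exact: cube_measurable.
have Qoo : (mu (cube a r) < +oo)%E := volume_bounded_lty m_gt0 (@cube_subset _ _ a r).
pose g (y : caratheodory_type mu) : \bar R := (\1_(cube a r) (y : 'rV[R]_m))%:E.
have mg D : measurable_fun D g.
  by apply/measurable_EFinP; exact: measurable_indic.
have ig : (volume_measure R m).-integrable E g.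
  apply/integrableP; split => //.
  rewrite (eq_integral g) => [|y _]; last by rewrite gee0_abs// lee_fin.
  rewrite integral_indic//; apply: le_lt_trans Qoo.
  by apply: le_outer_measure => y [].
have [] := @dominated_convergence _ _ R (volume_measure R m) E mE
  (fun N y => (cube_bump N r a y)%:E) g g _ (mg E) _ ig _.
- move=> N; apply/measurable_EFinP; apply: continuous_measurable_volume.
  exact: smoothm_continuous (cube_bump_smooth _ _ _).
- apply: aeW => y _; apply: cvg_EFin; last exact: cube_bump_cvg.
  exact: nearW.
- apply: aeW => y N _ /=; rewrite lee_fin.
  by have := cube_bump_le_indic N r a y; rewrite mul1r.
move=> _ _; rewrite integral_indic// setIC => C.
have fQ : mu (E `&` cube a r) \is a fin_num.
  rewrite ge0_fin_numE ?outer_measure_ge0//; apply: le_lt_trans Qoo.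
  by apply: le_outer_measure => y [].
by move: C; rewrite -[X in _ --> X](fineK fQ) => /fine_cvgP[].
Qed.

End Integral.
End CubeBump.

Lemma enorm_scale_delta {R : realType} {m : nat} (i : 'I_m) (c : R) :
  enorm (c *: (delta_mx 0 i : 'rV[R]_m)) = `|c|.
Proof.
rewrite enormZ -[RHS]mulr1; congr (_ * _).
rewrite /enorm (bigD1 i)//= big1 => [|l li]; rewrite !mxE !eqxx/=.
  by rewrite addr0 expr1n sqrtr1.
by rewrite (negbTE li) expr0n.
Qed.

(** At most one summand is nonzero. This keeps the test field of norm at most 1 whatever the number
    of cubes. *)
Lemma sum_orthogonal_le1 {R : realType} (I : finType) (s f : I -> R) :
  (forall c, `|s c| <= 1) -> (forall c, 0 <= f c <= 1) ->
  (forall c c', f c != 0 -> f c' != 0 -> c = c') -> `|\sum_c s c * f c| <= 1.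
Proof.
move=> s1 f1 fo; have [/existsP[c0 fc0]|H] := boolP [exists c, f c != 0]; last first.
  rewrite big1 ?normr0// => c _; move: H; rewrite negb_exists => /forallP/(_ c).
  by rewrite negbK => /eqP ->; rewrite mulr0.
rewrite (bigD1 c0)//= big1 ?addr0 => [|c cc0]; last first.
  have [->|fc] := eqVneq (f c) 0; first by rewrite mulr0.
  by rewrite (fo _ _ fc fc0) eqxx in cc0.
rewrite normrM; have /andP[f0 f1'] := f1 c0.
by rewrite (ger0_norm f0) mulr_ile1.
Qed.

Lemma MVT_global {R : realType} (f df : R -> R) (t u : R) :
  (forall v : R, is_derive v 1 f (df v)) -> t < u ->
  exists2 c, t < c < u & f u - f t = df c * (u - t).
Proof.
move=> D tu; have [] := @MVT _ f df t u tu (fun v _ => D v).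
  by apply: continuous_subspaceT => v; exact: is_derive_continuous D _.
by move=> c; rewrite in_itv /= => ctu ->; exists c.
Qed.

(** * Perimeter and translations *)

Section CoordinateTranslation.
Context {R : realType} {m : nat}.
Hypothesis m_gt0 : (0 < m)%N.
Local Notation mu := (volume R m).
Variables (C E : set 'rV[R]_m) (P : R).
Hypothesis mE : measurable (E : set (caratheodory_type mu)).
Hypothesis EP : (relative_perimeter C E <= P%:E)%E.
Variables (I : finType) (x : I -> 'rV[R]_m) (r tau : R) (s : I -> R) (i : 'I_m).
Hypotheses (r_gt0 : 0 < r) (tau_gt0 : 0 < tau).
Hypothesis s_le1 : forall c, `|s c| <= 1.
Hypothesis x_disjoint : forall c c' y, cube (x c) r y -> cube (x c') r y -> c = c'.
Hypothesis x_int : forall c y t, ccube (x c) r y -> 0 <= t <= tau ->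
  interior C (y + t *: delta_mx 0 i).

Section Field.
Variables (N : nat) (F : R -> R).
Hypothesis F_derive : forall t : R, is_derive t 1 F (bump1 N r t).

Let side c (y : 'rV[R]_m) := \prod_(l | l != i) bump1 N r (y 0 l - x c 0 l).

(** The signed sum of the bumps, averaged over the translations by [u *: delta_mx 0 i] with [u]
    between 0 and [tau]; the average is written with the primitive [F]. Its derivative along [i] is
    the difference between the bumps and their translates, divided by [tau]. *)
Let psi (y : 'rV[R]_m) : R := tau^-1 * \sum_c s c *
  (side c y * (F (y 0 i - x c 0 i) - F (y 0 i - (x c 0 i + tau)))).

Let xi (y : 'rV[R]_m) : 'rV[R]_m := psi y *: delta_mx 0 i.

Let shift c : 'rV[R]_m := x c + tau *: delta_mx 0 i.

Let psi_smooth : smoothm psi.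
Proof.
have sF : smooth1 F by apply: smooth1_prim F_derive; exact: bump_smooth.
apply: smoothm_mul; first exact: smoothm_cst.
apply: smoothm_sum => c; apply: smoothm_mul; first exact: smoothm_cst.
apply: smoothm_mul.
  by apply: smoothm_prod => l; apply: smoothm_coord; exact: bump_smooth.
rewrite (_ : (fun _ => _) = fun y : 'rV[R]_m => F (y 0 i - x c 0 i) + (-1) * F (y 0 i - (x c 0 i
  + tau))).
  apply: smoothm_add; first exact: smoothm_coord.
  by apply: smoothm_mul; [exact: smoothm_cst|exact: smoothm_coord].
by apply/funext => y; rewrite mulN1r.
Qed.

Let line_derive (a : R) (k : I -> R) (t : R) :
  is_derive t 1 (fun u => \sum_c k c * F (u - (x c 0 i + a)))
    (\sum_c k c * bump1 N r (t - (x c 0 i + a))).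
Proof.
apply: (@is_derive_bigsum _ _ (fun c u => k c * F (u - (x c 0 i + a)))
  (fun c t => k c * bump1 N r (t - (x c 0 i + a)))) => c.
have D : is_derive t 1 (fun u : R => u - (x c 0 i + a)) 1.
  have := is_deriveB (is_derive_id t (1 : R)) (is_derive_cst (x c 0 i + a) t 1).
  by rewrite subr0.
have := @is_derive1_comp _ F (fun u => u - (x c 0 i + a)) t _ _
  (F_derive (t - (x c 0 i + a))) D.
rewrite mulr1 => D1.
exact: (is_deriveZ (k c) D1).
Qed.

Let psi_partial y : partial psi i y =
  tau^-1 * \sum_c s c * (cube_bump N r (x c) y - cube_bump N r (shift c) y).
Proof.
have D : is_derive y (delta_mx 0 i) psi
    (tau^-1 * \sum_c s c * (cube_bump N r (x c) y - cube_bump N r (shift c) y)).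
  apply: is_derive_cvg.
  pose k c := tau^-1 * (s c * side c y).
  pose G (t : R) := \sum_c k c * F (t - (x c 0 i + 0)) - \sum_c k c * F (t - (x c 0 i + tau)).
  have DG := is_deriveB (line_derive 0 k (y 0 i)) (line_derive tau k (y 0 i)).
  have -> : tau^-1 * \sum_c s c * (cube_bump N r (x c) y - cube_bump N r (shift c) y) =
      \sum_c k c * bump1 N r (y 0 i - (x c 0 i + 0)) -
      \sum_c k c * bump1 N r (y 0 i - (x c 0 i + tau)).
    rewrite -sumrB mulr_sumr; apply: eq_bigr => c _.
    have E1 : cube_bump N r (x c) y = side c y * bump1 N r (y 0 i - x c 0 i).
      by rewrite /cube_bump (bigD1 i)//= mulrC.
    have E2 : cube_bump N r (shift c) y = side c y * bump1 N r (y 0 i - (x c 0 i + tau)).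
      rewrite /cube_bump (bigD1 i)//= mulrC; congr (_ * bump1 _ _ (_ - _)).
        apply: eq_bigr => l li; congr (bump1 _ _ (_ - _)).
        by rewrite /shift !mxE eqxx (negbTE li) mulr0 addr0.
      by rewrite /shift !mxE !eqxx mulr1.
    by rewrite E1 E2 /k addr0; ring.
  have := is_derive_cvgP DG; apply: cvg_trans; apply: near_eq_cvg; near=> h.
  congr (_ *: _).
  have psiE (z : 'rV[R]_m) : (forall l, l != i -> z 0 l = y 0 l) -> psi z = G (z 0 i).
    move=> zy; rewrite /psi /G -sumrB mulr_sumr; apply: eq_bigr => c _.
    have -> : side c z = side c y by apply: eq_bigr => l li; rewrite zy.
    by rewrite /k addr0; ring.
  rewrite [in RHS]psiE ?[in RHS]psiE//; last first.
    by move=> l li; rewrite line_coord (negbTE li) mulr0 add0r.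
  by rewrite line_coord eqxx mulr1 [h *: 1]mulr1.
by case: D => _ <-.
Unshelve. all: by end_near. Qed.

(** The mean value theorem is applied to the whole sum and not to each term, so a single
    intermediate point [z] appears, at which at most one bump is nonzero. *)
Let psi_le1 y : `|psi y| <= 1.
Proof.
rewrite /psi normrM gtr0_norm ?invr_gt0// ler_pdivrMl// mulr1.
pose k c := s c * side c y.
pose G (t : R) := \sum_c k c * F (t - (x c 0 i + 0)).
have DG t := line_derive 0 k t.
have -> : \sum_c s c * (side c y * (F (y 0 i - x c 0 i) - F (y 0 i - (x c 0 i + tau)))) =
    G (y 0 i) - G (y 0 i - tau).
  rewrite -sumrB; apply: eq_bigr => c _; rewrite /k !addr0.
  by rewrite (_ : y 0 i - tau - x c 0 i = y 0 i - (x c 0 i + tau)); ring.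
have yt : y 0 i - tau < y 0 i by rewrite ltrBlDr ltrDl.
have [t _ ->] := MVT_global DG yt.
have -> : y 0 i - (y 0 i - tau) = tau by ring.
rewrite normrM (gtr0_norm tau_gt0) ler_piMl ?(ltW tau_gt0)//.
pose z : 'rV[R]_m := \row_l (if l == i then t else y 0 l).
rewrite (eq_bigr (fun c => s c * cube_bump N r (x c) z)) => [|c _]; last first.
  rewrite /k -mulrA; congr (_ * _); rewrite /cube_bump [RHS](bigD1 i)//= mulrC.
  congr (_ * _); first by rewrite mxE eqxx addr0.
  by apply: eq_bigr => l li; rewrite mxE (negbTE li).
apply: sum_orthogonal_le1 => // [c|c c' H H']; first exact: cube_bump_itv.
apply: (@x_disjoint c c' z).
  by apply: contrapT => H1; move: H; rewrite cube_bump_eq0// eqxx.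
by apply: contrapT => H1; move: H'; rewrite cube_bump_eq0// eqxx.
Qed.

Let box c : set 'rV[R]_m := cbox (fun l => x c 0 l - r)
  (fun l => x c 0 l + r + (l == i)%:R * tau).

Let F_cst t u : t < u -> (forall v, t < v < u -> bump1 N r v = 0) -> F t = F u.
Proof.
move=> tu H; have [v /H bv] := MVT_global F_derive tu.
by rewrite bv mul0r => /eqP; rewrite subr_eq0 => /eqP.
Qed.

Let support_box y : xi y != 0 -> exists c, box c y.
Proof.
move=> xi0; have : psi y != 0.
  by apply: contraNneq xi0 => p0; rewrite /xi p0 scale0r.
rewrite /psi mulf_eq0 negb_or => /andP[_ H].
have [c Hc] : exists c, s c *
    (side c y * (F (y 0 i - x c 0 i) - F (y 0 i - (x c 0 i + tau)))) != 0.
  apply: contrapT => /forallNP H'; move/negP: H; apply; apply/eqP.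
  by apply: big1 => c _; apply/eqP; move: (H' c) => /negP; rewrite negbK.
exists c => l; move: Hc; rewrite mulf_eq0 negb_or => /andP[_].
rewrite mulf_eq0 negb_or => /andP[sc Fc].
have [->|li] := eqVneq l i; last first.
  have : `|y 0 l - x c 0 l| < r.
    rewrite ltNge; apply: contra sc => rl.
    by rewrite /side (bigD1 l)//= bump_eq0// mul0r.
  by rewrite ltr_norml mul0r addr0 => /andP[h1 h2]; apply/andP; split; lra.
rewrite mul1r; set t := y 0 i - x c 0 i.
have tt : t - tau < t by rewrite ltrBlDr ltrDl.
move: Fc; rewrite subr_eq0 opprD addrA -/t => Fc.
have h1 : - r < t.
  rewrite ltNge; apply: contra Fc => tr; rewrite eq_sym; apply/eqP;
    apply: F_cst => // v /andP[v1 v2].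
  by apply: bump_eq0; rewrite ler_normr; apply/orP; right; lra.
have h2 : t < r + tau.
  rewrite ltNge; apply: contra Fc => tr; rewrite eq_sym; apply/eqP;
    apply: F_cst => // v /andP[v1 v2].
  by apply: bump_eq0; rewrite ler_normr; apply/orP; left; lra.
by rewrite /t in h1 h2; apply/andP; split; lra.
Qed.

Let box_int c : box c `<=` interior C.
Proof.
(* [t] is the overshoot of [y] past the upper face: moving back by [t] leads into the closed cube,
   whose translates lie in the interior. *)
move=> y yb; pose t := Num.max 0 (y 0 i - x c 0 i - r).
have -> : y = (y - t *: delta_mx 0 i) + t *: delta_mx 0 i by rewrite subrK.
apply: (@x_int c) => [l|].
  have := yb l; rewrite !mxE eqxx /=.
  have [->|li] := eqVneq l i; rewrite ?mulr0 ?subr0 ler_norml.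
    rewrite mul1r mulr1 /t /Num.max; case: ifPn; rewrite -?leNgt => h /andP[h1 h2];
      by apply/andP; split; move: r_gt0; lra.
  by rewrite mul0r addr0 => /andP[h1 h2]; apply/andP; split; lra.
rewrite le_max lexx/= ge_max (ltW tau_gt0)/=.
by have := yb i; rewrite eqxx mul1r => /andP[_]; lra.
Qed.

Let xi_test : test_field C xi.
Proof.
pose S := \big[setU/set0]_(c <- index_enum I) box c.
have cS : compact S by apply: bigsetU_compact => c _; exact: compact_cbox.
have clS : closed S.
  rewrite /S; elim/big_ind : _ => //; first exact: closed0.
    exact: closedU.
  by move=> c _; exact: closed_cbox.
have supS : support_of xi `<=` S.
  rewrite /support_of [X in _ `<=` X](closure_id S).1//; apply: closure_subset => y /=.
  by move=> /support_box[c yc]; rewrite /S -bigcup_seq; exists c => //=; exact: mem_index_enum.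
split.
- move=> l; apply: smoothm_smooth_fun.
  rewrite (_ : (fun _ => _) = fun y => psi y * (l == i)%:R).
    by apply: smoothm_mul => //; exact: smoothm_cst.
  by apply/funext => y; rewrite !mxE eqxx.
- by apply: subclosed_compact supS => //; exact: closed_closure.
- apply: (subset_trans supS); rewrite /S -bigcup_seq => y [c _].
  exact: box_int.
- by move=> y; rewrite enorm_scale_delta.
Qed.

Let divergence_xi y : divergence xi y =
  tau^-1 * \sum_c s c * (cube_bump N r (x c) y - cube_bump N r (shift c) y).
Proof.
rewrite -psi_partial /divergence (bigD1 i)//= big1 ?addr0 => [|l li].
  congr (partial _ i y); apply/funext => z; by rewrite !mxE !eqxx mulr1.
rewrite (_ : (fun _ => _) = cst 0); first by rewrite /partial derive_cst.
by apply/funext => z; rewrite !mxE (negbTE li) andbF mulr0.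
Qed.

Let J a := \int[volume_measure R m]_(y in E) cube_bump N r a y.

Lemma bump_translation : \sum_c s c * (J (x c) - J (shift c)) <= tau * P.
Proof.
have JE a : (\int[volume_measure R m]_(y in E) (cube_bump N r a y)%:E = (J a)%:E)%E.
  rewrite /J /Rintegral fineK//; apply: integrable_fin_num => //.
  exact: cube_bump_integrable.
have : (\int[volume_measure R m]_(y in E) (divergence xi y)%:E <= P%:E)%E.
  by apply: le_trans EP; apply: ereal_sup_ubound; exists xi.
rewrite (eq_integral (fun y : caratheodory_type mu => \sum_c (tau^-1 * s c)%:E *
    ((cube_bump N r (x c) y)%:E - (cube_bump N r (shift c) y)%:E))%E); last first.
  move=> y _; rewrite divergence_xi mulr_sumr -sumEFin.
  by apply: eq_bigr => c _; rewrite mulrA EFinM EFinB.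
have ib a : (volume_measure R m).-integrable E (fun y => (cube_bump N r a y)%:E).
  exact: cube_bump_integrable.
rewrite integral_sum//; last first.
  by move=> c; apply: integrableZl => //; apply: integrableB.
rewrite (eq_bigr (fun c => ((tau^-1 * s c) * (J (x c) - J (shift c)))%:E)) => [|c _]; last first.
  rewrite integralZl//; last exact: integrableB.
  by rewrite integralB// !JE -EFinB -EFinM.
rewrite sumEFin lee_fin -ler_pdivrMl// mulr_sumr.
by under eq_bigr do rewrite -mulrA.
Qed.

End Field.

(** The coefficients [s c] are arbitrary in [-1, 1]; taken as signs of the differences they turn the
    sum into one of absolute values. *)
Lemma coordinate_translation :
  \sum_c s c * (fine (mu (E `&` cube (x c) r)) -
                fine (mu (E `&` cube (x c + tau *: delta_mx 0 i) r))) <= tau * P.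
Proof.
have H N : \sum_c s c * (\int[volume_measure R m]_(y in E) cube_bump N r (x c) y -
    \int[volume_measure R m]_(y in E) cube_bump N r (x c + tau *: delta_mx 0 i) y) <= tau * P.
  have [F DF] := @exists_primitive R (bump1 N r) (- r) (smooth1_continuous (bump_smooth N r))
     (fun t tr => @bump_eq0 R N r t ltac:(by rewrite ler_normr lerNr tr orbT)).
  exact: bump_translation DF.
apply: (@cvgr_to_le _ \oo _ _ (fun N => \sum_c s c *
    (\int[volume_measure R m]_(y in E) cube_bump N r (x c) y -
     \int[volume_measure R m]_(y in E) cube_bump N r (x c + tau *: delta_mx 0 i) y))).
  elim: (index_enum I) => [|c l IH].
    by apply: cvg_near_cst; near=> N; rewrite !big_nil.
  rewrite big_cons; under eq_fun do rewrite big_cons.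
  apply: cvgD => //; apply: cvgM; first exact: cvg_cst.
  by apply: cvgB; exact: cube_bump_integral_cvg.
by near=> N; exact: H.
Unshelve. all: by end_near. Qed.

End CoordinateTranslation.

Section Translation.
Context {R : realType} {m : nat}.
Hypothesis m_gt0 : (0 < m)%N.
Local Notation mu := (volume R m).
Variables (C E : set 'rV[R]_m) (P : R).
Hypothesis mE : measurable (E : set (caratheodory_type mu)).
Hypothesis EP : (relative_perimeter C E <= P%:E)%E.
Variables (I : finType) (r : R).
Hypothesis r_gt0 : 0 < r.
Implicit Types (x : I -> 'rV[R]_m) (w y z : 'rV[R]_m).

Let V a : R := fine (mu (E `&` cube a r)).

Let disjoint x := forall c c' y, cube (x c) r y -> cube (x c') r y -> c = c'.

Let cube_shift a w y : cube (a + w) r y -> cube a r (y - w).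
Proof. by move=> H l; have := H l; rewrite !mxE opprD addrA addrAC. Qed.

Let ccube_shift a w y : ccube (a + w) r y -> ccube a r (y - w).
Proof. by move=> H l; have := H l; rewrite !mxE opprD addrA addrAC. Qed.

Let disjoint_shift x w : disjoint x -> disjoint (fun c => x c + w).
Proof. by move=> dx c c' y /cube_shift H /cube_shift; exact: dx H. Qed.

Let positive_shift x i t : 0 < t -> disjoint x ->
  (forall c y u, ccube (x c) r y -> 0 <= u <= t -> interior C (y + u *: delta_mx 0 i)) ->
  \sum_c `|V (x c) - V (x c + t *: delta_mx 0 i)| <= t * P.
Proof.
move=> t0 dx xC.
have := @coordinate_translation R m m_gt0 C E P mE EP I x r t
  (fun c => Num.sg (V (x c) - V (x c + t *: delta_mx 0 i))) i r_gt0 t0 _ dx xC.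
under eq_bigr do rewrite -normrEsg.
by apply => c; rewrite normr_sg; case: eqP => _; rewrite ?lexx ?ler01.
Qed.

Let coordinate_shift x i t : disjoint x ->
  (forall c y u, ccube (x c) r y -> `|u| <= `|t| -> interior C (y + u *: delta_mx 0 i)) ->
  \sum_c `|V (x c) - V (x c + t *: delta_mx 0 i)| <= `|t| * P.
Proof.
move=> dx xC; have [t0|t0|t0] := ltgtP t 0.
- have := @positive_shift (fun c => x c + t *: delta_mx 0 i) i (- t).
  rewrite oppr_gt0 (ltr0_norm t0) => /(_ t0 (disjoint_shift dx)) H.
  rewrite (eq_bigr (fun c => `|V (x c + t *: delta_mx 0 i) -
    V (x c + t *: delta_mx 0 i + - t *: delta_mx 0 i)|)) => [|c _]; last first.
    by rewrite scaleNr addrK distrC.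
  apply: H => c y u /ccube_shift Hy /andP[u0 ut].
  have -> : y + u *: delta_mx 0 i = (y - t *: delta_mx 0 i) + (t + u) *: delta_mx 0 i.
    by rewrite scalerDl addrA subrK.
  by apply: xC Hy _; rewrite (ltr0_norm t0) ler_norml; apply/andP; split; lra.
- rewrite (gtr0_norm t0); apply: positive_shift => // c y u Hy /andP[u0 ut].
  by apply: xC Hy _; rewrite ger0_norm// gtr0_norm.
- rewrite t0 normr0 mul0r big1// => c _.
  by rewrite scale0r addr0 subrr normr0.
Qed.

(** The coordinates of [w] are added one at a time; all intermediate positions stay within [d] of
    the start in the sup norm. *)
Let small_translation x w (d : R) : disjoint x -> (forall l, `|w 0 l| <= d) ->
  (forall c y z, ccube (x c) r y -> (forall l, `|z 0 l| <= d) -> interior C (y + z)) ->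
  \sum_c `|V (x c) - V (x c + w)| <= (\sum_l `|w 0 l|) * P.
Proof.
move=> dx wd xC.
suff H (s : seq 'I_m) : uniq s ->
    \sum_c `|V (x c) - V (x c + \sum_(l <- s) w 0 l *: delta_mx 0 l)| <=
    (\sum_(l <- s) `|w 0 l|) * P.
  by rewrite {1}(row_sum_delta w); apply: H; exact: index_enum_uniq.
elim: s => [_|l s IH /=/andP[ls us]].
  by rewrite !big_nil mul0r big1// => c _; rewrite addr0 subrr normr0.
rewrite !big_cons mulrDl; set ws := \sum_(l <- s) w 0 l *: delta_mx 0 l.
have wsE k : ws 0 k = if k \in s then w 0 k else 0.
  rewrite /ws summxE; under eq_bigr do rewrite !mxE eqxx /=.
  case: ifPn => ks; last first.
    rewrite big_seq big1// => j js; case: eqVneq => [kj|]; last by rewrite mulr0.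
    by rewrite kj js in ks.
  rewrite (bigD1_seq k)//= eqxx mulr1 big1 ?addr0// => j /negbTE jk.
  by rewrite eq_sym jk mulr0.
apply: (@le_trans _ _ (\sum_c (`|V (x c + ws) - V (x c + ws + w 0 l *: delta_mx 0 l)| +
    `|V (x c) - V (x c + ws)|))).
  apply: ler_sum => c _; rewrite [leRHS]addrC.
  have -> : x c + (w 0 l *: delta_mx 0 l + ws) = x c + ws + w 0 l *: delta_mx 0 l.
    by rewrite (addrC (w 0 l *: _)) addrA.
  exact: (ler_distD (V (x c + ws))).
rewrite big_split /= lerD ?IH//.
apply: (@coordinate_shift (fun c => x c + ws)); first exact: disjoint_shift.
move=> c y u /ccube_shift Hy ut.
rewrite -(subrK ws y) -addrA; apply: xC Hy _ => k.
rewrite mxE wsE !mxE eqxx /=; have [->|kl] := eqVneq k l.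
  by rewrite (negbTE ls) add0r mulr1 (le_trans ut).
rewrite mulr0 addr0; case: ifP => // _.
by rewrite normr0 (le_trans (normr_ge0 (w 0 l))).
Qed.

(** The segment is cut into [N] pieces of sup length at most [d], and each is replaced by a
    staircase, so that the cubes stay in the neighbourhood of width [d]. The l1 lengths of the
    pieces add up exactly, hence the subdivision costs nothing. *)
Lemma translation_estimate x w (d : R) : 0 < d ->
  (forall c c' y, cube (x c) r y -> cube (x c') r y -> c = c') ->
  (forall c y t z, ccube (x c) r y -> 0 <= t <= 1 -> (forall l, `|z 0 l| <= d) ->
     interior C (y + t *: w + z)) ->
  \sum_c `|fine (mu (E `&` cube (x c) r)) - fine (mu (E `&` cube (x c + w) r))| <=
  (\sum_l `|w 0 l|) * P.
Proof.
move=> d0 dx xC; pose M := \sum_l `|w 0 l|.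
have wM l : `|w 0 l| <= M by rewrite /M (bigD1 l)//= lerDl sumr_ge0.
have M0 : 0 <= M by rewrite sumr_ge0.
pose N := (Num.bound (M / d)).+1.
have N0 : 0 < N%:R :> R by rewrite ltr0n.
have Nd : M / N%:R <= d.
  rewrite ler_pdivrMr// mulrC -ler_pdivrMr// (le_trans (ltW (archi_boundP _)))//.
    by rewrite divr_ge0// ltW.
  by rewrite ler_nat leqnSn.
suff H k : (k <= N)%N ->
    \sum_c `|V (x c) - V (x c + (k%:R / N%:R) *: w)| <= (k%:R / N%:R) * (M * P).
  by have := H N (leqnn _); rewrite mulfV ?gt_eqF// mul1r scale1r.
elim: k => [_|k IH kN].
  by rewrite !mul0r big1// => c _; rewrite scale0r addr0 subrr normr0.
pose wk := (k%:R / N%:R) *: w; pose w1 := N%:R^-1 *: w.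
have -> : k.+1%:R / N%:R = k%:R / N%:R + N%:R^-1 :> R by rewrite -natr1 mulrDl mul1r.
rewrite mulrDl scalerDl.
apply: (@le_trans _ _ (\sum_c (`|V (x c) - V (x c + wk)| + `|V (x c + wk) - V (x c + wk + w1)|))).
  apply: ler_sum => c _; have -> : x c + (wk + w1) = x c + wk + w1 by rewrite addrA.
  exact: (ler_distD (V (x c + wk))).
rewrite big_split /=; apply: lerD; first by apply: IH; exact: ltnW.
have w1E l : `|w1 0 l| = N%:R^-1 * `|w 0 l|.
  by rewrite mxE normrM gtr0_norm ?invr_gt0.
have -> : N%:R^-1 * (M * P) = (\sum_l `|w1 0 l|) * P.
  by rewrite mulrA; congr (_ * _); rewrite mulr_sumr; apply: eq_bigr => l _; rewrite w1E.
apply: (@small_translation (fun c => x c + wk) w1 d); first exact: disjoint_shift.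
  move=> l; rewrite w1E; apply: le_trans Nd; rewrite mulrC ler_wpM2r ?invr_ge0 ?(ltW N0)//.
move=> c y z /ccube_shift Hy zd; rewrite -(subrK wk y).
apply: xC Hy _ zd; rewrite divr_ge0 ?ler0n//= ler_pdivrMr// mul1r ler_nat.
exact: ltnW.
Qed.

End Translation.

(** * Cylindrically bounded bodies *)

Section Join.
Context {R : realType} {n : nat}.
Implicit Types (y : 'rV[R]_n) (x : 'rV[R]_n.+1) (t r : R).

Definition join y t : 'rV[R]_n.+1 :=
  \row_j (if unlift ord_max j is Some i then y 0 i else t).

Definition last_coord x : R := x 0 ord_max.

Lemma join_last y t : last_coord (join y t) = t.
Proof. by rewrite /last_coord mxE unlift_none. Qed.

Lemma join_lift y t i : join y t 0 (lift ord_max i) = y 0 i.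
Proof. by rewrite mxE liftK. Qed.

Lemma proj_coord x i : horizontal_projection x 0 i = x 0 (lift ord_max i).
Proof. by rewrite mxE. Qed.

Lemma proj_join y t : horizontal_projection (join y t) = y.
Proof. by apply/rowP => i; rewrite proj_coord join_lift. Qed.

Lemma forall_lift (Q : 'I_n.+1 -> Prop) :
  (forall j, Q j) <-> Q ord_max /\ forall i, Q (lift ord_max i).
Proof.
split=> [H|[H1 H2] j]; first by split.
by case: (unliftP ord_max j) => [i ->|->].
Qed.

Lemma join_eta x : join (horizontal_projection x) (last_coord x) = x.
Proof.
apply/rowP; apply/forall_lift; split; first exact: join_last.
by move=> i; rewrite join_lift proj_coord.
Qed.

Lemma projD x x' : horizontal_projection (x + x') =
  horizontal_projection x + horizontal_projection x'.
Proof. by apply/rowP => i; rewrite !mxE. Qed.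

Lemma projZ (a : R) x : horizontal_projection (a *: x) = a *: horizontal_projection x.
Proof. by apply/rowP => i; rewrite !mxE. Qed.

Lemma cube_join x y t r :
  cube (join y t) r x <-> cube y r (horizontal_projection x) /\ `|last_coord x - t| < r.
Proof.
rewrite /cube /= forall_lift; split => -[H1 H2]; split.
- by move=> i; rewrite proj_coord; have := H2 i; rewrite join_lift.
- by have := H1; rewrite -[join _ _ _ _]/(last_coord _) join_last.
- by rewrite -[join _ _ _ _]/(last_coord _) join_last.
- by move=> i; rewrite join_lift -proj_coord; exact: H1.
Qed.

Lemma ccube_join x y t r :
  ccube (join y t) r x <-> ccube y r (horizontal_projection x) /\ `|last_coord x - t| <= r.
Proof.
rewrite /ccube /= forall_lift; split => -[H1 H2]; split.
- by move=> i; rewrite proj_coord; have := H2 i; rewrite join_lift.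
- by have := H1; rewrite -[join _ _ _ _]/(last_coord _) join_last.
- by rewrite -[join _ _ _ _]/(last_coord _) join_last.
- by move=> i; rewrite join_lift -proj_coord; exact: H1.
Qed.

Lemma join_up (y : 'rV[R]_n) (t u : R) : join y t + u *: delta_mx 0 ord_max = join y (t + u).
Proof.
apply/rowP; apply/forall_lift; split => [|i]; rewrite !mxE.
  by rewrite unlift_none !eqxx mulr1.
by rewrite liftK eqxx /= eq_sym (negbTE (neq_lift _ _)) mulr0 addr0.
Qed.

End Join.

(** * Homotheties of convex sets and vertical rays *)

Section Convex.
Context {R : realType} {m : nat}.
Implicit Types (A : set 'rV[R]_m) (p x y : 'rV[R]_m).

Definition convex A := forall x y t, A x -> A y -> 0 <= t <= 1 -> A (t *: x + (1 - t) *: y).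

Lemma convex_set_convex A : convex_set (A : set (convex_lmodType 'rV[R]_m)) -> convex A.
Proof.
move=> cA x y t Ax Ay /andP[t0 t1].
have := cA x y (Itv01 t0 t1) (mem_set Ax) (mem_set Ay); rewrite inE; exact.
Qed.

Lemma closure_convex A : convex A -> convex (closure A).
Proof.
move=> cA x y t Ax Ay t01 B /nbhs_cubeP[r r0 rB].
have [x' [Ax' xx']] := Ax _ (nbhs_cube x r0).
have [y' [Ay' yy']] := Ay _ (nbhs_cube y r0).
exists (t *: x' + (1 - t) *: y'); split; first exact: cA.
apply: rB => i; rewrite !mxE; have := xx' i; have := yy' i.
set a := x' 0 i; set b := x 0 i; set c := y' 0 i; set d := y 0 i => h1 h2.
have -> : t * a + (1 - t) * c - (t * b + (1 - t) * d) = t * (a - b) + (1 - t) * (c - d) by ring.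
have /andP[t0 t1] := t01; have t1' : 0 <= 1 - t by rewrite subr_ge0.
apply: (le_lt_trans (ler_normD _ _)); rewrite !normrM (ger0_norm t0) (ger0_norm t1').
have [E|tne] := eqVneq t 0; first by rewrite E mul0r add0r subr0 mul1r.
have tpos : 0 < t by rewrite lt_neqAle eq_sym tne.
have H1 : t * `|a - b| < t * r by rewrite ltr_pM2l.
have H2 : (1 - t) * `|c - d| <= (1 - t) * r by rewrite ler_wpM2l// ltW.
lra.
Qed.

(** The cube on the left is the image of [cube p r] under the homothety of centre [x] and ratio
    [1 - t]. This is the source of all margins of the form [(1 - t) * r] below. *)
Lemma convex_dilate_cube A p r x (t : R) : convex A -> cube p r `<=` A -> A x -> 0 <= t < 1 ->
  cube (p + t *: (x - p)) ((1 - t) * r) `<=` A.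
Proof.
move=> cA pA Ax /andP[t0 t1] y Hy; have t1' : 0 < 1 - t by rewrite subr_gt0.
have -> : y = t *: x + (1 - t) *: (p + (1 - t)^-1 *: (y - (p + t *: (x - p)))).
  apply/rowP => i; rewrite !mxE; field; by rewrite gt_eqF.
apply: cA => //; last by rewrite t0 ltW.
apply: pA => i; have := Hy i; rewrite !mxE.
set a := y 0 i; set b := p 0 i; set c := x 0 i => H.
have -> : b + (1 - t)^-1 * (a - (b + t * (c - b))) - b = (1 - t)^-1 * (a - (b + t * (c - b))) by
  ring.
by rewrite normrM gtr0_norm ?invr_gt0// ltr_pdivrMl.
Qed.

(** Half of the margin pays for replacing [x] by a nearby point of [A]. *)
Lemma convex_dilate_closure A p r x (t : R) : convex A -> 0 < r -> cube p r `<=` A ->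
  closure A x -> 0 <= t < 1 -> cube (p + t *: (x - p)) ((1 - t) * r / 2) `<=` A.
Proof.
move=> cA r0 pA Ax t01 y Hy; have /andP[t0 t1] := t01.
have d0 : 0 < (1 - t) * r / 2 by rewrite divr_gt0// mulr_gt0// subr_gt0.
have [x' [Ax' xx']] := Ax _ (nbhs_cube x d0).
apply: (convex_dilate_cube cA pA Ax' t01) => i.
have := Hy i; have := xx' i; rewrite !mxE.
set a := x' 0 i; set b := x 0 i; set c := y 0 i; set d := p 0 i => h1 h2.
have -> : c - (d + t * (a - d)) = (c - (d + t * (b - d))) + t * (b - a) by ring.
apply: (le_lt_trans (ler_normD _ _)); rewrite (normrM t) (ger0_norm t0) (distrC b a).
have : t * `|a - b| <= `|a - b| by rewrite ler_piMl// ltW.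
lra.
Qed.

Lemma interior_cube A x : interior A x -> exists2 r, 0 < r & cube x r `<=` interior A.
Proof.
move=> /nbhs_cubeP[r r0 rA]; exists r => // y Hy.
have [e e0 eA] := (open_cubeP _).1 (@open_cube _ _ x r) y Hy.
by apply/nbhs_cubeP; exists e => //; exact: subset_trans eA rA.
Qed.

Lemma interior_convex A : convex A -> convex (interior A).
Proof.
move=> cA x y t Ix Iy t01; have [r r0 rA] := (nbhs_cubeP x A).1 Ix.
have [r' r'0 rA'] := (nbhs_cubeP y A).1 Iy.
apply/nbhs_cubeP; exists (Num.min r r'); first by rewrite lt_min r0.
move=> z Hz; pose e := z - (t *: x + (1 - t) *: y).
have -> : z = t *: (x + e) + (1 - t) *: (y + e).
  by apply/rowP => i; rewrite /e !mxE; ring.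
apply: cA => //; [apply: rA => i|apply: rA' => i]; have := Hz i;
  rewrite lt_min /e !mxE => /andP[h1 h2].
  by rewrite [X in `|X|](_ : _ = z 0 i - (t * x 0 i + (1 - t) * y 0 i)); [|ring].
by rewrite [X in `|X|](_ : _ = z 0 i - (t * x 0 i + (1 - t) * y 0 i)); [|ring].
Qed.

End Convex.

Section UpwardRay.
Context {R : realType} {n : nat}.
Implicit Types (C : set 'rV[R]_n.+1) (x : 'rV[R]_n.+1) (s t : R).

(** On the segment from [x] to a point [z] of [C] very far in direction [s], the point at height [t]
    above [x] is displaced sideways by at most [2 * B * t] over the height of [z]. These points
    converge to the claimed one, and [C] is closed. *)
Lemma upward_ray C s (B : R) : closed C -> convex C ->
  (forall x i, C x -> `|horizontal_projection x 0 i| <= B) ->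
  (forall k : R, exists2 x, C x & k < s * last_coord x) -> (s = 1 \/ s = -1) ->
  forall x t, C x -> 0 <= t -> C (x + (s * t) *: delta_mx 0 ord_max).
Proof.
move=> clC cC CB Cs s1 x t Cx; rewrite le_eqVlt => /orP[/eqP <-|t0].
  by rewrite mulr0 scale0r addr0.
have ss : s * s = 1 by case: s1 => ->; rewrite ?mulrNN mulr1.
apply: clC => A /nbhs_cubeP[r r0 rA].
have B0 : 0 <= `|B| by [].
(* The summand [t] puts the wanted height within the segment, the last one makes the sideways
   displacement smaller than [r]. *)
pose k := s * last_coord x + t + t * (2 * `|B|) / r.
have [z Cz kz] := Cs k.
have tB : 0 <= t * (2 * `|B|) / r by rewrite divr_ge0 ?(ltW r0)// mulr_ge0 ?(ltW t0)// mulr_ge0.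
have d0 : 0 < s * last_coord z - s * last_coord x by move: kz; rewrite /k; lra.
pose l := t / (s * last_coord z - s * last_coord x).
have l0 : 0 <= l by rewrite divr_ge0 ?ltW.
have l1 : l <= 1 by rewrite ler_pdivrMr// mul1r; move: kz; rewrite /k; lra.
exists (l *: z + (1 - l) *: x); split; first by apply: cC => //; rewrite l0.
apply: rA; apply/forall_lift; split => [|i]; rewrite !mxE.
  have E : l * (s * last_coord z - s * last_coord x) = t by rewrite /l divfK// gt_eqF.
  rewrite -/(last_coord z) -/(last_coord x) !eqxx /= mulr1.
  have -> : l * last_coord z + (1 - l) * last_coord x - (last_coord x + s * t) =
      l * (last_coord z - last_coord x) - s * t by ring.
  have -> : l * (last_coord z - last_coord x) - s * t = 0; last by rewrite normr0.
  rewrite -E; have -> : s * (l * (s * last_coord z - s * last_coord x)) =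
    s * s * l * (last_coord z - last_coord x) by ring.
  by rewrite ss mul1r subrr.
rewrite eq_sym (negbTE (neq_lift _ _)) andbF mulr0 addr0 -!proj_coord.
set a := horizontal_projection z 0 i; set b := horizontal_projection x 0 i.
have -> : l * a + (1 - l) * b - b = l * (a - b) by ring.
rewrite normrM (ger0_norm l0) /l mulrAC ltr_pdivrMr//.
have ab : `|a - b| <= 2 * `|B|.
  have := CB z i Cz; have := CB x i Cx; rewrite -/a -/b.
  have := ler_normD a (- b); rewrite normrN; have := ler_norm B; lra.
apply: (@le_lt_trans _ _ (t * (2 * `|B|))); first by rewrite ler_pM2l.
rewrite -ltr_pdivrMl// mulrC; move: kz; rewrite /k; lra.
Qed.

(** A body with bounded heights on both sides would be bounded; unbounded on both sides, it would
    contain the vertical line through an interior point. So exactly one direction [s] is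
    unbounded. *)
Lemma cylindrically_bounded_vertical C : cylindrically_bounded_convex_body C ->
  exists s, [/\ s = 1 \/ s = -1,
    forall x t, C x -> 0 <= t -> C (x + (s * t) *: delta_mx 0 ord_max) &
    exists M, forall x, C x -> M <= s * last_coord x].
Proof.
move=> [[clC uC /convex_set_convex cC [p /interior_subset Cp]] [bC nl]].
have [B B0 HB] := (bounded_ccubeP _).1 bC.
have CB x i : C x -> `|horizontal_projection x 0 i| <= B.
  move=> Cx; have Hx : (horizontal_projection @` C) (horizontal_projection x) by exists x.
  by have := HB _ Hx i; rewrite [X in `|_ - X|]mxE subr0.
have nb s : ~ (exists M, forall x, C x -> s * last_coord x <= M) ->
    forall k : R, exists2 x, C x & k < s * last_coord x.
  move=> H k; apply: contrapT => H'; apply: H; exists k => x Cx.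
  by rewrite leNgt; apply/negP => kx; apply: H'; exists x.
have ray s : s = 1 \/ s = -1 -> ~ (exists M, forall x, C x -> s * last_coord x <= M) ->
    forall x t, C x -> 0 <= t -> C (x + (s * t) *: delta_mx 0 ord_max).
  by move=> s1 H; exact: (upward_ray clC cC CB (nb s H) s1).
have [up|nup] := pselect (exists M, forall x, C x -> 1 * last_coord x <= M);
  have [dn|ndn] := pselect (exists M, forall x, C x -> -1 * last_coord x <= M).
- exfalso; apply: uC; apply/bounded_ccubeP.
  have [M1 H1] := up; have [M2 H2] := dn.
  exists (B + `|M1| + `|M2|); first by rewrite ltr_wpDr// ltr_wpDr.
  move=> x Cx; apply/forall_lift; split => [|i]; rewrite mxE subr0.
    have := H1 x Cx; have := H2 x Cx; rewrite -/(last_coord x) mul1r mulN1r.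
    have := normr_ge0 M1; have := normr_ge0 M2; have := ler_norm M1; have := ler_norm M2.
    by rewrite ler_norml => *; apply/andP; split; move: B0; lra.
  have := CB x i Cx; rewrite proj_coord; have := normr_ge0 M1; have := normr_ge0 M2; lra.
- exists (-1); split; [by right|by apply: ray => //; right|].
  have [M H] := up; exists (- M) => x Cx; have := H x Cx; rewrite mul1r mulN1r; lra.
- exists 1; split; [by left|by apply: ray => //; left|].
  have [M H] := dn; exists (- M) => x Cx; have := H x Cx; rewrite mul1r mulN1r; lra.
- exfalso; apply: nl; exists p, (delta_mx 0 ord_max); split.
    by apply/eqP => /matrixP/(_ 0 ord_max)/eqP; rewrite !mxE !eqxx oner_eq0.
  move=> t; have [t0|t0] := leP 0 t.
    by have := ray 1 (or_introl erefl) nup p t Cp t0; rewrite mul1r.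
  have := ray (-1) (or_intror erefl) ndn p (- t) Cp; rewrite mulrNN mul1r.
  by apply; rewrite oppr_ge0 ltW.
Qed.

Lemma asymptotic_cylinder_base C (K : set 'rV[R]_n) :
  asymptotic_cylinder C = cylinder K -> K = closure (horizontal_projection @` C).
Proof.
rewrite /asymptotic_cylinder /cylinder => E; rewrite predeqE => y.
have : ((@horizontal_projection R n) @^-1` (closure (horizontal_projection @` C))) (join y 0) =
  ((@horizontal_projection R n) @^-1` K) (join y 0) by rewrite E.
by rewrite /= /preimage /= proj_join => ->.
Qed.

End UpwardRay.

Section Heights.
Context {R : realType} {n : nat}.
Variables (C : set 'rV[R]_n.+1) (s : R) (B : R).
Hypothesis cC : convex C.
Hypothesis s1 : s = 1 \/ s = -1.
Hypothesis C_up : forall x t, C x -> 0 <= t -> C (x + (s * t) *: delta_mx 0 ord_max).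
Hypothesis C_bounded : forall x i, C x -> `|horizontal_projection x 0 i| <= B.

Let ss : s * s = 1. Proof. by case: s1 => ->; rewrite ?mulrNN mulr1. Qed.

Lemma interior_up x t : interior C x -> 0 <= t ->
  interior C (x + (s * t) *: delta_mx 0 ord_max).
Proof.
move=> /nbhs_cubeP[r r0 rC] t0; apply/nbhs_cubeP; exists r => // y yx.
rewrite -(subrK ((s * t) *: delta_mx 0 ord_max) y); apply: C_up => //; apply: rC => i.
by have := yx i; rewrite !mxE opprD addrA addrAC.
Qed.

Variables (p : 'rV[R]_n.+1) (r : R).
Hypotheses (r0 : 0 < r) (pC : cube p r `<=` C).
Let K := closure (horizontal_projection @` C).

Lemma proj_cube : cube (horizontal_projection p) r `<=` horizontal_projection @` C.
Proof.
move=> y Hy; exists (join y (last_coord p)); last exact: proj_join.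
apply: pC; rewrite -(join_eta p); apply/cube_join; split.
  by rewrite proj_join; exact: Hy.
by rewrite !join_last subrr normr0.
Qed.

Lemma proj_convex : convex (horizontal_projection @` C).
Proof.
move=> _ _ t [x Cx <-] [y Cy <-] t01; exists (t *: x + (1 - t) *: y); first exact: cC.
by rewrite projD !projZ.
Qed.

Lemma base_convex : convex K.
Proof. by apply: closure_convex; exact: proj_convex. Qed.

Lemma base_bounded y i : K y -> `|y 0 i| <= B.
Proof.
move=> Ky; apply/ler_addgt0Pr => e e0; have [z [[x Cx <-] yz]] := Ky _ (nbhs_cube y e0).
have := C_bounded i Cx; have := yz i; rewrite distrC.
have := ler_normD (y 0 i - horizontal_projection x 0 i) (horizontal_projection x 0 i).
by rewrite subrK; lra.
Qed.

(** A point of [K] is only a limit of projections, and the fibre over a projection may miss the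
    interior. So [y] is first pushed away from [q] within [K], then contracted twice: towards [q]
    into the projection itself, and, upstairs towards [p], into the interior of [C] over [y]. *)
Lemma deep_point_above y d : 0 < d -> ccube y d `<=` K ->
  exists t, interior C (join y t).
Proof.
move=> d0 yK; pose q := horizontal_projection p.
pose M := \sum_i `|y 0 i - q 0 i|.
have M0 : 0 <= M by rewrite sumr_ge0.
(* [M] bounds the distance from [y] to [q] in each coordinate, so pushing [y] away by the factor [e]
   moves it by at most [d]. *)
pose e := d / (M + 1).
have e0 : 0 < e by rewrite divr_gt0// ltr_wpDl.
have Kk : K (y + e *: (y - q)).
  apply: yK => i; rewrite !mxE addrAC subrr add0r normrM gtr0_norm//.
  rewrite /e mulrAC ler_pdivrMr ?ltr_wpDl// ler_pM2l//.
  by rewrite -proj_coord -/q /M (bigD1 i)//= -addrA lerDl addr_ge0// sumr_ge0.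
have e1 : 0 < 1 + e by rewrite addr_gt0.
pose t := (1 + e)^-1.
have t01 : 0 <= t < 1 by rewrite invr_ge0 (ltW e1) invf_lt1// ltrDl.
have yE : y = q + t *: ((y + e *: (y - q)) - q).
  apply/rowP => i; rewrite !mxE /t; field; by rewrite gt_eqF.
have /andP[t0 t1] := t01.
pose k := y + e *: (y - q).
(* a second dilation turns a point of the projection into an interior point of C *)
pose u := (1 + e / 2)^-1.
have e2 : 0 < 1 + e / 2 by rewrite addr_gt0// divr_gt0.
have u01 : 0 <= u < 1 by rewrite invr_ge0 (ltW e2) invf_lt1// ltrDl divr_gt0.
pose z := y + (e / 2) *: (y - q).
have Kz : (horizontal_projection @` C) z.
  pose v := (1 + e / 2) / (1 + e).
  have v01 : 0 <= v < 1 by rewrite divr_ge0 ?(ltW e2) ?(ltW e1)//= ltr_pdivrMr// mul1r; lra.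
  apply: (convex_dilate_closure proj_convex r0 proj_cube Kk v01) => i.
  rewrite !mxE [X in `|X|](_ : _ = 0).
    by rewrite normr0 divr_gt0// mulr_gt0// subr_gt0; case/andP: v01.
  by rewrite /v -/q; field; rewrite gt_eqF.
have [x Cx xz] := Kz.
exists (last_coord (p + u *: (x - p))).
have -> : y = horizontal_projection (p + u *: (x - p)).
  rewrite projD projZ projD -scaleN1r projZ scaleN1r xz -/q.
  apply/rowP => i; rewrite !mxE /u; field.
  by rewrite gt_eqF//; move: e0; lra.
rewrite join_eta; apply/nbhs_cubeP; exists ((1 - u) * r).
  by rewrite mulr_gt0// subr_gt0; case/andP: u01.
exact: convex_dilate_cube.
Qed.

(** The points [y] at depth [d] form a compact set, covered by the open sets of those with
    [join y (s * k)] interior to [C]. These sets increase with [k], so the largest index of a finite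
    subcover serves all [y]. *)
Lemma uniform_height d : 0 < d -> exists T, forall y t, ccube y d `<=` K -> T <= t ->
  interior C (join y (s * t)).
Proof.
move=> d0; pose Z : set 'rV[R]_n := [set y | ccube y d `<=` K].
have cZ : compact Z.
  apply: (@compact_ccubeP _ _ _ B) => [y Zy z yz|y Zy i].
    rewrite [K](closure_id K).1; last exact: closed_closure.
    move=> A /nbhs_cubeP[e e0 eA].
    have [y' [Zy' yy']] := Zy _ (nbhs_cube y e0).
    exists (z + (y' - y)); split.
      apply: Zy' => i; rewrite !mxE; have := yz i.
      by rewrite [X in _ -> `|X| <= _](_ : _ = z 0 i - y 0 i)//; ring.
    by apply: eA => i; rewrite !mxE addrAC subrr add0r; exact: yy'.
  rewrite mxE subr0; apply: base_bounded; apply: Zy => l.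
  by rewrite subrr normr0 ltW.
have : cover_compact Z by rewrite -compact_cover.
move=> /(_ nat setT (fun k => [set y | interior C (join y (s * k%:R))])) [].
- move=> k _; apply/open_cubeP => y /= Hy.
  have [e e0 eC] := interior_cube Hy.
  exists e; first exact: e0.
  move=> z yz; apply: eC; apply/cube_join; split; first by rewrite proj_join.
  by rewrite join_last subrr normr0.
- move=> y Zy; have [t Ht] := deep_point_above d0 Zy.
  have [k kt] : exists k : nat, s * t <= k%:R.
    have [st|st] := leP 0 (s * t); last by exists 0%N; exact: ltW.
    by exists (Num.bound (s * t)); rewrite ltW// archi_boundP.
  exists k; first exact: I.
  change (interior C (join y (s * k%:R))).
  have := @interior_up _ (k%:R - s * t) Ht.
  rewrite subr_ge0 => /(_ kt); rewrite join_up.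
  by rewrite mulrBr mulrA ss mul1r addrC subrK.
move=> D _ ZD; exists (\max_(k <- finmap.enum_fset D) k)%:R => y t Zy Tt.
have [k /= kD Hk] := ZD y Zy.
have kT : k%:R <= t.
  apply: le_trans Tt; rewrite ler_nat.
  exact: (@leq_bigmax_seq _ (finmap.enum_fset D) xpredT id).
have := @interior_up _ (t - k%:R) Hk; rewrite subr_ge0 => /(_ kT); rewrite join_up.
by rewrite -mulrDr addrC subrK.
Qed.

End Heights.

(** * Volume of slabs by counting grid cells *)

Section Slab.
Context {R : realType} {n : nat}.
Hypothesis n_gt0 : (0 < n)%N.

(** An outer count: all cells that meet [A]. It bounds the volume of [A] from above by covering and,
    for the convex [K], from below after a contraction. *)
Definition grid_trace (A : set 'rV[R]_n) N (o : 'rV[R]_n) (e : R) : {set {ffun 'I_n -> 'I_N}} :=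
  [set c | `[< exists2 y, A y & ccube (grid_center o e c) (e / 2) y >]].

Variables (K : set 'rV[R]_n) (s B : R).
Hypothesis cK : convex K.
Hypothesis K_bounded : forall y i, K y -> `|y 0 i| <= B.
Variables (q : 'rV[R]_n) (r : R).
Hypotheses (r0 : 0 < r) (qK : cube q r `<=` K).
Hypothesis s1 : s = 1 \/ s = -1.

Let ss : s * s = 1. Proof. by case: s1 => ->; rewrite ?mulrNN mulr1. Qed.

Lemma base_volume_fin_num : volume R n K \is a fin_num.
Proof.
rewrite ge0_fin_numE ?outer_measure_ge0//; apply: (@volume_bounded_lty _ _ n_gt0 _ 0 B).
by move=> y Ky i; rewrite mxE subr0 K_bounded.
Qed.

Lemma grid_trace_le N (o : 'rV[R]_n) (e lam : R) : 0 < e -> 0 < lam < 1 ->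
  e <= (1 - lam) * r ->
  lam ^+ n * (#|grid_trace K N o e|%:R * e ^+ n) <= fine (volume R n K).
Proof.
move=> e0 /andP[l0 l1] el; have e20 : 0 < e / 2 by rewrite divr_gt0.
pose Q c := if c \in grid_trace K N o e then cube (grid_center o e c) (e / 2) else set0.
have mQ c : measurable (Q c : set (caratheodory_type (volume R n))).
  by rewrite /Q; case: ifP => // _; exact: cube_measurable.
have QE : volume R n (\bigcup_c Q c) = (#|grid_trace K N o e|%:R * e ^+ n)%:E.
  rewrite -[\bigcup_c Q c]setTI -(sum_disjoint_volume mQ)//; last first.
    move=> c c' y; rewrite /Q; case: ifP => // _; case: ifP => // _.
    exact: grid_disjoint.
  rewrite (eq_bigr (fun c => if c \in grid_trace K N o e then (e ^+ n)%:E else 0%E)) => [|c _].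
    by rewrite -big_mkcond /= sumEFin sumr_const mulr_natl.
  rewrite setTI /Q; case: ifP => _; last exact: outer_measure0.
  by rewrite volume_cube// mulrC divfK.
(* contracting K towards q pushes every cube meeting K inside K *)
have QK : [set ((1 - lam) *: q + lam *: y) | y in \bigcup_c Q c] `<=` K.
  move=> _ [y [c _ Qy] <-]; move: Qy; rewrite /Q; case: ifP => [|_ []//];
    rewrite inE => /asboolP[k Kk kc] yc.
  apply: (@convex_dilate_cube _ _ K q r k lam cK qK Kk); first by rewrite (ltW l0).
  move=> i; rewrite !mxE; have := kc i; have := yc i.
  set a := grid_center o e c 0 i; set b := y 0 i; set d := k 0 i; set u := q 0 i => h1 h2.
  have -> : (1 - lam) * u + lam * b - (u + lam * (d - u)) = lam * (b - d) by ring.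
  rewrite normrM (gtr0_norm l0) (lt_le_trans _ el)//.
  have bd : `|b - d| < e.
    have := ler_distD a b d; rewrite (distrC a d) => h3.
    by rewrite (le_lt_trans h3)// [ltRHS]splitr ltr_leD.
  by rewrite (le_lt_trans _ bd)// ler_piMl// ltW.
rewrite -lee_fin fineK ?base_volume_fin_num//.
by rewrite EFinM -QE -(volume_affine ((1 - lam) *: q))//; apply: le_outer_measure.
Qed.

Lemma le_outer_measure_finite (T : Type) (mu : {outer_measure set T -> \bar R})
  (I : finType) (P : pred I) (F : I -> set T) (A : set T) :
  (forall x, A x -> exists2 i, P i & F i x) -> (mu A <= \sum_(i | P i) mu (F i))%E.
Proof.
move=> AF; apply: (@le_trans _ _ (mu (\big[setU/set0]_(i | P i) F i))).
  apply: le_outer_measure => x /AF[i Pi Fx]; rewrite -bigcup_seq_cond.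
  by exists i => //=; rewrite Pi mem_index_enum.
elim: (index_enum I) => [|i l IH]; first by rewrite !big_nil outer_measure0.
rewrite !big_cons; case: ifP => // _.
by apply: le_trans (outer_measureU2 _ _ _) _; rewrite leeD2l.
Qed.

Lemma le_grid_trace (A : set 'rV[R]_n) N (o : 'rV[R]_n) (e : R) : (0 < N)%N -> 0 < e ->
  (forall y l, A y -> o 0 l <= y 0 l <= o 0 l + e * N%:R) ->
  (volume R n A <= (#|grid_trace A N o e|%:R * e ^+ n)%:E)%E.
Proof.
move=> N0 e0 Ao; have e20 : 0 < e / 2 by rewrite divr_gt0.
apply: (le_trans (@le_outer_measure_finite _ _ _ (fun c => c \in grid_trace A N o e)
    (fun c : {ffun 'I_n -> 'I_N} => ccube (grid_center o e c) (e / 2)) A _)).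
  move=> y Ay; have [c yc] := grid_cover e0 N0 (Ao y ^~ Ay).
  by exists c => //; rewrite inE; apply/asboolP; exists y.
rewrite (eq_bigr (fun=> (e ^+ n)%:E)) => [|c _]; last first.
  by rewrite volume_ccube// mulrC divfK.
by rewrite sumEFin sumr_const mulr_natl.
Qed.

(** Fubini by counting: the cells over those that meet [K], on [M] levels, cover the slab, and
    [grid_trace_le] compares their number with |K| up to [lam ^+ n]. Then [lam] tends to 1. *)
Lemma slab_volume (t w : R) : 0 < w ->
  (volume R n.+1 [set x | K (horizontal_projection x) /\ (t <= s * last_coord x <= t + w)%R]
   <= (w * fine (volume R n K))%:E)%E.
Proof.
move=> w0; set S := [set x | _].
pose b := `|B| + 1; have b0 : 0 < b by rewrite ltr_wpDl.
have SB : S `<=` ccube 0 (b + `|t| + w).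
  move=> x [Kx /andP[h1 h2]]; apply/forall_lift; split => [|i]; rewrite mxE subr0.
    rewrite -/(last_coord x).
    have -> : `|last_coord x| = `|s * last_coord x|.
      by rewrite normrM (_ : `|s| = 1) ?mul1r//; case: s1 => ->; rewrite ?normrN normr1.
    rewrite ler_norml; have := ler_norm t; have := ler_norm (- t); rewrite normrN.
    by move=> *; apply/andP; split; move: b0 w0 h1 h2; lra.
  rewrite -proj_coord (le_trans (K_bounded _ Kx))// (le_trans (ler_norm _))//.
  by have := normr_ge0 t; move: w0; rewrite /b; lra.
have fS : volume R n.+1 S \is a fin_num.
  by rewrite ge0_fin_numE ?outer_measure_ge0//; exact: volume_bounded_lty SB.
rewrite -(fineK fS) lee_fin; apply: (@ler_of_scaling _ n).
  by rewrite fine_ge0// outer_measure_ge0.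
move=> lam l0 l1.
have lr : 0 < (1 - lam) * r by rewrite mulr_gt0// subr_gt0.
pose M := (Num.bound (w / ((1 - lam) * r))).+1.
have M0 : 0 < M%:R :> R by rewrite ltr0n.
(* The mesh divides the height [w] exactly, so the levels add nothing to the slab. *)
pose e := w / M%:R; have e0 : 0 < e by rewrite divr_gt0.
have el : e <= (1 - lam) * r.
  rewrite /e ler_pdivrMr// mulrC -ler_pdivrMr// (le_trans (ltW (archi_boundP _)))//.
    by rewrite divr_ge0// ltW.
  by rewrite ler_nat leqnSn.
pose N := (Num.bound (2 * b / e)).+1.
have N0 : (0 < N)%N by [].
have eN : 2 * b <= e * N%:R.
  rewrite [leRHS]mulrC -ler_pdivrMr// (le_trans (ltW (archi_boundP _)))//.
    by rewrite divr_ge0// ?(ltW e0)// mulr_ge0// ltW.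
  by rewrite ler_nat leqnSn.
pose o : 'rV[R]_n := const_mx (- b).
have e20 : 0 < e / 2 by rewrite divr_gt0.
have Ko y l : K y -> o 0 l <= y 0 l <= o 0 l + e * N%:R.
  move=> Ky; rewrite mxE; have := K_bounded l Ky; rewrite ler_norml => /andP[h1 h2].
  have := ler_norm B; rewrite /b in eN *.
  by move=> h3; apply/andP; split; move: h1 h2 h3 eN; lra.
have H : (volume R n.+1 S <= (#|grid_trace K N o e|%:R * e ^+ n * w)%:E)%E.
  apply: (le_trans (@le_outer_measure_finite _ _ _ (fun cj => cj.1 \in grid_trace K N o e)
    (fun cj : {ffun 'I_n -> 'I_N} * 'I_M =>
      ccube (join (grid_center o e cj.1) (s * (t + e * (cj.2%:R + 2^-1)))) (e / 2)) S _)).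
    move=> x [Kx /andP[h1 h2]].
    have [c xc] := grid_cover e0 N0 (Ko (horizontal_projection x) ^~ Kx).
    have [||j /andP[j1 j2]] := @grid_interval R M ((s * last_coord x - t) / e); first by [].
      rewrite divr_ge0 ?subr_ge0 ?(ltW e0)//= ler_pdivrMr//.
      by rewrite /e [M%:R * _]mulrC divfK ?gt_eqF// lerBlDl.
    exists (c, j); first by rewrite inE; apply/asboolP; exists (horizontal_projection x).
    apply/ccube_join; split => //=.
    have -> : `|last_coord x - s * (t + e * (j%:R + 2^-1))| =
        `|s * last_coord x - (t + e * (j%:R + 2^-1))|.
      rewrite -[in LHS](mul1r (last_coord x)) -{1}ss -mulrA -mulrBr normrM.
      by rewrite (_ : `|s| = 1) ?mul1r//; case: s1 => ->; rewrite ?normrN normr1.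
    move: j1 j2; rewrite ler_pdivlMr// ler_pdivrMr// ler_norml => j1 j2.
    by apply/andP; split; move: j1 j2; lra.
  rewrite (eq_bigr (fun=> (e ^+ n.+1)%:E)) => [|c _]; last first.
    by rewrite volume_ccube// [2 * _]mulrC divfK.
  rewrite sumEFin lee_fin.
  rewrite (eq_bigl (fun cj => (cj.1 \in grid_trace K N o e) && xpredT cj.2)); last first.
    by move=> cj; rewrite andbT.
  rewrite -(pair_big (fun c => c \in grid_trace K N o e) xpredT (fun _ _ => e ^+ n.+1))/=.
  under eq_bigr do rewrite sumr_const card_ord.
  have -> : e ^+ n.+1 *+ M = e ^+ n * w.
    by rewrite -mulr_natr exprSr -mulrA; congr (_ * _); rewrite /e divfK ?gt_eqF.
  by rewrite sumr_const -[leLHS]mulr_natl mulrA.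
have G := grid_trace_le N o e0 (lam := lam) ltac:(by rewrite l0) el.
rewrite -(fineK fS) lee_fin in H.
apply: (@le_trans _ _ (lam ^+ n * (#|grid_trace K N o e|%:R * e ^+ n * w))).
  by rewrite ler_pM2l// exprn_gt0.
by rewrite mulrA mulrC ler_pM2l.
Qed.

End Slab.

(** * Sublevel sets of prescribed volume *)

Section Sublevel.
Context {R : realType} {n : nat}.
Hypothesis n_gt0 : (0 < n)%N.
Local Notation mu := (volume R n.+1).
Variables (C : set 'rV[R]_n.+1) (s B M : R).
Hypothesis clC : closed C.
Hypothesis cC : convex C.
Hypothesis s1 : s = 1 \/ s = -1.
Hypothesis C_up : forall x t, C x -> 0 <= t -> C (x + (s * t) *: delta_mx 0 ord_max).
Hypothesis C_bounded : forall x i, C x -> `|horizontal_projection x 0 i| <= B.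
Hypothesis C_low : forall x, C x -> M <= s * last_coord x.
Variables (p : 'rV[R]_n.+1) (r : R).
Hypotheses (r0 : 0 < r) (pC : cube p r `<=` C).
Let K := closure (horizontal_projection @` C).

Let ss : s * s = 1. Proof. by case: s1 => ->; rewrite ?mulrNN mulr1. Qed.
Let norm_s : `|s| = 1. Proof. by case: s1 => ->; rewrite ?normrN normr1. Qed.

Definition sublevel t : set 'rV[R]_n.+1 := C `&` [set x | s * last_coord x <= t].

Lemma closed_halfspace t : closed [set x : 'rV[R]_n.+1 | s * last_coord x <= t].
Proof.
move=> x Hx /=; apply/ler_addgt0Pr => e e0.
have [z [/= zt /(_ ord_max) xz]] := Hx _ (nbhs_cube x e0).
have : `|s * last_coord z - s * last_coord x| < e by rewrite -mulrBr normrM norm_s mul1r.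
by rewrite ltr_norml => /andP[]; lra.
Qed.

Lemma closed_sublevel t : closed (sublevel t).
Proof. by apply: closedI => //; exact: closed_halfspace. Qed.

Lemma sublevel_bounded t : sublevel t `<=` ccube 0 (`|B| + `|M| + `|t|).
Proof.
move=> x [Cx /= xt]; apply/forall_lift; split => [|i]; rewrite mxE subr0.
  rewrite -/(last_coord x).
  have -> : `|last_coord x| = `|s * last_coord x| by rewrite normrM norm_s mul1r.
  have := C_low Cx; have := ler_norm (- M); have := ler_norm t; rewrite normrN.
  have := normr_ge0 B; have := normr_ge0 t; have := normr_ge0 M.
  by rewrite ler_norml => *; apply/andP; split; lra.
rewrite -proj_coord; have := C_bounded i Cx.
by have := ler_norm B; have := normr_ge0 t; have := normr_ge0 M; lra.
Qed.

Lemma sublevel_volume_fin t : mu (sublevel t) \is a fin_num.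
Proof.
rewrite ge0_fin_numE ?outer_measure_ge0//.
exact: volume_bounded_lty (@sublevel_bounded t).
Qed.

Lemma sublevel_mono t t' : t <= t' -> sublevel t `<=` sublevel t'.
Proof. by move=> tt x [Cx xt]; split => //; exact: le_trans tt. Qed.

Let V t := fine (mu (sublevel t)).

Lemma sublevel_lipschitz t w : 0 < w -> V t <= V (t + w) <= V t + w * fine (volume R n K).
Proof.
move=> w0; rewrite -!lee_fin EFinD !fineK ?sublevel_volume_fin//.
apply/andP; split.
  by apply: le_outer_measure; apply: sublevel_mono; rewrite lerDl ltW.
have slab := @slab_volume _ _ n_gt0 K s B (base_convex cC)
  (base_bounded C_bounded) (horizontal_projection p) r r0
  (subset_trans (proj_cube r0 pC) (@subset_closure _ _)) s1 t w w0.
apply: le_trans; last exact: leeD2l slab.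
apply: le_trans (outer_measureU2 _ _ _); apply: le_outer_measure => x [Cx /= xt].
have [h|h] := leP (s * last_coord x) t; [by left|right].
by split; [apply: subset_closure; exists x|rewrite (ltW h)].
Qed.

(** Disjoint vertical translates of [cube p r], stacked in the unbounded direction, fill any volume
    inside [C]. *)
Lemma sublevel_unbounded (v : R) : exists t, v <= V t.
Proof.
have v0 : 0 < (2 * r) ^+ n.+1 by rewrite exprn_gt0// mulr_gt0.
pose N := Num.bound (`|v| / (2 * r) ^+ n.+1).
pose x (k : 'I_N) := p + (s * (2 * r * k%:R)) *: delta_mx 0 ord_max.
pose T := s * last_coord p + r + 2 * r * N%:R.
have xP k y : cube (x k) r y -> cube p r (y - (s * (2 * r * k%:R)) *: delta_mx 0 ord_max).
  by move=> H l; have := H l; rewrite !mxE opprD addrA addrAC.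
exists T.
apply: (@le_trans _ _ (\sum_(k < N) (2 * r) ^+ n.+1)).
  rewrite sumr_const card_ord -[leRHS]mulr_natl -ler_pdivrMr//.
  apply: (@le_trans _ _ (`|v| / (2 * r) ^+ n.+1)).
    by rewrite ler_pM2r ?invr_gt0// ler_norm.
  by rewrite ltW// archi_boundP// divr_ge0// ltW.
rewrite -lee_fin -sumEFin fineK ?sublevel_volume_fin//.
have lastE k y : last_coord (y - (s * (2 * r * k%:R)) *: delta_mx 0 ord_max) =
    last_coord y - s * (2 * r * k%:R).
  by rewrite /last_coord !mxE !eqxx mulr1.
have xS k : cube (x k) r `<=` sublevel T.
  move=> y /xP Hy; split.
    rewrite -(subrK ((s * (2 * r * k%:R)) *: delta_mx 0 ord_max) y).
    by apply: C_up; [exact: pC|rewrite !mulr_ge0// ltW].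
  have := Hy ord_max; rewrite -!/(last_coord _) lastE => H.
  have : `|s * last_coord y - 2 * r * k%:R - s * last_coord p| < r.
    have -> : s * last_coord y - 2 * r * k%:R - s * last_coord p =
      s * (last_coord y - s * (2 * r * k%:R) - last_coord p).
      by rewrite !mulrBr [s * (s * _)]mulrA ss mul1r.
    by rewrite normrM norm_s mul1r.
  rewrite ltr_norml /= /T => /andP[_ h].
  have : 2 * r * k%:R <= 2 * r * N%:R by rewrite ler_pM2l ?mulr_gt0// ler_nat ltnW.
  by move: h; lra.
apply: (@le_trans _ _ (\sum_(k < N) mu (sublevel T `&` cube (x k) r))).
  by apply: lee_sum => k _; rewrite setIidr// volume_cube.
rewrite sum_disjoint_volume//.
- by apply: le_outer_measure => y [].
- by move=> k; exact: cube_measurable.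
- move=> k k' y /xP/(_ ord_max) + /xP/(_ ord_max); rewrite -!/(last_coord _) !lastE => h h'.
  have : `|s * (2 * r * k%:R) - s * (2 * r * k'%:R)| < 2 * r.
    have -> : s * (2 * r * k%:R) - s * (2 * r * k'%:R) =
      (last_coord y - s * (2 * r * k'%:R) - last_coord p) -
      (last_coord y - s * (2 * r * k%:R) - last_coord p) by ring.
    apply: (le_lt_trans (ler_normB _ _)); move: h h'; lra.
  rewrite -!mulrBr normrM norm_s mul1r normrM gtr0_norm ?mulr_gt0//.
  rewrite gtr_pMr ?mulr_gt0// ltr_norml => /andP[h1 h2].
  have [h3 h4] : k%:R < k'%:R + 1 :> R /\ k'%:R < k%:R + 1 :> R by split; lra.
  by apply/val_inj/eqP; move: h3 h4; rewrite !natr1 !ltr_nat !ltnS eqn_leq => -> ->.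
- by apply: closed_measurable_volume; exact: closed_sublevel.
Qed.

(** The slab bound makes the volume Lipschitz in the height, so the intermediate value theorem
    applies between an empty sublevel and a large one. *)
Lemma sublevel_of_volume (v : R) : 0 < v -> exists t, mu (sublevel t) = v%:E.
Proof.
move=> v0; have [T VT] := sublevel_unbounded v.
pose a := Num.min (M - 1) T.
have Va : V a = 0.
  rewrite /V (_ : sublevel a = set0) ?outer_measure0//.
  rewrite -subset0 => x [Cx /= xa]; have := C_low Cx.
  have : a <= M - 1 by rewrite ge_min lexx.
  by move: xa; lra.
pose k := fine (volume R n K) + 1.
have k0 : 0 < k by rewrite ltr_wpDl// fine_ge0// outer_measure_ge0.
have Vlip t u : `|V t - V u| <= k * `|t - u|.
  wlog tu : t u / t <= u => [H|].
    have [/H//|ut] := leP t u.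
    by rewrite distrC (distrC t); apply: H; exact: ltW.
  have [->|tne] := eqVneq t u; first by rewrite !subrr normr0 mulr0.
  have tlu : 0 < u - t by rewrite subr_gt0 lt_neqAle tne.
  have := sublevel_lipschitz t tlu; rewrite addrC subrK => /andP[h1 h2].
  rewrite distrC (distrC t) !ger0_norm ?subr_ge0//.
  rewrite lerBlDl (le_trans h2)// lerD2l mulrC ler_pM2r// /k lerDl//.
have Vc : continuous V.
  move=> t; apply/cvgrPdist_le => e e0; apply/nbhs_ballP; exists (e / k).
    by rewrite /= divr_gt0.
  move=> u; rewrite /ball /= => tu; rewrite (le_trans (Vlip _ _))//.
  by rewrite mulrC -ler_pdivlMr// ltW.
have aT : a <= T by rewrite ge_min lexx orbT.
have [||t _ Vt] := @IVT _ V a T v aT.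
- exact: continuous_subspaceT.
- rewrite Va ge_min le_max (ltW v0) VT orbT//.
- by exists t; rewrite -(fineK (sublevel_volume_fin t)) -Vt.
Qed.

End Sublevel.

(** * Upper bound *)

Section IntegralTranslation.
Context {R : realType} {m : nat}.
Local Notation mu := (volume R m).
Local Notation cara := (caratheodory_type mu).
Local Open Scope ereal_scope.

Lemma volume_translation (a : 'rV[R]_m) (X : set 'rV[R]_m) :
  mu [set x | X (x + a)%R] = mu X.
Proof.
rewrite (_ : [set x | X (x + a)%R] = [set (- a + 1 *: x)%R | x in X]).
  by rewrite volume_affine// expr1n mul1e.
apply/seteqP; split => [x Xx|_ [x Xx <-]]; last by rewrite /= scale1r addrC addrA subrr add0r.
by exists (x + a)%R => //; rewrite scale1r addrC addrK.
Qed.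

(** The Caratheodory condition for a translate of [B] tested on [X] is the condition for [B] tested
    on a translate of [X]. *)
Lemma translation_measurable (a : 'rV[R]_m) :
  measurable_fun setT (fun x : cara => (x + a)%R : cara).
Proof.
move=> _ B mB; rewrite setTI.
suff: mu.-caratheodory [set x | B (x + a)%R] by [].
move=> X.
pose Y := [set x | X (x - a)%R].
have XE : X = [set x | Y (x + a)%R] by apply/seteqP; split => x; rewrite /Y /= addrK.
rewrite {1}XE volume_translation (mB Y).
rewrite -(volume_translation a (Y `&` B)) -(volume_translation a (Y `&` ~` B)).
by congr (_ + _); congr (mu _); apply/seteqP; split => x; rewrite /Y /= addrK.
Qed.

Lemma integral_translation (a : 'rV[R]_m) (H H' : set 'rV[R]_m) (f : 'rV[R]_m -> \bar R) :
  measurable (H' : set cara) -> (forall x, H x <-> H' (x + a)%R) ->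
  measurable_fun setT (f : cara -> \bar R) ->
  (volume_measure R m).-integrable H (fun x => f (x + a)%R) ->
  \int[volume_measure R m]_(x in H) f (x + a)%R = \int[volume_measure R m]_(x in H') f x.
Proof.
move=> mH' HH' mf intf; pose phi (x : cara) : cara := (x + a)%R.
have HE : H = phi @^-1` H' by apply/seteqP; split => x /=; apply HH'.
rewrite HE in intf *.
have E := @integral_pushforward _ _ _ _ _ phi (translation_measurable a) (volume_measure R m) H'
  f mf intf mH'.
refine (etrans (esym E) _).
refine (eq_measure_integral (volume_measure R m) _) => A mA _; exact: volume_translation.
Unshelve. exact: translation_measurable.
Qed.

End IntegralTranslation.

Section DifferenceQuotient.
Context {R : realType} {m : nat}.
Hypothesis m_gt0 : (0 < m)%N.
Local Notation mu := (volume R m).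
Local Notation cara := (caratheodory_type mu).
Implicit Types (f : 'rV[R]_m -> R) (i : 'I_m).

Lemma partial_eq0 f i (A : set 'rV[R]_m) : closed A -> (forall y, ~ A y -> f y = 0) ->
  forall y, ~ A y -> partial f i y = 0.
Proof.
move=> clA fA y Ay; rewrite /partial /derive; apply: cvg_lim => //.
apply: cvg_near_cst.
have oA : open (~` A) by exact: closed_openC.
have cl : (h *: (delta_mx 0 i : 'rV[R]_m) + y) @[h --> (0:R)^'] --> y.
  rewrite -[X in _ --> X](add0r y) -(scale0r (delta_mx 0 i : 'rV[R]_m)).
  apply: cvg_within_filter; apply: cvgD; last exact: cvg_cst.
  by apply: cvgZr_tmp; exact: cvg_id.
have : nbhs y (~` A) by exact: open_nbhs_nbhs.
move=> /cl; rewrite /nbhs /= => H; near=> h.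
have Ah : ~ A (h *: (delta_mx 0 i : 'rV[R]_m) + y) by near: h.
by rewrite [f (h *: _ + y)]fA// [f y]fA// subr0 scaler0.
Unshelve. all: by end_near. Qed.

Variables (f : 'rV[R]_m -> R) (i : 'I_m) (b : R).
Hypothesis f_cont : continuous f.
Hypothesis f_derivable : forall x, derivable f x (delta_mx 0 i).
Hypothesis df_cont : continuous (partial f i).
Hypothesis f_support : forall y, ~ ccube 0 b y -> f y = 0.

Lemma bounded_ccube_support (g : 'rV[R]_m -> R) : continuous g ->
  (forall y, ~ ccube 0 b y -> g y = 0) -> exists2 M, 0 < M & forall y, `|g y| <= M.
Proof.
move=> cg g0; have cptb : compact (ccube (0 : 'rV[R]_m) b).
  by apply: (@compact_ccubeP _ _ _ b); [exact: closed_ccube|].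
have [N [Nr HN]] := compact_bounded (continuous_compact (continuous_subspaceT cg) cptb).
exists (`|N| + 1); first by rewrite ltr_wpDl.
move=> y; have [yb|/g0 ->] := pselect (ccube 0 b y); last by rewrite normr0 ler_wpDl.
by apply: (HN (`|N| + 1)); [rewrite (le_lt_trans (ler_norm N))// ltrDl|exists y].
Qed.

Lemma partial_line y (t : R) : is_derive t 1 (fun u : R => f (y + u *: delta_mx 0 i))
  (partial f i (y + t *: delta_mx 0 i)).
Proof.
apply: is_derive_cvg.
have D : is_derive (y + t *: delta_mx 0 i) (delta_mx 0 i) f (partial f i (y + t *: delta_mx 0 i)).
  exact: DeriveDef.
have := is_derive_cvgP D; apply: cvg_trans; apply: near_eq_cvg; near=> h.
by rewrite [h *: 1]mulr1 scalerDl addrCA.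
Unshelve. all: by end_near. Qed.

Lemma difference_quotient_bound M : (forall y, `|partial f i y| <= M) ->
  forall y (a : R), a != 0 -> `|a^-1 * (f (y + a *: delta_mx 0 i) - f y)| <= M.
Proof.
move=> HM y a a0; pose g (u : R) := f (y + u *: delta_mx 0 i).
have D (u : R) := partial_line y u.
have [c Hc] : exists c, g a - g 0 = partial f i (y + c *: delta_mx 0 i) * a.
  have [a1|a1|/eqP] := ltgtP 0 a; last by rewrite eq_sym (negbTE a0).
    by have [c _ E] := MVT_global D a1; exists c; rewrite /g E subr0.
  by have [c _ E] := MVT_global D a1; exists c; rewrite -opprB /g E sub0r mulrN opprK.
have -> : f (y + a *: delta_mx 0 i) - f y = g a - g 0 by rewrite /g scale0r addr0.
by rewrite Hc mulrCA mulVf// mulr1.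
Qed.

(** By the mean value theorem all quotients are bounded by a bound of the partial derivative, and
    they vanish outside the cube enlarged by [|s|]: one dominating function for all steps. *)
Lemma partial_integral_cvg (s : R) (H : set 'rV[R]_m) : s != 0 -> measurable (H : set cara) ->
  (\int[volume_measure R m]_(x in H)
     ((s / k.+1%:R)^-1 * (f (x + (s / k.+1%:R) *: delta_mx 0 i) - f x))%:E)%E
    @[k --> \oo] --> (\int[volume_measure R m]_(x in H) (partial f i x)%:E)%E.
Proof.
move=> s0 mH; have cl0 : closed (ccube (0 : 'rV[R]_m) b) by exact: closed_ccube.
have [M M0 HM] := bounded_ccube_support df_cont (@partial_eq0 f i _ cl0 f_support).
pose B := ccube (0 : 'rV[R]_m) (b + `|s|).
have mB : measurable (B : set cara) by exact: ccube_measurable.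
pose q k x := (s / k.+1%:R)^-1 * (f (x + (s / k.+1%:R) *: delta_mx 0 i) - f x).
have a0 k : s / k.+1%:R != 0 by rewrite mulf_neq0// invr_eq0 pnatr_eq0.
have qc k : continuous (q k).
  rewrite /q => x; set w := (s / k.+1%:R) *: delta_mx 0 i.
  have ct : {for x, continuous (fun y : 'rV[R]_m => f (y + w))}.
    apply: (@continuous_comp _ _ _ (fun y : 'rV[R]_m => y + w) f); last exact: f_cont.
    by apply: continuousD; [exact: cvg_id|exact: cst_continuous].
  have c0 : {for x, continuous (fun=> (s / k.+1%:R)^-1 : R)} by exact: cst_continuous.
  exact: (continuousM c0 (continuousB ct (@f_cont x))).
have qB k x : `|q k x| <= M * \1_B x.
  rewrite indicE; have [|xB] := boolP (x \in B).
    by move=> _; rewrite mulr1; exact: difference_quotient_bound.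
  have sk : `|s / k.+1%:R| <= `|s|.
    rewrite normrM normfV (ger0_norm (ler0n _ _)) ler_pdivrMr ?ltr0n//.
    by rewrite ler_peMr// ler1n.
  rewrite /q !f_support ?subrr ?mulr0 ?normr0// => xb; move: xB; rewrite mem_set//.
    by move=> l; rewrite (le_trans (xb l))// lerDl.
  move=> l; have := xb l; rewrite !mxE subr0 subr0.
  set u := x 0 l; set w := _ * _ => h.
  have wl : `|w| <= `|s|.
    by rewrite /w normrM (le_trans _ sk)// ler_piMr// ?eqxx; case: (l == i);
      rewrite /= ?normr1 ?normr0.
  have -> : u = (u + w) - w by rewrite addrK.
  by rewrite (le_trans (ler_normB _ _))// lerD.
have intB : (volume_measure R m).-integrable H (EFin \o (fun x => M * \1_B x)).
  by apply: indic_integrable => //; exact: (@volume_bounded_lty _ _ m_gt0 _ 0 (b + `|s|)).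
have [|||||_ _] := @dominated_convergence _ cara R (volume_measure R m) H mH
  (fun k x => (q k x)%:E) (fun x => (partial f i x)%:E) (EFin \o (fun x => M * \1_B x)).
- move=> k; apply/measurable_EFinP; exact: continuous_measurable_volume.
- by apply/measurable_EFinP; exact: continuous_measurable_volume.
- apply: aeW => x _; apply: cvg_EFin; first exact: nearW.
  have D : is_derive x (delta_mx 0 i) f (partial f i x) by exact: DeriveDef.
  have cvg_a : s / k.+1%:R @[k --> \oo] --> (0 : R)^'.
    move=> A /= [e e0 HA].
    have : s * k.+1%:R^-1 @[k --> \oo] --> s * 0.
      by apply: cvgMl_tmp; exact: cvg_harmonic.
    rewrite mulr0 => /cvgrPdist_lt/(_ e e0); apply: filterS => k Hk.
    exact: HA.
  have := cvg_comp _ _ cvg_a (is_derive_cvgP D).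
  apply: cvg_trans; apply: near_eq_cvg; near=> k.
  by rewrite /= /q [x + _]addrC.
- exact: intB.
- by apply: aeW => x k _; rewrite lee_fin; exact: qB.
- by [].
Unshelve. all: by end_near. Qed.

End DifferenceQuotient.

Section SublevelPerimeter.
Context {R : realType} {n : nat}.
Hypothesis n_gt0 : (0 < n)%N.
Local Notation mu := (volume R n.+1).
Local Notation cara := (caratheodory_type mu).
Variables (C : set 'rV[R]_n.+1) (s B : R).
Hypothesis cC : convex C.
Hypothesis s1 : s = 1 \/ s = -1.
Hypothesis C_bounded : forall x i, C x -> `|horizontal_projection x 0 i| <= B.
Variables (p : 'rV[R]_n.+1) (r : R).
Hypotheses (r0 : 0 < r) (pC : cube p r `<=` C).
Let K := closure (horizontal_projection @` C).
Let H (t : R) : set 'rV[R]_n.+1 := [set x | s * last_coord x <= t].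

Let ss : s * s = 1. Proof. by case: s1 => ->; rewrite ?mulrNN mulr1. Qed.
Let s_neq0 : s != 0. Proof. by case: s1 => ->; rewrite ?oppr_eq0 oner_eq0. Qed.

Let mH t : measurable (H t : set cara).
Proof. by apply: closed_measurable_volume; exact: closed_halfspace. Qed.

Variables (xi : 'rV[R]_n.+1 -> 'rV[R]_n.+1) (t : R).
Hypothesis xiP : test_field C xi.

Let A := support_of xi.
Let clA : closed A. Proof. exact: closed_closure. Qed.
Let AC : A `<=` C.
Proof. by case: xiP => _ _ AC _ x /AC; exact: interior_subset. Qed.

Let xi_eq0 i y : ~ A y -> xi y 0 i = 0.
Proof.
move=> Ay; have -> : xi y = 0; last by rewrite mxE.
by apply/eqP; apply: contra_notT Ay => xy; exact: subset_closure.
Qed.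

Let A_bounded : exists b, A `<=` ccube 0 b.
Proof.
by case: xiP => _ /compact_bounded/bounded_ccubeP[b _ Hb] _ _; exists b.
Qed.

Let xi_cont i : continuous (fun y => xi y 0 i).
Proof. by case: xiP => /(_ i)/(_ [::])[]. Qed.

Let xi_derivable i y : derivable (fun y => xi y 0 i) y (delta_mx 0 i).
Proof. by case: xiP => /(_ i)/(_ [::])[_ h] _ _ _; exact: h. Qed.

Let dxi_cont i : continuous (partial (fun y => xi y 0 i) i).
Proof. by case: xiP => /(_ i)/(_ [:: i])[]. Qed.

Let xi_le i y : `|xi y 0 i| <= 1.
Proof. by case: xiP => _ _ _ h; exact: le_trans (enorm_coord _ _) (h y). Qed.

Let xi_indic i y : `|xi y 0 i| <= 1 * \1_A y.
Proof.
rewrite indicE mul1r; have [_|yA] := boolP (y \in A); first exact: xi_le.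
by rewrite xi_eq0 ?normr0// => Ay; rewrite mem_set in yA.
Qed.

Let mA : measurable (A : set cara). Proof. exact: closed_measurable_volume. Qed.

Let A_lty : (mu A < +oo)%E.
Proof. by have [b Ab] := A_bounded; exact: (volume_bounded_lty _ Ab). Qed.

Let xi_integrable i D : measurable (D : set cara) ->
  (volume_measure R n.+1).-integrable D (EFin \o (fun y => xi y 0 i)).
Proof. by move=> mD; exact: (bounded_support_integrable (@xi_cont i) mD mA A_lty (xi_indic i)). Qed.

Let shift_integrable i (a : 'rV[R]_n.+1) D : measurable (D : set cara) ->
  (volume_measure R n.+1).-integrable D (EFin \o (fun y => xi (y + a) 0 i)).
Proof.
move=> mD; have [b Ab] := A_bounded.
pose A' := [set y | A (y + a)].
have mA' : measurable (A' : set cara).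
  by rewrite -[A' : set cara]setTI; exact: translation_measurable.
have cs : continuous (fun y : 'rV[R]_n.+1 => xi (y + a) 0 i).
  move=> y; apply: (@continuous_comp _ _ _ (fun y : 'rV[R]_n.+1 => y + a) (fun y => xi y 0 i)).
    by apply: continuousD; [exact: cvg_id|exact: cst_continuous].
  exact: xi_cont.
have A'oo : (mu A' < +oo)%E by rewrite volume_translation.
have xiA' y : `|xi (y + a) 0 i| <= 1 * \1_A' y.
  by have := xi_indic i (y + a); rewrite !indicE.
exact: (bounded_support_integrable cs mD mA' A'oo xiA').
Qed.

Let quotient_integral i (a : R) H' : measurable (H' : set cara) ->
  (forall x, H t x <-> H' (x + a *: delta_mx 0 i)) ->
  (\int[volume_measure R n.+1]_(x in H t)
     (a^-1 * (xi (x + a *: delta_mx 0 i) 0 i - xi x 0 i))%:E =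
   a^-1%:E * (\int[volume_measure R n.+1]_(x in H') (xi x 0 i)%:E -
              \int[volume_measure R n.+1]_(x in H t) (xi x 0 i)%:E))%E.
Proof.
move=> mH' HH'.
have mf : measurable_fun setT ((fun x => (xi x 0 i)%:E) : cara -> \bar R).
  by apply/measurable_EFinP; apply: continuous_measurable_volume; exact: xi_cont.
have E := integral_translation mH' HH' mf (shift_integrable i (a *: delta_mx 0 i) (mH t)).
refine (etrans _ (congr1 (fun z => a^-1%:E * (z - _))%E E)).
rewrite -integralB_EFin//; last 2 first.
- exact: shift_integrable.
- exact: xi_integrable.
rewrite -integralZl//.
by apply: integrableB => //; [exact: shift_integrable|exact: xi_integrable].
Qed.

(** The field vanishes off [C], so the integral may be taken over the half-space [H t]. Unlike the
    sublevel set, [H t] is invariant under horizontal translations and is carried to another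
    half-space by vertical ones. *)
Lemma divergence_sublevel_le :
  (\int[volume_measure R n.+1]_(x in sublevel C s t) (divergence xi x)%:E <= volume R n K)%E.
Proof.
have [b Ab] := A_bounded.
have off i y : ~ A y -> partial (fun z => xi z 0 i) i y = 0.
  by apply: partial_eq0 => // z Az; exact: xi_eq0.
have offb i y : ~ ccube 0 b y -> xi y 0 i = 0 by move=> yb; apply: xi_eq0 => /Ab.
have int_partial i : (volume_measure R n.+1).-integrable (H t)
    (EFin \o partial (fun z => xi z 0 i) i).
  have offb' y : ~ ccube 0 b y -> partial (fun z => xi z 0 i) i y = 0 by move=> yb;
    apply: off => /Ab.
  have [M M0 HM] := bounded_ccube_support (@dxi_cont i) offb'.
  apply: (bounded_support_integrable (@dxi_cont i) (mH t) mA A_lty (M := M)) => y.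
  rewrite indicE; have [_|yA] := boolP (y \in A); first by rewrite mulr1.
  by rewrite off ?normr0 ?mulr0// => Ay; rewrite mem_set in yA.
have -> : (\int[volume_measure R n.+1]_(x in sublevel C s t) (divergence xi x)%:E =
    \int[volume_measure R n.+1]_(x in H t) (divergence xi x)%:E)%E.
  rewrite integral_mkcond [RHS]integral_mkcond; apply: eq_integral => x _.
  rewrite /patch /sublevel in_setI; have [//|xC] := boolP (x \in C).
  rewrite /= /divergence big1 ?if_same// => i _; apply: off => /AC Cx.
  by rewrite mem_set in xC.
have lim i := @partial_integral_cvg R _ (ltn0Sn n) (fun z => xi z 0 i) i b (@xi_cont i)
  (@xi_derivable i) (@dxi_cont i) (offb i) s (H t) s_neq0 (mH t).
under eq_integral do rewrite /divergence -sumEFin.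
rewrite integral_sum//.
rewrite big_ord_recr/= big1 ?add0e => [|i _].
  apply: (cvge_to_le (lim ord_max)); apply: nearW => k.
  set T : R := k.+1%:R; have T0 : 0 < T by rewrite ltr0n.
  have HU : H (t + T^-1) = H t `|` (H (t + T^-1) `\` H t).
    apply/seteqP; split => x; rewrite /H /=; first by case: (pselect (s * last_coord x <= t));
      [left|right].
    by case=> [h|[]//]; rewrite (le_trans h)// lerDl invr_ge0 ltW.
  have mD : measurable (H (t + T^-1) `\` H t : set cara) by apply: measurableD.
  have mxi D : measurable_fun D (fun x : cara => (xi x 0 ord_max)%:E).
    by apply/measurable_EFinP; apply: continuous_measurable_volume; exact: xi_cont.
  (* For either sign [s], the step [s / T] raises [s * last_coord] by [T^-1]. *)
  rewrite (quotient_integral (H' := H (t + T^-1)))//; last first.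
    by move=> x; rewrite /H /= /last_coord !mxE !eqxx mulr1 mulrDr mulrA ss mul1r lerD2r.
  rewrite HU integral_setU//; last by apply/disj_setPS => x [? []].
  rewrite addeAC subee ?add0e; last by apply: integrable_fin_num => //; exact: xi_integrable.
  have absJ : (`|\int[volume_measure R n.+1]_(x in H (t + T^-1) `\` H t) (xi x 0 ord_max)%:E|
      <= (T^-1 * fine (volume R n K))%:E)%E.
    apply: (le_trans (le_abse_integral _ mD (mxi _))).
    apply: (@le_trans _ _ (\int[volume_measure R n.+1]_(x in H (t + T^-1) `\` H t) (\1_A x)%:E)%E).
      have mi : measurable_fun (H (t + T^-1) `\` H t : set cara) (fun x : cara => (\1_A x)%:E :
        \bar R).
        by apply/measurable_EFinP; exact: measurable_indic.
      have ma := measurableT_comp (@abse_measurable R setT) (mxi (H (t + T^-1) `\` H t)).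
      apply: (ge0_le_integral (volume_measure R n.+1) mD _ ma mi) => x _; first exact: abse_ge0.
      by rewrite lee_fin -[leRHS]mul1r; exact: xi_indic.
    rewrite integral_indic//.
    apply: (le_trans _ (@slab_volume _ _ n_gt0 K s B (base_convex cC)
      (base_bounded C_bounded) (horizontal_projection p) r r0
      (subset_trans (proj_cube r0 pC) (@subset_closure _ _)) s1 t T^-1 _));
        last by rewrite invr_gt0.
    apply: le_outer_measure => x [Ax [/= h1 /negP]]; rewrite -ltNge => h2; split.
      by apply: subset_closure; exists x => //; exact: AC.
    by rewrite (ltW h2).
  apply: (le_trans (lee_abs _)); rewrite abseM abse_EFin.
  rewrite (_ : `|(s / T)^-1| = T); last first.
    rewrite normfV normrM normfV (gtr0_norm T0).
    by rewrite (_ : `|s| = 1) ?mul1r ?invrK//; case: s1 => ->; rewrite ?normrN normr1.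
  apply: (le_trans (lee_wpmul2l _ absJ)); first by rewrite lee_fin ltW.
  by rewrite -EFinM mulrA mulfV ?gt_eqF// mul1r fineK// (base_volume_fin_num n_gt0 (base_bounded
    C_bounded)).
apply/esym; apply: (cvg_unique _ _ (lim (widen_ord (leqnSn n) i))) => //.
apply: cvg_near_cst; apply: nearW => k.
rewrite (quotient_integral (H' := H t))//.
  rewrite subee ?mule0//; apply: integrable_fin_num => //; exact: xi_integrable.
move=> x; rewrite /H /= /last_coord !mxE.
have -> : (ord_max == widen_ord (leqnSn n) i) = false; last by rewrite andbF mulr0 addr0.
by apply/eqP => /(congr1 val) /= E; have := ltn_ord i; rewrite -E ltnn.
Qed.

End SublevelPerimeter.

Lemma isoperimetric_profile_le (R : realType) (n : nat) (C : set 'rV[R]_n.+1) (s B M : R)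
  (p : 'rV[R]_n.+1) (r v : R) : (0 < n)%N -> closed C -> convex C -> s = 1 \/ s = -1 ->
  (forall x t, C x -> 0 <= t -> C (x + (s * t) *: delta_mx 0 ord_max)) ->
  (forall x i, C x -> `|horizontal_projection x 0 i| <= B) ->
  (forall x, C x -> M <= s * last_coord x) -> 0 < r -> cube p r `<=` C -> 0 < v ->
  (isoperimetric_profile C v <= volume R n (closure (horizontal_projection @` C)))%E.
Proof.
move=> n0 clC cC s1 C_up CB CM r0 pC v0.
have [t tv] := sublevel_of_volume n0 clC cC s1 C_up CB CM r0 pC v0.
apply: (@le_trans _ _ (relative_perimeter C (sublevel C s t))).
  apply: ereal_inf_lbound; exists (sublevel C s t) => //; split => //.
    exact/closed_measurable_volume/closed_sublevel.
  by move=> x [].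
apply: ge_ereal_sup => _ [xi xiP <-].
exact: (divergence_sublevel_le n0 cC s1 CB r0 pC).
Qed.

(** * Lower bound *)

Lemma translation_estimate_in (R : realType) (m : nat) (C E : set 'rV[R]_m) (P : R)
  (I : finType) (A : {pred I}) (r : R) (x : I -> 'rV[R]_m) (w : 'rV[R]_m) (d : R) :
  (0 < m)%N -> measurable (E : set (caratheodory_type (volume R m))) ->
  (relative_perimeter C E <= P%:E)%E -> 0 < r -> 0 < d ->
  {in A &, forall c c', forall y, cube (x c) r y -> cube (x c') r y -> c = c'} ->
  {in A, forall c (y : 'rV[R]_m) (t : R) (z : 'rV[R]_m), ccube (x c) r y -> 0 <= t <= 1 ->
    (forall l, `|z 0 l| <= d) ->
     interior C (y + t *: w + z)} ->
  \sum_(c in A) `|fine (volume R m (E `&` cube (x c) r)) -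
                  fine (volume R m (E `&` cube (x c + w) r))| <= (\sum_l `|w 0 l|) * P.
Proof.
move=> m0 mE EP r0 d0 dx xC; rewrite big_sub.
apply: (translation_estimate m0 mE EP r0 (x := fun c => x (val c)) d0) => [c c' y h h'|c].
  by apply/val_inj; apply: dx h h'; exact: valP.
by apply: xC; exact: valP.
Qed.

(** * Volumes of [E] in the cells of a grid *)

Section GridEstimate.
Context {R : realType} {n : nat}.
Local Notation mu := (volume R n.+1).
Local Notation cara := (caratheodory_type mu).

Definition cell N (o : 'rV[R]_n) (eta T s : R) (i : {ffun 'I_n -> 'I_N}) (k : nat) : 'rV[R]_n.+1 :=
  join (grid_center o eta i) (s * (T + eta * (k%:R + 2^-1))).

Variables (C E : set 'rV[R]_n.+1) (P s : R).
Hypothesis cC : convex C.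
Hypothesis s1 : s = 1 \/ s = -1.
Hypothesis mE : measurable (E : set cara).
Hypothesis Eoo : (mu E < +oo)%E.
Hypothesis EP : (relative_perimeter C E <= P%:E)%E.
Variables (N : nat) (o : 'rV[R]_n) (eta T : R).
Hypothesis eta0 : 0 < eta.
Local Notation I := {ffun 'I_n -> 'I_N}.
Let x (i : I) k := cell o eta T s i k.
Let Q i k := cube (x i k) (eta / 2).
Let a i k := fine (mu (E `&` Q i k)).

Let ss : s * s = 1. Proof. by case: s1 => ->; rewrite ?mulrNN mulr1. Qed.
Let norm_s : `|s| = 1. Proof. by case: s1 => ->; rewrite ?normrN normr1. Qed.
Let eta20 : 0 < eta / 2. Proof. by rewrite divr_gt0. Qed.

Lemma cell_height (y : 'rV[R]_n.+1) (u : R) : `|last_coord y - s * u| = `|s * last_coord y - u|.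
Proof. by rewrite -[in LHS](mul1r (last_coord y)) -{1}ss -mulrA -mulrBr normrM norm_s mul1r. Qed.

Lemma cell_disjoint i k i' k' y : Q i k y -> Q i' k' y -> i = i' /\ k = k'.
Proof.
move=> /cube_join[h1 h2] /cube_join[h1' h2']; split; first exact: grid_disjoint h1 h1'.
move: h2 h2'; rewrite !cell_height !ltr_norml => /andP[h5 h2] /andP[h3 h4].
have [h6 h7] : k%:R < k'%:R + 1 :> R /\ k'%:R < k%:R + 1 :> R.
  by split; rewrite -(ltr_pM2l eta0); lra.
by apply/eqP; move: h6 h7; rewrite !natr1 !ltr_nat !ltnS eqn_leq => -> ->.
Qed.

Lemma cell_up i k : x i k + (s * eta) *: delta_mx 0 ord_max = x i k.+1.
Proof. by rewrite /x /cell join_up -natr1; congr join; ring. Qed.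

Let mQ i k : measurable (Q i k : set cara).
Proof. exact: cube_measurable. Qed.

Let fin_Q i k : mu (E `&` Q i k) \is a fin_num.
Proof.
rewrite ge0_fin_numE ?outer_measure_ge0//; apply: le_lt_trans Eoo.
by apply: le_outer_measure => y [].
Qed.

Lemma cells_volume_le M (A : {pred I * 'I_M}) k0 :
  \sum_(c in A) a c.1 (k0 + c.2)%N <= fine (mu E).
Proof.
apply: (@le_trans _ _ (\sum_(c : I * 'I_M) a c.1 (k0 + c.2)%N)).
  rewrite big_mkcond/=; apply: ler_sum => c _; case: ifP => // _.
  exact: fine_ge0 (outer_measure_ge0 _ _).
rewrite -lee_fin -sumEFin fineK; last by rewrite ge0_fin_numE ?outer_measure_ge0.
rewrite (eq_bigr (fun c : I * 'I_M => mu (E `&` Q c.1 (k0 + c.2)%N))) => [|c _]; last exact: fineK.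
rewrite (sum_disjoint_volume (Q := fun c : I * 'I_M => Q c.1 (k0 + c.2)%N))//.
- by apply: le_outer_measure => y [].
- move=> [i k] [i' k'] y h h'; have /= [-> /eqP] := cell_disjoint h h'.
  by rewrite eqn_add2l => /eqP/val_inj ->.
Qed.

Variable IZ : {set I}.
Hypothesis IZ_int : forall i k, i \in IZ -> ccube (x i k) eta `<=` interior C.

Let margin (i : I) k (y z : 'rV[R]_n.+1) : ccube (x i k) (eta / 2) y -> (forall l, `|z 0 l| <=
  eta / 2) ->
  ccube (x i k) eta (y + z).
Proof.
move=> h h' l; have -> : (y + z) 0 l = y 0 l + z 0 l by rewrite mxE.
by rewrite addrAC (le_trans (ler_normD _ _))//; have := h l; have := h' l; lra.
Qed.

(* Every column over IZ lies in C, so the volume of E in two of its levels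
   differs by at most eta P; the levels far up carry almost no volume. *)
Lemma level_volume_le k : \sum_(i in IZ) a i k <= eta * P.
Proof.
pose S k := \sum_(i in IZ) a i k.
(* The first [L] cells of each column from level [k] are disjoint, and their upward shifts by one
   level telescope. One translation of l1 norm [eta] thus compares levels at any distance. *)
have step L : S k - S (k + L)%N <= eta * P.
  pose w : 'rV[R]_n.+1 := (s * eta) *: delta_mx 0 ord_max.
  have wE : \sum_l `|w 0 l| = eta.
    rewrite big_ord_recr/= big1 => [|l _].
      by rewrite !mxE !eqxx mulr1 add0r normrM norm_s mul1r gtr0_norm.
    rewrite !mxE; have -> : (widen_ord (leqnSn n) l == ord_max) = false.
      by apply/eqP => /(congr1 val) /= El; have := ltn_ord l; rewrite El ltnn.
    by rewrite andbF mulr0 normr0.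
  have := @translation_estimate_in R n.+1 C E P _ [pred c : I * 'I_L | c.1 \in IZ] (eta / 2)
    (fun c => x c.1 (k + c.2)%N) w (eta / 2) (ltn0Sn n) mE EP eta20 eta20.
  rewrite wE => H; apply: le_trans (H _ _).
  - rewrite (eq_bigl (fun c : I * 'I_L => (c.1 \in IZ) && xpredT c.2)) => [|c];
    last by rewrite andbT.
    rewrite -(pair_big (mem IZ) xpredT (fun (i : I) (l : 'I_L) =>
      `|fine (mu (E `&` cube (x i (k + l)%N) (eta / 2))) -
        fine (mu (E `&` cube (x i (k + l)%N + w) (eta / 2)))|))/=.
    rewrite -sumrB; apply: ler_sum => i _.
    apply: (@le_trans _ _ (\sum_(l < L) (a i (k + l)%N - a i (k + l).+1))).
      rewrite -(big_mkord xpredT (fun l => a i (k + l)%N - a i (k + l).+1)).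
      elim: (L) => [|L' IH]; first by rewrite big_nil addn0 subrr.
      rewrite big_nat_recr//= addnS -lerBlDr; move: IH; lra.
    by apply: ler_sum => l _; rewrite /a /Q -cell_up ler_norm.
  - move=> [i l] [i' l'] _ _ y h h'; have /= [-> /eqP] := cell_disjoint h h'.
    by rewrite eqn_add2l => /eqP/val_inj ->.
  - move=> [i l] /= iZ y t z h t01 zl.
    have h1 : interior C (y + z) by apply: (IZ_int iZ (k := (k + l)%N)); exact: margin.
    have h2 : interior C (y + w + z).
      apply: (IZ_int iZ (k := (k + l).+1)); apply: margin => // j.
      by have := h j; rewrite -cell_up /w !mxE opprD addrACA subrr addr0.
    have -> : y + t *: w + z = t *: (y + w + z) + (1 - t) *: (y + z).
      by apply/rowP => j; rewrite !mxE; ring.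
    exact: interior_convex.
have tot M : \sum_(l < M) S (k + l)%N <= fine (mu E).
  have := cells_volume_le (M := M) [pred c : I * 'I_M | c.1 \in IZ] k.
  rewrite (eq_bigl (fun c : I * 'I_M => (c.1 \in IZ) && xpredT c.2)) => [|c]; last by rewrite andbT.
  by rewrite -(pair_big (mem IZ) xpredT (fun (i : I) (l : 'I_M) => a i (k + l)%N))/= exchange_big.
(* An excess over [eta * P] on level [k] would recur on each of the [M] levels counted, against the
   finite volume of [E]. *)
have tot' M : M%:R * (S k - eta * P) <= fine (mu E).
  apply: le_trans (tot M); rewrite mulr_natl -[X in _ *+ X](card_ord M) -sumr_const.
  by apply: ler_sum => l _; have := step l; lra.
rewrite leNgt; apply/negP => lt.
have d0 : 0 < S k - eta * P by rewrite subr_gt0.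
have := tot' (Num.bound (fine (mu E) / (S k - eta * P))).+1.
rewrite -ler_pdivlMr// leNgt => /negP; apply.
apply: (lt_trans (archi_boundP _)); last by rewrite ltr_nat.
by rewrite divr_ge0 ?(ltW d0)// fine_ge0// outer_measure_ge0.
Qed.

Lemma perimeter_bound_ge0 : 0 <= P.
Proof.
rewrite -(pmulr_rge0 _ eta0); apply: le_trans (level_volume_le 0).
by apply: sumr_ge0 => i _; rewrite fine_ge0// outer_measure_ge0.
Qed.

Variables (M : nat) (G : {set I * 'I_M}).
Hypothesis G_int : forall c, c \in G -> ccube (x c.1 c.2) eta `<=` interior C.

Let shift_lt (i j : 'I_N) : (N + j - i < N + N)%N.
Proof. by have := ltn_ord j; have := ltn_ord i; lia. Qed.

(* The pairs are grouped by their difference j - i (shifted by N), and the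
   translation estimate applies to each of the (2N)^n groups. *)
Lemma pair_oscillation_le :
  \sum_(c in G) \sum_(j in IZ) `|a c.1 c.2 - a j c.2| <=
  (2 * N%:R) ^+ n * (n%:R * (N%:R * eta)) * P.
Proof.
rewrite pair_big/=.
pose p (u : (I * 'I_M) * I) : {ffun 'I_n -> 'I_(N + N)} := [ffun l => Ordinal (shift_lt (u.1.1 l)
  (u.2 l))].
have pE u l : (p u l : nat) = (N + u.2 l - u.1.1 l)%N by rewrite ffunE.
rewrite (partition_big p xpredT)//=.
apply: (@le_trans _ _ (\sum_(d : {ffun 'I_n -> 'I_(N + N)}) (n%:R * (N%:R * eta)) * P)); last first.
  rewrite sumr_const card_ffun !card_ord -[leLHS]mulr_natl mulrA natrX natrD.
  by rewrite (_ : N%:R + N%:R = 2 * N%:R)//; ring.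
apply: ler_sum => d _.
pose w : 'rV[R]_n.+1 := join (\row_l (eta * ((d l)%:R - N%:R))) 0.
have wE : \sum_l `|w 0 l| <= n%:R * (N%:R * eta).
  rewrite (bigD1_ord ord_max)//= -/(last_coord w) join_last normr0 add0r.
  apply: (@le_trans _ _ (\sum_(l < n) (N%:R * eta)));
    last by rewrite sumr_const card_ord -[leLHS]mulr_natl.
  apply: ler_sum => l _; rewrite join_lift mxE normrM gtr0_norm// mulrC ler_pM2r//.
  have : (d l)%:R <= N%:R + N%:R :> R by rewrite -natrD ler_nat ltnW.
  have := ler0n R (d l); have := ler0n R N.
  by rewrite ler_norml; lra.
have xw (u : (I * 'I_M) * I) : p u = d -> x u.1.1 u.1.2 + w = x u.2 u.1.2.
  move=> pu; apply/rowP; apply/forall_lift; split=> [|l].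
    by rewrite mxE -!/(last_coord _) /x /cell !join_last addr0.
  rewrite mxE /x /cell !join_lift !mxE -pu pE natrB ?natrD; first by ring.
  by rewrite (leq_trans (ltnW (ltn_ord _)))// leq_addr.
apply: (@le_trans _ _ ((\sum_l `|w 0 l|) * P)); last by rewrite ler_wpM2r// perimeter_bound_ge0.
have H := @translation_estimate_in R n.+1 C E P _
  [pred u : (I * 'I_M) * I | [&& u.1 \in G, u.2 \in IZ & p u == d]] (eta / 2)
  (fun u => x u.1.1 u.1.2) w (eta / 2) (ltn0Sn n) mE EP eta20 eta20.
apply: le_trans (H _ _).
- rewrite (eq_bigl [pred u : (I * 'I_M) * I | [&& u.1 \in G, u.2 \in IZ & p u == d]]) => [|u];
  last first.
    by rewrite /= -andbA.
  by apply: ler_sum => u /and3P[_ _ /eqP pu]; rewrite xw.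
(* Within one group the source cell determines the target cell, so distinct pairs have disjoint
   source cubes. *)
- move=> [[i k] j] [[i' k'] j'] /= /and3P[_ _ /eqP pu] /and3P[_ _ /eqP pu'] y h h'.
  have /= [E1 /val_inj E2] := cell_disjoint h h'; subst i' k'; congr (_, _).
  apply/ffunP => l; apply/val_inj => /=.
  have := congr1 (fun f : {ffun 'I_n -> 'I_(N + N)} => nat_of_ord (f l)) (etrans pu (esym pu')).
  rewrite !pE /=; move: (ltn_ord (i l)).
  move: (nat_of_ord (i l)) (nat_of_ord (j l)) (nat_of_ord (j' l)) => i0 j0 j0'.
  by lia.
(* Only the two end cells are known to lie in the interior of [C]; convexity of the interior gives
   the path between them. *)
- move=> [[i k] j] /= /and3P[cG jZ /eqP pu] y t z h t01 zl.
  have h1 : interior C (y + z) by apply: (G_int cG); exact: margin.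
  have h2 : interior C (y + w + z).
    apply: (IZ_int jZ (k := k)); apply: margin => // l.
    have /= <- := xw _ pu.
    have -> : (y + w) 0 l = y 0 l + w 0 l by rewrite mxE.
    have -> : (x i k + w) 0 l = x i k 0 l + w 0 l by rewrite mxE.
    by rewrite opprD addrACA subrr addr0; exact: h.
  have -> : y + t *: w + z = t *: (y + w + z) + (1 - t) *: (y + z).
    by apply/rowP => l; rewrite !mxE; ring.
  exact: interior_convex.
Qed.

Let b i k := fine (mu (Q i k `\` E)).
Let q := eta ^+ n.+1.

Let a_ge0 i k : 0 <= a i k. Proof. by rewrite fine_ge0// outer_measure_ge0. Qed.
Let b_ge0 i k : 0 <= b i k. Proof. by rewrite fine_ge0// outer_measure_ge0. Qed.
Let q_gt0 : 0 < q. Proof. exact: exprn_gt0. Qed.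

Let abE i k : a i k + b i k = q.
Proof.
have fb : mu (Q i k `\` E) \is a fin_num.
  rewrite ge0_fin_numE ?outer_measure_ge0//;
    apply: (@volume_bounded_lty _ _ (ltn0Sn n) _ (x i k) (eta / 2)).
  by move=> y [/cube_subset].
apply/EFin_inj; rewrite EFinD /a /b !fineK//.
have := mE (Q i k); rewrite setIC setDE => <-.
by rewrite volume_cube// mulrC divfK.
Qed.

(** On each level the inner columns have total base area at least [P + kappa], while [E] fills at
    most [eta * P] of them: the complement keeps [eta * kappa]. Multiplying by it and summing the
    pair inequality gives the bound; the summand [N ^ n] bounds the number of inner columns, each
    charged the total 1 of the minima. *)
Lemma good_cells_volume_le kappa : 0 < kappa -> P + kappa <= #|IZ|%:R * eta ^+ n ->
  \sum_(c in G) Num.min (a c.1 c.2) (b c.1 c.2) <= 1 ->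
  \sum_(c in G) a c.1 c.2 <=
  ((2 * N%:R) ^+ n * (n%:R * (N%:R * eta)) * P + N%:R ^+ n) * eta ^+ n / kappa.
Proof.
move=> kappa0 IZP minG.
have level k : eta * kappa <= \sum_(j in IZ) b j k.
  have -> : \sum_(j in IZ) b j k = #|IZ|%:R * q - \sum_(j in IZ) a j k.
    rewrite mulr_natl -sumr_const -sumrB; apply: eq_bigr => j _.
    by rewrite -(abE j k) addrAC subrr add0r.
  have := level_volume_le k; have := ler_wpM2l (ltW eta0) IZP.
  by rewrite /q exprS; lra.
(* If [a i k] is the smaller volume, use [b j k <= q]. Otherwise use [a i k <= q] and write [b j k]
   as [b i k + (a i k - a j k)]. *)
have pair i j k : a i k * b j k <= q * (`|a i k - a j k| + Num.min (a i k) (b i k)).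
  have := abE i k; have := abE j k; have := a_ge0 i k; have := a_ge0 j k.
  have := b_ge0 i k; have := b_ge0 j k.
  move: (a i k) (b i k) (a j k) (b j k) => A B A' B' B'0 B0 A'0 A0 E1 E2.
  have h := ler_norm (A' - A); have h' := ler_norm (A - A'); rewrite distrC in h.
  have [AB|BA] := leP A B.
    apply: (@le_trans _ _ (A * q)); first by rewrite ler_wpM2l//; lra.
    by rewrite mulrC ler_pM2l//; have := normr_ge0 (A - A'); lra.
  apply: (@le_trans _ _ (q * B')); first by rewrite ler_wpM2r//; lra.
  by rewrite ler_pM2l//; lra.
rewrite ler_pdivlMr// -(ler_pM2l eta0).
have -> : eta * ((\sum_(c in G) a c.1 c.2) * kappa) = \sum_(c in G) a c.1 c.2 * (eta * kappa).
  by rewrite -mulr_suml mulrCA.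
apply: (@le_trans _ _ (\sum_(c in G) \sum_(j in IZ) a c.1 c.2 * b j c.2)).
  by apply: ler_sum => c _; rewrite -mulr_sumr ler_wpM2l.
apply: (@le_trans _ _ (\sum_(c in G) \sum_(j in IZ)
    q * (`|a c.1 c.2 - a j c.2| + Num.min (a c.1 c.2) (b c.1 c.2)))).
  by apply: ler_sum => c _; apply: ler_sum => j _; exact: pair.
under eq_bigr do rewrite -mulr_sumr big_split/= sumr_const.
rewrite -mulr_sumr big_split/=.
rewrite [leRHS]mulrCA -exprS -/q mulrC ler_pM2r//.
rewrite lerD ?pair_oscillation_le// sumrMnl -[leLHS]mulr_natr.
apply: (@le_trans _ _ (1 * #|IZ|%:R)); first by rewrite ler_wpM2r.
rewrite mul1r -natrX ler_nat (leq_trans (max_card _))//.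
by rewrite card_ffun !card_ord.
Qed.

End GridEstimate.

(** The faces are null, since the open and the closed cube have the same finite volume. *)
Lemma volume_ccube_le_cube (R : realType) (m : nat) (E : set 'rV[R]_m) (x : 'rV[R]_m) (r : R) :
  (0 < m)%N -> 0 < r ->
  (volume R m (E `&` ccube x r) <= volume R m (E `&` cube x r))%E.
Proof.
move=> m0 r0; have face : volume R m (ccube x r `&` ~` cube x r) = 0%E.
  have := cube_measurable x r (ccube x r).
  rewrite setIC setIidl; last exact: cube_subset.
  have fz : volume R m (ccube x r `&` ~` cube x r) \is a fin_num.
    rewrite ge0_fin_numE ?outer_measure_ge0//; apply: (@volume_bounded_lty _ _ m0 _ x r).
    by move=> y [].
  rewrite volume_cube// volume_ccube//.
  move: (volume R m _) fz => [z| |]// _; rewrite -EFinD => -[h].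
  by congr EFin; move: h; lra.
rewrite -[leRHS]adde0 -face; apply: le_trans (outer_measureU2 _ _ _).
apply: le_outer_measure => y [Ey xy].
by have [h|h] := pselect (cube x r y); [left|right].
Qed.

(** * A bound on the volume of [E], uniform in [E] *)

Section LowerBound.
Context {R : realType} {n : nat}.
Hypothesis n_gt0 : (0 < n)%N.
Local Notation mu := (volume R n.+1).
Local Notation cara := (caratheodory_type mu).
Variables (C : set 'rV[R]_n.+1) (s B M : R).
Hypothesis clC : closed C.
Hypothesis cC : convex C.
Hypothesis s1 : s = 1 \/ s = -1.
Hypothesis C_up : forall x t, C x -> 0 <= t -> C (x + (s * t) *: delta_mx 0 ord_max).
Hypothesis C_bounded : forall x i, C x -> `|horizontal_projection x 0 i| <= B.
Hypothesis C_low : forall x, C x -> M <= s * last_coord x.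
Variables (p : 'rV[R]_n.+1) (r : R).
Hypotheses (r0 : 0 < r) (pC : cube p r `<=` C).
Let K := closure (horizontal_projection @` C).
Let q := horizontal_projection p.

Let norm_s : `|s| = 1. Proof. by case: s1 => ->; rewrite ?normrN normr1. Qed.
Let cK : convex K. Proof. exact: base_convex. Qed.
Let qK : cube q r `<=` K.
Proof. exact: subset_trans (proj_cube r0 pC) (@subset_closure _ _). Qed.

Lemma exists_scaling (m : nat) (a e : R) : 0 <= a -> 0 < e ->
  exists2 t : R, 0 < t < 1 & a - e <= t ^+ m * a.
Proof.
move=> a0 e0; apply: contrapT => H.
suff : a <= a - e by lra.
apply: (@ler_of_scaling _ m) => // t t0 t1; rewrite leNgt; apply/negP => h.
by apply: H; exists t; [rewrite t0|rewrite ltW].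
Qed.

Lemma convex_sublevel t : convex (sublevel C s t).
Proof.
move=> x y u [Cx xt] [Cy yt] u01; split; first exact: cC.
move: xt yt u01; rewrite /= /last_coord !mxE => xt yt /andP[u0 u1].
have := ler_wpM2l u0 xt; have := @ler_wpM2l _ (1 - u) _ _ _ yt; rewrite subr_ge0.
by move=> /(_ u1); lra.
Qed.

Lemma dilated_sublevel_closed t u : 0 < u ->
  closed [set (1 - u) *: p + u *: y | y in sublevel C s t].
Proof.
move=> u0; have -> : [set (1 - u) *: p + u *: y | y in sublevel C s t] =
    (fun z => u^-1 *: (z - (1 - u) *: p)) @^-1` sublevel C s t.
  apply/seteqP; split => [_ [y Cy <-]|z Cz] /=.
    by rewrite addrC addKr scalerA mulVf ?gt_eqF// scale1r.
  exists (u^-1 *: (z - (1 - u) *: p)) => //.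
  by rewrite scalerA mulfV ?gt_eqF// scale1r addrC subrK.
apply: closed_comp; last exact: (closed_sublevel clC s1).
move=> z _; apply: continuous_comp; last exact: scaler_continuous.
by apply: continuousB; [exact: cvg_id|exact: cst_continuous].
Qed.

Section Grid.
Variables (E : set 'rV[R]_n.+1) (eps lam b T : R).
Hypothesis mE : measurable (E : set cara).
Hypothesis Eoo : (mu E < +oo)%E.
Hypotheses (eps0 : 0 < eps) (lam0 : 0 < lam) (lam1 : lam < 1).
Hypothesis lamK : fine (volume R n K) - eps / 2 <= lam ^+ n * fine (volume R n K).
Hypothesis bB : B <= b.
Hypothesis b0 : 0 < b.
Hypothesis T_height : forall y t, ccube y ((1 - lam) * r / 2) `<=` K -> T - 1 <= t ->
  interior C (join y (s * t)).
Hypothesis T_p : s * last_coord p <= T.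
Let P := fine (volume R n K) - eps.
Hypothesis EP : (relative_perimeter C E <= P%:E)%E.
Let W := 2 * b.
Let o : 'rV[R]_n := const_mx (- b).

(** The bound of [good_cells_volume_le] for [kappa = eps / 2], with [N * eta] replaced by [W]: no
    trace of the mesh or of [E] is left. *)
Definition volume_bound : R := ((2 * W) ^+ n * (n%:R * W) * P + W ^+ n) / (eps / 2).

Let W0 : 0 < W. Proof. by rewrite mulr_gt0. Qed.

Let Ko N (eta : R) y l : eta * N%:R = W -> K y -> o 0 l <= y 0 l <= o 0 l + eta * N%:R.
Proof.
move=> -> Ky; rewrite mxE; have := base_bounded C_bounded l Ky.
rewrite ler_norml => /andP[h1 h2]; rewrite /W.
by apply/andP; split; move: bB h1 h2; lra.
Qed.

Let Kl : set 'rV[R]_n := [set (1 - lam) *: q + lam *: y | y in K].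

(** The distances [(1 - lam) * r / 2], [eta] and [eta / 2] add up to less than the margin
    [(1 - lam) * r] around a contracted point. Enlarged cells reach at most [eta / 2] below [T],
    which is why heights are required from [T - 1] on. *)
Let deep N (eta : R) (i : {ffun 'I_n -> 'I_N}) k : 0 < eta -> eta <= 1 ->
  eta <= (1 - lam) * r / 4 ->
  i \in grid_trace Kl N o eta -> ccube (cell o eta T s i k) eta `<=` interior C.
Proof.
move=> e0 e1 el; rewrite inE => /asboolP[_ [y Ky <-] yi] z /ccube_join[z1 z2].
rewrite -(join_eta z).
have -> : last_coord z = s * (s * last_coord z).
  by rewrite mulrA; case: s1 => ->; rewrite ?mulrNN mulr1 mul1r.
apply: T_height; last first.
  move: z2; rewrite (cell_height s1) ler_norml => /andP[h _].
  have := ler0n R k; have := mulr_ge0 (ltW e0) (ler0n R k); move: e1 h; lra.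
move=> u zu.
have sub : cube (q + lam *: (y - q)) ((1 - lam) * r) `<=` K.
  by apply: convex_dilate_cube => //; rewrite ltW.
apply: sub => l; have := zu l; have := z1 l; have := yi l.
have -> : ((1 - lam) *: q + lam *: y) 0 l = (1 - lam) * q 0 l + lam * y 0 l by rewrite !mxE.
have -> : (q + lam *: (y - q)) 0 l = q 0 l + lam * (y 0 l - q 0 l) by rewrite !mxE.
move: (grid_center o eta i 0 l) (u 0 l) (horizontal_projection z 0 l) (y 0 l) (q 0 l).
move=> g v w y' q' h1 h2 h3.
have -> : v - (q' + lam * (y' - q')) = (v - w) + (w - g) - ((1 - lam) * q' + lam * y' - g) by ring.
rewrite (le_lt_trans (ler_normB _ _))//.
have := ler_normD (v - w) (w - g); move: h1 h2 h3 el e0; lra.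
Qed.

(** Cells near the boundary of [C] may leave [C]. So the sublevel is contracted towards [p] by [u]:
    for a fine mesh the part of [E] in the contracted set [F] and above [T] is covered by good
    cells. The volume lost is at most [(1 - u ^ (n+1)) * V]. The mesh depends on [u] and on [E], the
    bound does not, and [u] can tend to 1. *)
Lemma sublevel_part_le L :
  (mu (E `&` (sublevel C s (T + W * L.+1%:R)%R `&` [set x | (T <= s * last_coord x)%R]))
   <= volume_bound%:E)%E.
Proof.
set T' := T + _; set S := _ `&` [set x | _].
pose V := fine (mu (sublevel C s T')).
have finV : mu (sublevel C s T') \is a fin_num by exact: (sublevel_volume_fin s1 C_bounded C_low).
have finS : mu (E `&` S) \is a fin_num.
  rewrite ge0_fin_numE ?outer_measure_ge0//; apply: le_lt_trans Eoo.
  by apply: le_outer_measure => y [].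
rewrite -(fineK finS) lee_fin; set vS := fine _.
(* A form to which [ler_of_scaling] applies, with [V] alone on the left. *)
suff : V <= volume_bound + V - vS by lra.
apply: (@ler_of_scaling _ n.+1); first by rewrite fine_ge0// outer_measure_ge0.
move=> u u0 u1.
pose F := [set (1 - u) *: p + u *: y | y in sublevel C s T'].
have T'p : s * last_coord p <= T'.
  by rewrite (le_trans T_p)// /T' lerDl mulr_ge0// ltW.
have pS : sublevel C s T' p.
  by split => //; apply: pC => l; rewrite subrr normr0.
have FS : F `<=` sublevel C s T'.
  move=> _ [y Sy <-]; rewrite addrC; apply: convex_sublevel => //.
  by rewrite (ltW u0) (ltW u1).
have mF : measurable (F : set cara).
  by apply: closed_measurable_volume; exact: dilated_sublevel_closed.
have FV : mu (sublevel C s T' `&` ~` F) = (V - u ^+ n.+1 * V)%:E.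
  have := mF (sublevel C s T'); rewrite setIC setIidl//.
  rewrite (_ : mu F = (u ^+ n.+1 * V)%:E); last first.
    by rewrite EFinM fineK// -(volume_affine ((1 - u) *: p)).
  rewrite -[X in X = _](fineK finV) -/V.
  have : mu (sublevel C s T' `&` ~` F) \is a fin_num.
    rewrite ge0_fin_numE ?outer_measure_ge0//;
      apply: le_lt_trans (_ : mu (sublevel C s T') < +oo)%E.
      by apply: le_outer_measure => y [].
    by rewrite -ge0_fin_numE ?outer_measure_ge0.
  move: (mu _) => [z| |]// _; rewrite -EFinD => -[h].
  by congr EFin; move: h; lra.
suff EF : (mu (E `&` S `&` F) <= volume_bound%:E)%E.
  have : (mu (E `&` S) <= volume_bound%:E + (V - u ^+ n.+1 * V)%:E)%E.
    rewrite -FV; apply: le_trans (leeD2r _ EF); apply: le_trans (outer_measureU2 _ _ _).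
    apply: le_outer_measure => y [Ey Sy].
    by have [h|h] := pselect (F y); [left|right; split => //; case: Sy].
  by rewrite -(fineK finS) -EFinD lee_fin -/vS; lra.
pose rho := b + `|T| + `|T'| + 1.
have rho0 : 0 < rho by rewrite /rho; have := normr_ge0 T; have := normr_ge0 T'; move: b0; lra.
have [d d0 osc] := oscillation_small (ltn0Sn n) ltr01 rho0 mE.
(* The bounds 1 and [(1 - lam) * r / 4] serve [deep], [d] serves the oscillation estimate, and
   [(1 - u) * r / 4] keeps the cells that meet [F] inside [C]. *)
pose delta := Num.min (Num.min 1 d) (Num.min ((1 - lam) * r / 4) ((1 - u) * r / 4)).
have delta0 : 0 < delta.
  by rewrite !lt_min ltr01 d0 !divr_gt0// mulr_gt0// subr_gt0.
pose N := (Num.bound (W / delta)).+1.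
have N0 : 0 < N%:R :> R by rewrite ltr0n.
pose eta := W / N%:R; have eta0 : 0 < eta by rewrite divr_gt0.
have etaN : eta * N%:R = W by rewrite /eta divfK ?gt_eqF.
have : eta <= delta.
  rewrite /eta ler_pdivrMr// mulrC -ler_pdivrMr// (le_trans (ltW (archi_boundP _)))//.
    by rewrite divr_ge0// ltW.
  by rewrite ler_nat leqnSn.
rewrite /delta !le_min => /andP[/andP[e1 ed] /andP[el eu]].
have eta20 : 0 < eta / 2 by rewrite divr_gt0.
pose I := {ffun 'I_n -> 'I_N}; pose J := 'I_(N * L.+1).
pose x (c : I * J) := cell o eta T s c.1 c.2.
pose G : {set I * J} := [set c | `[< ccube (x c) eta `<=` interior C >]]%SET.
(* The height [W * L.+1] is a whole number of mesh steps, so [N * L.+1] levels fill it exactly. *)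
have ET : T' - T = eta * (N * L.+1)%:R by rewrite natrM mulrA etaN /T' addrC addKr.
have cover y : (E `&` S `&` F) y -> exists2 c, c \in G & (E `&` ccube (x c) (eta / 2)) y.
  move=> [[Ey [[Cy /= yT'] /= Ty]] [z [Cz _] zy]].
  have Ky : K (horizontal_projection y) by apply: subset_closure; exists y.
  have [i yi] := grid_cover eta0 (ltn0Sn _) (fun l => Ko l etaN Ky).
  have [||k /andP[k1 k2]] := @grid_interval R (N * L.+1) ((s * last_coord y - T) / eta).
  - by rewrite muln_gt0.
  - by rewrite divr_ge0 ?subr_ge0 ?(ltW eta0)//= ler_pdivrMr// [leRHS]mulrC -ET lerD2r.
  have yc : ccube (x (i, k)) (eta / 2) y.
    apply/ccube_join; split => //; rewrite (cell_height s1).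
    move: k1 k2; rewrite ler_pdivlMr// ler_pdivrMr// ler_norml => k1 k2.
    by apply/andP; split; move: k1 k2; lra.
  exists (i, k) => //; rewrite inE; apply/asboolP => t xt.
  have sub : cube (p + u *: (z - p)) ((1 - u) * r) `<=` C.
    by apply: convex_dilate_cube => //; rewrite (ltW u0).
  apply: filterS sub _; apply: open_nbhs_nbhs; split; first exact: open_cube.
  move=> l; have := xt l; have := yc l.
  have -> : (p + u *: (z - p)) 0 l = y 0 l by rewrite -zy !mxE; ring.
  move: (x (i, k) 0 l) (y 0 l) (t 0 l) => g y' t' h1 h2.
  have -> : t' - y' = (t' - g) - (y' - g) by ring.
  by rewrite (le_lt_trans (ler_normB _ _))//; move: h1 h2 eu eta0; lra.
have minG : \sum_(c in G) Num.min (fine (mu (E `&` cube (x c) (eta / 2))))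
    (fine (mu (cube (x c) (eta / 2) `\` E))) <= 1.
  have box c : cube (x c) (eta / 2) `<=` ccube 0 rho.
    move=> y /cube_join[yh yv]; apply/forall_lift; split=> [|l]; rewrite mxE subr0.
      rewrite -/(last_coord y) -[leLHS]mul1r -norm_s -normrM.
      move: yv; rewrite (cell_height s1) ltr_norml => /andP[h1 h2].
      have h3 : eta * (c.2%:R + 1) <= T' - T.
        by rewrite ET ler_pM2l// natr1 ler_nat.
      have h4 := mulr_ge0 (ltW eta0) (ler0n R c.2).
      have := ler_norm T'; have := ler_norm (- T); rewrite normrN.
      have := normr_ge0 T; have := normr_ge0 T'.
      by rewrite ler_norml /rho; move: b0; lra.
    have gE : grid_center o eta c.1 0 l = - b + eta * ((c.1 l)%:R + 2^-1) by rewrite !mxE.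
    rewrite -proj_coord; have := yh l; rewrite gE ltr_norml => /andP[h1 h2].
    have h3 : eta * ((c.1 l)%:R + 1) <= W by rewrite -etaN ler_pM2l// natr1 ler_nat.
    have h4 := mulr_ge0 (ltW eta0) (ler0n R (c.1 l)).
    have := normr_ge0 T; have := normr_ge0 T'.
    by rewrite ler_norml /rho; move: b0 h3; rewrite /W; lra.
  have disj (c c' : I * J) y : cube (x c) (eta / 2) y -> cube (x c') (eta / 2) y -> c = c'.
    case: c c' => [i k] [i' k'] h h'.
    by have /= [-> /val_inj ->] := cell_disjoint s1 eta0 h h'.
  have eta2d : eta / 2 <= d by move: ed eta0; lra.
  rewrite -lee_fin -sumEFin; apply: le_trans (osc _ x (eta / 2) eta2d box disj).
  rewrite big_mkcond/=; apply: lee_sum => c _; case: ifP => _; last first.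
    by rewrite le_min !outer_measure_ge0.
  have fQ X : mu (cube (x c) (eta / 2) `&` X) \is a fin_num.
    rewrite ge0_fin_numE ?outer_measure_ge0//; apply: (@volume_bounded_lty _ _ (ltn0Sn n) _ 0 rho).
    by move=> y [/box].
  by rewrite [E `&` _]setIC setDE EFin_min (fineK (fQ E)) (fineK (fQ (~` E))).
have IZP : P + eps / 2 <= #|grid_trace Kl N o eta|%:R * eta ^+ n.
  apply: (@le_trans _ _ (lam ^+ n * fine (volume R n K))).
    by move: lamK; rewrite /P; lra.
  rewrite -lee_fin EFinM fineK; last exact: (base_volume_fin_num n_gt0 (base_bounded C_bounded)).
  rewrite -(volume_affine ((1 - lam) *: q))//; apply: le_grid_trace => //.
  move=> _ l [y Ky <-]; apply: Ko => //; rewrite addrC; apply: cK => //.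
    by apply: qK => j; rewrite subrr normr0.
  by rewrite (ltW lam0) ltW.
have G_int c : c \in G -> ccube (x c) eta `<=` interior C by rewrite inE => /asboolP.
have eps20 : 0 < eps / 2 by rewrite divr_gt0.
have good := good_cells_volume_le cC s1 mE Eoo EP eta0
  (fun i k => @deep N eta i k eta0 e1 el) (G := G) G_int eps20 IZP minG.
apply: (le_trans (le_outer_measure_finite mu cover)).
apply: (@le_trans _ _ (\sum_(c in G) fine (mu (E `&` cube (x c) (eta / 2))))%:E).
  rewrite -sumEFin; apply: lee_sum => c _; rewrite fineK; last first.
    rewrite ge0_fin_numE ?outer_measure_ge0//; apply: le_lt_trans Eoo.
    by apply: le_outer_measure => y [].
  exact: volume_ccube_le_cube.
rewrite lee_fin; apply: (le_trans good).
rewrite /volume_bound ler_pM2r ?invr_gt0 ?divr_gt0//.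
have -> : (2 * W) ^+ n = (2 * N%:R) ^+ n * eta ^+ n by rewrite -exprMn -etaN; congr (_ ^+ _); ring.
have -> : W ^+ n = N%:R ^+ n * eta ^+ n by rewrite -exprMn -etaN mulrC.
by rewrite -etaN [eta * _]mulrC le_eqVlt; apply/orP; left; apply/eqP; ring.
Qed.

Hypothesis EC : E `<=` C.

(** [sublevel_part_le] is uniform in [L], so continuity from below along growing sublevels gives the
    bound for all of [E]. *)
Lemma volume_le_bound :
  fine (mu E) <= fine (mu (sublevel C s T)) + volume_bound.
Proof.
rewrite -lee_fin fineK; last by rewrite ge0_fin_numE ?outer_measure_ge0.
pose F L := E `&` sublevel C s (T + W * L.+1%:R).
have mF L : measurable (F L : set cara).
  by apply: measurableI => //; apply: closed_measurable_volume; exact: closed_sublevel.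
have FE : \bigcup_L F L = E.
  apply/seteqP; split => [x [L _ []]//|x Ex].
  exists (Num.bound (`|s * last_coord x - T| / W)) => //; split => //; split; first exact: EC.
  rewrite /= -lerBlDl (le_trans (ler_norm _))// [leRHS]mulrC -ler_pdivrMr//.
  rewrite (le_trans (ltW (archi_boundP _)))//; first by rewrite divr_ge0// ltW.
  by rewrite ler_nat leqnSn.
have F_mono : {homo F : L L' / (L <= L')%N >-> (L <= L')%O}.
  move=> L L' LL'; rewrite subsetEset => x [Ex Sx]; split => //.
  by apply: sublevel_mono Sx; rewrite lerD2l ler_pM2l// ler_nat.
have cvgF := @nondecreasing_cvg_mu _ _ _ (volume_measure R n.+1) F mF
  (bigcup_measurable (fun L _ => mF L)) F_mono.
rewrite FE in cvgF; apply: (cvge_to_le cvgF); apply: nearW => L /=.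
have fT := sublevel_volume_fin s1 C_bounded C_low T.
rewrite EFinD fineK//; apply: le_trans (leeD2l _ (sublevel_part_le L)).
apply: le_trans (outer_measureU2 _ _ _); apply: le_outer_measure => x [Ex [Cx xT]].
by have [h|h] := leP (s * last_coord x) T; [left|right; split => //; split => //=; exact: ltW].
Qed.

End Grid.

Lemma isoperimetric_profile_ge eps : 0 < eps -> exists v0 : R, forall v, v0 < v ->
  ((fine (volume R n K) - eps)%:E <= isoperimetric_profile C v)%E.
Proof.
move=> eps0; have eps20 : 0 < eps / 2 by rewrite divr_gt0.
have k0 : 0 <= fine (volume R n K) by rewrite fine_ge0// outer_measure_ge0.
have [lam /andP[lam0 lam1] lamK] := exists_scaling n k0 eps20.
have d0 : 0 < (1 - lam) * r / 2 by rewrite divr_gt0// mulr_gt0// subr_gt0.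
have [T0 HT0] := uniform_height cC s1 C_up C_bounded r0 pC d0.
(* The 1 leaves room for the cells that reach below [T]; the other term puts [p] into all sublevels
   considered. *)
pose T := Num.max (T0 + 1) (s * last_coord p).
have TT0 : T0 + 1 <= T by rewrite le_max lexx.
have Tp : s * last_coord p <= T by rewrite le_max lexx orbT.
pose b := `|B| + 1; have b0 : 0 < b by rewrite ltr_wpDl.
have bB : B <= b by rewrite /b (le_trans (ler_norm B))// lerDl.
exists (fine (mu (sublevel C s T)) + volume_bound eps b) => v vv.
apply: le_ereal_inf_tmp => _ [E [mE EC Ev] <-]; rewrite leNgt; apply/negP => lt.
have Eoo : (mu E < +oo)%E by rewrite Ev ltry.
have T_height y t : ccube y ((1 - lam) * r / 2) `<=` K -> T - 1 <= t -> interior C (join y (s * t)).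
  by move=> yK Tt; apply: HT0 => //; move: TT0 Tt; lra.
have := volume_le_bound mE Eoo eps0 lam0 lam1 lamK bB b0 T_height Tp (ltW lt) EC.
by rewrite Ev /= leNgt vv.
Qed.

End LowerBound.

Theorem theorem4p1 (R : realType) (n : nat) (n_ge1 : (1 <= n)%N)
    (C : set 'rV[R]_n.+1) (K : set 'rV[R]_n)
    (C_body : cylindrically_bounded_convex_body C)
    (C_cyl : asymptotic_cylinder C = cylinder K) :
  isoperimetric_profile C v @[v --> +oo%R] --> hausdorff n K.
Proof.
have [s [s1 C_up [M C_low]]] := cylindrically_bounded_vertical C_body.
case: C_body => -[clC _ /convex_set_convex cC [p /interior_cube[r r0 pC]]] [bC _].
have {}pC : cube p r `<=` C := subset_trans pC (@interior_subset _ _).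
have [B _ HB] := (bounded_ccubeP _).1 bC.
have C_bounded x i : C x -> `|horizontal_projection x 0 i| <= B.
  by move=> Cx; have := HB _ (imageP _ Cx) i; rewrite [X in _ - X]mxE subr0.
rewrite (asymptotic_cylinder_base C_cyl);
  pose k := volume R n (closure (horizontal_projection @` C)).
have fK := base_volume_fin_num n_ge1 (base_bounded C_bounded).
rewrite (_ : hausdorff n _ = (fine k)%:E); last by rewrite fineK.
have upper v : 0 < v -> (isoperimetric_profile C v <= (fine k)%:E)%E.
  by move=> v0; rewrite fineK//;
    exact: (isoperimetric_profile_le n_ge1 clC cC s1 C_up C_bounded C_low r0 pC v0).
have lower := isoperimetric_profile_ge n_ge1 clC cC s1 C_up C_bounded C_low r0 pC.
(* Once the profile is finite near infinity, convergence in the extended reals reduces to real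
   convergence; the lower bound with [eps = 1] is enough for this. *)
have fin : \forall v \near +oo%R, isoperimetric_profile C v \is a fin_num.
  have [v0 Hv0] := lower 1 ltr01; near=> v.
  have vv0 : v0 < v by near: v; apply: nbhs_pinfty_gt; exact: num_real.
  have vp : 0 < v by near: v; apply: nbhs_pinfty_gt; exact: num_real.
  by rewrite fin_numElt (lt_le_trans (ltNyr _) (Hv0 v vv0)) (le_lt_trans (upper v vp) (ltry _)).
apply: cvg_EFin => //; apply/cvgrPdist_le => e e0.
have [v0 Hv0] := lower e e0; near=> v.
have fv : isoperimetric_profile C v \is a fin_num by near: v.
have vv0 : v0 < v by near: v; apply: nbhs_pinfty_gt; exact: num_real.
have vp : 0 < v by near: v; apply: nbhs_pinfty_gt; exact: num_real.
have h1 := upper v vp; have h2 := Hv0 v vv0.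
move: h1 h2; rewrite -(fineK fv) !lee_fin /= => h1 h2.
by rewrite ler_norml; apply/andP; split; move: h1 h2 e0; lra.
Unshelve. all: by end_near. Qed.
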